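(* Let $\alpha>0$ and let $\mu$ be a positive Borel measure on $(0,\infty)$. Then $\mathcal{H}_\mu:F^{1}_\alpha\to F^{\infty,1,\alpha}$ is bounded if and only if $\sup_{n\ge0} \mu_{n}\sqrt{n+1}<\infty$.
   Context: For $\alpha>0$, $F^1_\alpha$ is the space of entire functions $f$ with $\|f\|_{1,\alpha}=\frac{\alpha}{2\pi}\int_{\mathbb C}|f(z)|e^{-\frac{\alpha}{2}|z|^2}\,dA(z)<\infty$ ($dA$ is area measure). With $M_\infty(f,r)=\sup_{|z|=r}|f(z)|$, the mixed norm Fock space $F^{\infty,1,\alpha}$ is the space of entire functions $f$ with $\|f\|_{\infty,1,\alpha}=\alpha\int_0^\infty M_\infty(f,r)e^{-\frac{\alpha}{2}r^2}\,r\,dr<\infty$. The Hausdorff operator is $\mathcal{H}_\mu(f)(z)=\int_0^\infty f\left(\frac{z}{t}\right)\frac{d\mu(t)}{t}$ for entire $f$, and $\mu_n=\int_0^\infty\frac{d\mu(t)}{t^{n+1}}$ for $n=0,1,2,\dots$. ''$\mathcal{H}_\mu:X\to Y$ is bounded'' means it is well defined on $X$ with values in $Y$ and there is $C>0$ with $\|\mathcal{H}_\mu f\|_Y\le C\|f\|_X$ for all $f\in X$. *)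

(* Defs.v *)
From HB Require Import structures.
From mathcomp Require Import all_boot all_order all_algebra.
From mathcomp Require Import all_classical all_reals all_analysis.
From mathcomp Require Import complex.
Set Implicit Arguments.
Unset Strict Implicit.
Unset Printing Implicit Defensive.
Import Order.TTheory GRing.Theory Num.Theory.
Import numFieldNormedType.Exports.
Local Open Scope classical_set_scope.
Local Open Scope ring_scope.
Local Open Scope complex_scope.

(* Complex differentiability at every point: the scalars are R[i], and R[i]^o
   is R[i] as a normed module over itself. *)
Definition entire (R : realType) (f : R[i] -> R[i]) : Prop :=
  forall z : R[i], derivable (f : R[i]^o -> R[i]^o) z 1.

(* Area measure is the product Lebesgue measure, through (x, y) |-> x +i* y. *)
Definition fock1_norm (R : realType) (alpha : R) (f : R[i] -> R[i]) : \bar R :=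
  ((alpha / (2 * pi))%:E *
   \int[(@lebesgue_measure R) \x (@lebesgue_measure R)]_p
     (Normc.normc (f (p.1 +i* p.2)) *
      expR (- (alpha / 2) * (Normc.normc (p.1 +i* p.2)) ^+ 2))%:E)%E.

Definition fock1 (R : realType) (alpha : R) : set (R[i] -> R[i]) :=
  [set f | entire f /\ (fock1_norm alpha f < +oo)%E].

Definition Minfty (R : realType) (f : R[i] -> R[i]) (r : R) : \bar R :=
  ereal_sup [set (Normc.normc (f z))%:E | z in [set z | Normc.normc z = r]].

Definition mixed_fock_norm (R : realType) (alpha : R) (f : R[i] -> R[i]) :
    \bar R :=
  (alpha%:E *
   \int[@lebesgue_measure R]_(r in `]0%R, +oo[)
     (Minfty f r * (expR (- (alpha / 2) * r ^+ 2) * r)%:E))%E.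

Definition mixed_fock (R : realType) (alpha : R) : set (R[i] -> R[i]) :=
  [set f | entire f /\ (mixed_fock_norm alpha f < +oo)%E].

Section complex_integral.
Context d (T : measurableType d) (R : realType).
Variable mu : {measure set T -> \bar R}.

Definition cintegrable (D : set T) (g : T -> R[i]) : Prop :=
  mu.-integrable D (fun t => (complex.Re (g t))%:E) /\
  mu.-integrable D (fun t => (complex.Im (g t))%:E).

Definition cintegral (D : set T) (g : T -> R[i]) : R[i] :=
  (\int[mu]_(t in D) complex.Re (g t)) +i*
  (\int[mu]_(t in D) complex.Im (g t)).

End complex_integral.

(* A Borel measure on ]0, +oo[ is given as a Borel measure mu on R of which only
   the restriction to ]0, +oo[ is ever used. *)
Section hausdorff.
Context (R : realType).
Variable mu : {measure set (measurableTypeR R) -> \bar R}.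

Definition hausdorff_integrand (f : R[i] -> R[i]) (z : R[i]) (t : R) : R[i] :=
  f (z / t%:C) / t%:C.

(* The defining integral converges absolutely at every z. *)
Definition hausdorff_defined (f : R[i] -> R[i]) : Prop :=
  forall z, cintegrable mu `]0, +oo[ (hausdorff_integrand f z).

Definition hausdorff (f : R[i] -> R[i]) (z : R[i]) : R[i] :=
  cintegral mu `]0, +oo[ (hausdorff_integrand f z).

Definition moment (n : nat) : \bar R :=
  (\int[mu]_(t in `]0%R, +oo[) ((t ^+ n.+1)^-1)%:E)%E.

Definition hausdorff_bounded (X : set (R[i] -> R[i]))
    (normX : (R[i] -> R[i]) -> \bar R) (Y : set (R[i] -> R[i]))
    (normY : (R[i] -> R[i]) -> \bar R) : Prop :=
  (forall f, X f -> hausdorff_defined f /\ Y (hausdorff f)) /\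
  (exists C : R, 0 < C /\
    forall f, X f -> (normY (hausdorff f) <= C%:E * normX f)%E).

End hausdorff.

(* Main.v *)
(* Sufficiency. For entire f, Cauchy's estimate applied to f (w) exp (alpha conj(z) (z - w)) gives
   |f z| <= C int |f w| exp (alpha |z| |w| - alpha |w|^2) dA(w). Inserting this in H_mu f, taking
   the maximum over |z| = r and integrating in r reduces the norm inequality to
     int (1 + alpha rho / t) exp (s / t^2) dmu(t) / t <= C exp s,   s = alpha rho^2 / 2,
   because int_0^oo r exp (b r - alpha r^2 / 2) dr is O ((1 + b) exp (b^2 / (2 alpha)));
   expanding the exponential, this follows from mu_n = O(1 / sqrt (n + 1)). Bounded moments
   also force mu to live on [1, +oo[, which makes H_mu f entire.
   Necessity. Testing on exp (alpha rho w), whose norm is a constant times exp s, gives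
   rho int exp (s / t^2) dmu(t) / t^2 <= C exp s for every rho > 0, and
   t^-n <= exp (n (t^-2 - 1) / 2) turns the choice s = n / 2 into the moment bound. *)

Require Import Defs.
From HB Require Import structures.
From mathcomp Require Import all_boot all_order all_algebra.
From mathcomp Require Import all_classical all_reals all_analysis.
From mathcomp Require Import measurable_realfun complex.
From mathcomp Require Import ring lra zify.
Set Implicit Arguments.
Unset Strict Implicit.
Unset Printing Implicit Defensive.
Import Order.TTheory GRing.Theory Num.Theory.
Import numFieldNormedType.Exports.
Local Open Scope classical_set_scope.
Local Open Scope ring_scope.
Local Open Scope complex_scope.

(** * Complex derivatives *)

(** The pointwise bound carries the weight exp (- alpha |w|^2), the square of the weight in the norm
    of F^1. The surplus exp (- alpha |w|^2 / 2) pays exactly for the factor exp s with rho = |w|.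
    The rate 1 / sqrt (n + 1) matters only for the odd moments. The radial integral produces a
    linear factor alpha rho / t with alpha rho = sqrt (2 alpha s), the main terms of the exponential
    series have index k near s, and there the decay of mu_(2k+1) offsets the factor. For the even
    moments boundedness suffices. The measure mu may fail to be sigma-finite, so Tonelli's theorem
    is never applied to it. The kernels exp (x / t) / t are expanded in powers instead: each term is
    a product of a function of x and a function of t, and sums of nonnegative terms commute with
    integrals for any measure. Cauchy's estimate is proved on squares, not circles: averaging over
    the size of the square then yields area integrals in Cartesian coordinates. Numerical constants
    are crude throughout, since only boundedness is at stake. *)

Section complex_modulus.
Context {R : realType}.
Implicit Types (z w : R[i]) (x y : R).
Local Notation normc := (@Normc.normc R).

Lemma normc_normr z : `|z| = (normc z)%:C.
Proof. by []. Qed.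

Lemma normc_ge0 z : 0 <= normc z.
Proof. by case: z => x y; exact: sqrtr_ge0. Qed.

Lemma normc_Re z : `|complex.Re z| <= normc z.
Proof.
case: z => x y /=; rewrite -sqrtr_sqr ler_sqrt ?sqr_ge0 ?addr_ge0 ?sqr_ge0//.
by rewrite lerDl sqr_ge0.
Qed.

Lemma normc_Im z : `|complex.Im z| <= normc z.
Proof.
case: z => x y /=; rewrite -sqrtr_sqr ler_sqrt ?sqr_ge0 ?addr_ge0 ?sqr_ge0//.
by rewrite lerDr sqr_ge0.
Qed.

Lemma normc_le_ReIm z : normc z <= `|complex.Re z| + `|complex.Im z|.
Proof.
case: z => x y /=; rewrite -[leRHS]ger0_norm ?addr_ge0 ?normr_ge0//.
rewrite -sqrtr_sqr ler_sqrt ?sqr_ge0// sqrrD !real_normK ?num_real//.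
by rewrite -addrA [_ *+ 2 + _]addrC addrA lerDl mulrn_wge0 ?mulr_ge0.
Qed.

Lemma sqr_normcE z : normc z ^+ 2 = complex.Re z ^+ 2 + complex.Im z ^+ 2.
Proof. by case: z => x y /=; rewrite sqr_sqrtr// addr_ge0 ?sqr_ge0. Qed.

Lemma normc_eq0 z : (normc z == 0) = (z == 0).
Proof. by apply/eqP/eqP => [/Normc.eq0_normc//|->]; rewrite Normc.normc0. Qed.

Lemma normc_gt0 z : (0 < normc z) = (z != 0).
Proof. by rewrite lt_neqAle normc_ge0 andbT eq_sym normc_eq0. Qed.

Lemma normc_real x : normc x%:C = `|x|.
Proof. by rewrite /= expr0n addr0 sqrtr_sqr. Qed.

Lemma normcX z n : normc (z ^+ n) = normc z ^+ n.
Proof.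
elim: n => [|n IH]; first by rewrite !expr0 Normc.normc1.
by rewrite !exprS Normc.normcM IH.
Qed.

Lemma normcB z w : normc (z - w) = normc (w - z).
Proof. by rewrite -(normcN (z - w)) opprB. Qed.

Lemma ler_normcB z w : normc (z - w) <= normc z + normc w.
Proof. by rewrite -(normcN w) le_normcD. Qed.

Lemma ler_dist_normc z w : `|normc z - normc w| <= normc (z - w).
Proof.
have H (u v : R[i]) : normc u - normc v <= normc (u - v).
  by rewrite lerBlDr -[leLHS](congr1 normc (subrK v u)) le_normcD.
by rewrite ler_norml H andbT lerNl opprB normcB H.
Qed.

End complex_modulus.

Section complex_derivative.
Context {R : realType}.
Local Notation normc := (@Normc.normc R).
Implicit Types (f g : R[i] -> R[i]) (z D : R[i]).

(** The first-order expansion is used instead of the difference quotient: no division by [h] occurs,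
    [h = 0] needs no exception, and all moduli are real numbers. *)
Definition cderiv f z D : Prop := forall e : R, 0 < e ->
  exists2 d : R, 0 < d &
    forall h, normc h < d -> normc (f (z + h) - f z - h * D) <= e * normc h.

Lemma derivable_cderiv f z :
  derivable (f : R[i]^o -> R[i]^o) z 1 <-> exists D, cderiv f z D.
Proof.
split=> [fz|[D fD]].
- exists ('D_1 (f : R[i]^o -> R[i]^o) z) => e e0.
  have /cvgrPdist_le /(_ e%:C) := fz.
  rewrite ltcR => /(_ e0).
  move=> /nbhs_ballP[d /= d0 H].
  (* A positive element of [R[i]] is real, so the radius [d] is its own real part. *)
  have dE : d = (complex.Re d)%:C by move: d0; case: (d) => a b; rewrite ltcE/= => /andP[/eqP -> _].
  exists (complex.Re d); first by rewrite -ltcR -dE.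
  move=> h hd; have [->|h0] := eqVneq h 0.
    by rewrite addr0 subrr mul0r subr0 Normc.normc0 mulr0.
  have := H h; rewrite /ball/= sub0r normrN normc_normr dE ltcR => /(_ hd h0).
  rewrite normc_normr lecR => {}H.
  have -> : f (z + h) - f z - h * 'D_1 (f : R[i]^o -> R[i]^o) z
    = - h * ('D_1 (f : R[i]^o -> R[i]^o) z - h^-1 *: ((f \o shift z) (h *: 1) - f z)).
    rewrite mulNr mulrBr opprB /GRing.scale/= mulr1 mulrA divff// mul1r.
    by rewrite [h + z]addrC.
  by rewrite Normc.normcM normcN mulrC ler_wpM2r ?normc_ge0.
- apply/cvg_ex; exists D; apply/cvgrPdist_le => e e0.
  have eE : e = (complex.Re e)%:C by move: e0; case: (e) => a b; rewrite ltcE/= => /andP[/eqP -> _].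
  have e0' : 0 < complex.Re e by rewrite -ltcR -eE.
  have [d d0 H] := fD _ e0'.
  apply/nbhs_ballP; exists d%:C; first by rewrite /= ltcR.
  move=> h; rewrite /ball/= sub0r normrN normc_normr ltcR => hd h0.
  rewrite normc_normr eE lecR.
  have -> : D - h^-1 *: ((f \o shift z) (h *: 1) - f z) = - h^-1 * (f (z + h) - f z - h * D).
    rewrite !mulNr mulrBr opprB mulrA mulVf// mul1r /GRing.scale/= mulr1.
    by rewrite [h + z]addrC.
  rewrite Normc.normcM normcN Normc.normcV ler_pdivrMl ?normc_gt0// [normc h * _]mulrC.
  exact: H.
Qed.

Lemma cderiv_cst c z : cderiv (cst c) z 0.
Proof.
move=> e e0; exists 1 => // h _.
by rewrite /cst subrr mulr0 subr0 Normc.normc0 mulr_ge0 ?normc_ge0 ?ltW.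
Qed.

Lemma cderiv_id z : cderiv id z 1.
Proof.
move=> e e0; exists 1 => // h _.
by rewrite mulr1 [z + h]addrC addrK subrr Normc.normc0 mulr_ge0 ?normc_ge0 ?ltW.
Qed.

Lemma cderivD f g z D E : cderiv f z D -> cderiv g z E ->
  cderiv (fun w => f w + g w) z (D + E).
Proof.
move=> fD gE e e0.
have e20 : 0 < e / 2 by rewrite divr_gt0.
have [d d0 H] := fD _ e20; have [d' d'0 H'] := gE _ e20.
exists (Num.min d d'); first by rewrite lt_min d0.
move=> h; rewrite lt_min => /andP[hd hd'].
have -> : f (z + h) + g (z + h) - (f z + g z) - h * (D + E) =
  (f (z + h) - f z - h * D) + (g (z + h) - g z - h * E) by ring.
by rewrite (splitr e) mulrDl (le_trans (le_normcD _ _))// lerD ?H ?H'.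
Qed.

Lemma cderivZ c f z D : cderiv f z D -> cderiv (fun w => c * f w) z (c * D).
Proof.
move=> fD e e0.
have c0 : 0 < normc c + 1 by rewrite ltr_wpDl ?normc_ge0.
have [d d0 H] := fD _ (divr_gt0 e0 c0).
exists d => // h hd.
have -> : c * f (z + h) - c * f z - h * (c * D) = c * (f (z + h) - f z - h * D) by ring.
rewrite Normc.normcM (le_trans (ler_wpM2l (normc_ge0 _) (H _ hd)))// mulrA ler_wpM2r ?normc_ge0//.
by rewrite mulrA ler_pdivrMr// mulrC ler_wpM2l ?(ltW e0)// lerDl.
Qed.

Lemma cderivB f g z D E : cderiv f z D -> cderiv g z E ->
  cderiv (fun w => f w - g w) z (D - E).
Proof.
move=> fD gE; have := cderivD fD (cderivZ (-1) gE).
rewrite mulN1r; congr cderiv.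
by apply/funext => w; rewrite mulN1r.
Qed.

Lemma cderiv_bound f z D : cderiv f z D ->
  exists2 d : R, 0 < d &
    forall h, normc h < d -> normc (f (z + h) - f z) <= (normc D + 1) * normc h.
Proof.
move=> /(_ 1 ltr01)[d d0 H]; exists d => // h /H {}H.
rewrite -(subrK (h * D) (f (z + h) - f z)) (le_trans (le_normcD _ _))//.
by rewrite addrC mulrDl lerD// Normc.normcM mulrC.
Qed.

Definition ccontinuous f z : Prop := forall e : R, 0 < e ->
  exists2 d : R, 0 < d & forall w, normc (w - z) < d -> normc (f w - f z) < e.

Lemma cderiv_ccontinuous f z D : cderiv f z D -> ccontinuous f z.
Proof.
move=> /cderiv_bound[d d0 H] e e0.
have D0 : 0 < normc D + 1 by rewrite ltr_wpDl ?normc_ge0.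
exists (Num.min d (e / (normc D + 1))); first by rewrite lt_min d0 divr_gt0.
move=> w; rewrite lt_min => /andP[wd we].
have := H _ wd; rewrite [z + _]addrC subrK => /le_lt_trans; apply.
by rewrite mulrC -ltr_pdivlMr.
Qed.

(** The remainder splits into the two remainders of the factors and the product of the two
    increments, which is quadratic in [h]. *)
Lemma cderivM f g z D E : cderiv f z D -> cderiv g z E ->
  cderiv (fun w => f w * g w) z (D * g z + f z * E).
Proof.
move=> fD gE e e0.
have [d1 d10 H1] := cderiv_bound fD; have [d2 d20 H2] := cderiv_bound gE.
set K := normc (g z) + normc (f z) + (normc D + 1) * (normc E + 1).
have K0 : 0 <= K by rewrite !addr_ge0 ?mulr_ge0 ?addr_ge0 ?normc_ge0.
have K1 : 0 < K + 1 by rewrite ltr_wpDl.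
have eK : 0 < e / (K + 1) by rewrite divr_gt0.
have [d3 d30 H3] := fD _ eK; have [d4 d40 H4] := gE _ eK.
(* The bound [e / (K + 1)] on [h] itself absorbs the quadratic term. *)
exists (Num.min (e / (K + 1)) (Num.min (Num.min d1 d2) (Num.min d3 d4))).
  by rewrite !lt_min eK d10 d20 d30 d40.
move=> h; rewrite !lt_min => /andP[he /andP[/andP[h1 h2] /andP[h3 h4]]].
have -> : f (z + h) * g (z + h) - f z * g z - h * (D * g z + f z * E) =
   g z * (f (z + h) - f z - h * D) + f z * (g (z + h) - g z - h * E)
   + (f (z + h) - f z) * (g (z + h) - g z) by ring.
have -> : e * normc h = e / (K + 1) * normc h * (K + 1).
  by field; rewrite gt_eqF.
apply: (@le_trans _ _ (e / (K + 1) * normc h * K)); last first.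
  apply: ler_wpM2l; last by rewrite lerDl.
  by apply: mulr_ge0; [exact: ltW | exact: normc_ge0].
rewrite /K (mulrDr (e / (K + 1) * normc h)) (le_trans (le_normcD _ _))// lerD//.
  rewrite [leRHS]mulrDr (le_trans (le_normcD _ _))// lerD// Normc.normcM mulrC ler_wpM2r ?normc_ge0//.
    exact: H3.
  exact: H4.
rewrite Normc.normcM (le_trans (ler_pM (normc_ge0 _) (normc_ge0 _) (H1 _ h1) (H2 _ h2)))//.
have -> : (normc D + 1) * normc h * ((normc E + 1) * normc h) =
  normc h * normc h * ((normc D + 1) * (normc E + 1)) by ring.
rewrite ler_wpM2r ?mulr_ge0 ?addr_ge0 ?normc_ge0//.
by rewrite ler_wpM2r ?normc_ge0// ltW.
Qed.

Lemma cderivV z : z != 0 -> cderiv (fun w => w^-1) z (- z ^- 2).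
Proof.
move=> z0 e e0.
have nz : 0 < normc z by rewrite normc_gt0.
exists (Num.min (normc z / 2) (e * normc z ^+ 3 / 2)).
  by rewrite lt_min !divr_gt0 ?mulr_gt0 ?exprn_gt0.
move=> h; rewrite lt_min => /andP[hz he].
have zh : normc z / 2 <= normc (z + h).
  have := ler_dist_normc z (- h); rewrite normcN opprK => H.
  have := le_trans (ler_norm _) (ler_dist_normc z (z + h)).
  rewrite opprD addrA subrr sub0r normcN; lra.
have zh0 : z + h != 0 by rewrite -normc_gt0 (lt_le_trans _ zh)// divr_gt0.
have -> : (z + h)^-1 - z^-1 - h * - z ^- 2 = h * (h * (z ^- 2 * (z + h)^-1)).
  by field; rewrite z0 zh0.
rewrite Normc.normcM mulrC ler_wpM2r ?normc_ge0//.
rewrite !Normc.normcM !Normc.normcV normcX.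
rewrite mulrA ler_pdivrMr; last by rewrite normc_gt0.
rewrite ler_pdivrMr ?exprn_gt0//.
apply: (le_trans (ltW he)).
have -> : e * normc z ^+ 3 / 2 = e * (normc z / 2) * normc z ^+ 2 by field.
by rewrite ler_wpM2r ?exprn_ge0 ?normc_ge0// ler_wpM2l// ltW.
Qed.

Lemma cderiv_affine f z c b D : cderiv f (c * z + b) D ->
  cderiv (fun w => f (c * w + b)) z (c * D).
Proof.
move=> fD e e0.
have c0 : 0 < normc c + 1 by rewrite ltr_wpDl ?normc_ge0.
have [d d0 H] := fD _ (divr_gt0 e0 c0).
exists (d / (normc c + 1)); first by rewrite divr_gt0.
move=> h; rewrite ltr_pdivlMr// => hd.
have chd : normc (c * h) <= normc h * (normc c + 1).
  by rewrite Normc.normcM mulrC ler_wpM2l ?normc_ge0// lerDl.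
have := H _ (le_lt_trans chd hd).
have -> : c * z + b + c * h = c * (z + h) + b by ring.
rewrite [c * h * D]mulrAC [c * D * h]mulrC => /le_trans; apply.
have e1 : 0 <= e / (normc c + 1) by rewrite divr_ge0 ?ltW.
apply: (le_trans (ler_wpM2l e1 chd)).
by rewrite mulrCA divfK ?gt_eqF// mulrC.
Qed.

Lemma cderiv_eq f g z D : f =1 g -> cderiv f z D -> cderiv g z D.
Proof. by move=> /funext ->. Qed.

End complex_derivative.

(** * Goursat's theorem *)

Section segment_integral.
Context {R : realType}.
Local Notation leb := (@lebesgue_measure R).
Implicit Types (u v : R -> R) (a b : R).

(** Continuity is two-sided even at the endpoints: the integrands come from functions defined around
    the segment, and the condition passes to subsegments at once. *)
Definition seg_continuous a b u := forall x, a <= x <= b -> {for x, continuous u}.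

Lemma seg_continuousW a b a' b' u : a <= a' -> b' <= b ->
  seg_continuous a b u -> seg_continuous a' b' u.
Proof.
move=> aa bb cu x /andP[ax xb]; apply: cu.
by rewrite (le_trans aa ax) (le_trans xb bb).
Qed.

Lemma seg_continuousB a b u v : seg_continuous a b u -> seg_continuous a b v ->
  seg_continuous a b (fun x => u x - v x).
Proof. by move=> cu cv x xab; apply: cvgB; [exact: cu|exact: cv]. Qed.

Lemma seg_continuous_within a b u : seg_continuous a b u ->
  {within `[a, b], continuous u}.
Proof.
move=> cu; apply: continuous_in_subspaceT => x.
by rewrite inE/= in_itv/=; exact: cu.
Qed.

Lemma seg_integrable a b u : seg_continuous a b u ->
  leb.-integrable `[a, b] (EFin \o u).
Proof.
move=> /seg_continuous_within cu.
by apply: continuous_compact_integrable => //; exact: segment_compact.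
Qed.

Lemma seg_integral_split a m b u : a <= m -> m <= b -> seg_continuous a b u ->
  \int[leb]_(x in `[a, b]) u x =
  \int[leb]_(x in `[a, m]) u x + \int[leb]_(x in `[m, b]) u x.
Proof.
move=> am mb cu; have iu := seg_integrable cu.
have := @Rintegral_itvB _ u (BLeft a) (BRight b) m iu.
rewrite !bnd_simp => /(_ am mb) => /eqP; rewrite subr_eq addrC => /eqP ->.
congr (_ + _); apply: Rintegral_itv_obnd_cbnd.
apply: integrableS iu => //; apply: subset_itv; by rewrite bnd_simp.
Qed.

Lemma seg_measure a b : a <= b -> leb `[a, b] = (b - a)%:E.
Proof.
move=> ab; rewrite lebesgue_measure_itv/= lte_fin.
by case: ltgtP ab => // -> _; rewrite subrr.
Qed.

Lemma seg_integral_cst a b (k : R) : a <= b ->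
  \int[leb]_(x in `[a, b]) k = k * (b - a).
Proof. by move=> ab; rewrite Rintegral_cst//= seg_measure. Qed.

Lemma seg_continuous_cst a b (k : R) : seg_continuous a b (fun=> k).
Proof. by move=> x _; exact: cvg_cst. Qed.

Lemma seg_integral_le a b u v : seg_continuous a b u -> seg_continuous a b v ->
  (forall x, a <= x <= b -> u x <= v x) ->
  \int[leb]_(x in `[a, b]) u x <= \int[leb]_(x in `[a, b]) v x.
Proof.
by move=> cu cv uv; apply: le_Rintegral => //; exact: seg_integrable.
Qed.

Lemma seg_integral_dev a b u (k M : R) : a <= b -> seg_continuous a b u ->
  (forall x, a <= x <= b -> `|u x - k| <= M) ->
  `|\int[leb]_(x in `[a, b]) u x - k * (b - a)| <= M * (b - a).
Proof.
move=> ab cu uM; rewrite -!seg_integral_cst// ler_distl; apply/andP; split.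
  rewrite -RintegralB//; try exact/seg_integrable/seg_continuous_cst.
  apply: seg_integral_le => //; first by move=> x _; exact: cvg_cst.
  by move=> x /uM; rewrite ler_distl => /andP[].
rewrite -RintegralD//; try exact/seg_integrable/seg_continuous_cst.
apply: seg_integral_le => //; first by move=> x _; exact: cvg_cst.
by move=> x /uM; rewrite ler_distl => /andP[].
Qed.

End segment_integral.

Section rectangles.
Context {R : realType}.
Local Notation leb := (@lebesgue_measure R).
Local Notation normc := (@Normc.normc R).
Implicit Types (h : R[i] -> R[i]) (a b c d x y : R).

Lemma ccontinuous_path h (p : R -> R[i]) x :
  (forall s t, normc (p s - p t) <= `|s - t|) -> ccontinuous h (p x) ->
  {for x, continuous (fun s => complex.Re (h (p s)))} /\
  {for x, continuous (fun s => complex.Im (h (p s)))}.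
Proof.
move=> lp ch; split; apply/cvgrPdist_lt => e /ch[d d0 H];
  apply/nbhs_ballP; exists d => // y; rewrite /ball/= distrC => xy.
  apply: le_lt_trans (H (p y) _); last exact: le_lt_trans (lp _ _) xy.
  rewrite distrC; move: (h (p y)) (h (p x)) => [? ?] [? ?] /=.
  exact: (normc_Re (_ +i* _)).
apply: le_lt_trans (H (p y) _); last exact: le_lt_trans (lp _ _) xy.
rewrite distrC; move: (h (p y)) (h (p x)) => [? ?] [? ?] /=.
exact: (normc_Im (_ +i* _)).
Qed.

Lemma horizontal_path c s t : normc ((s +i* c) - (t +i* c)) <= `|s - t|.
Proof. by rewrite /= subrr expr0n addr0 sqrtr_sqr. Qed.

Lemma vertical_path a s t : normc ((a +i* s) - (a +i* t)) <= `|s - t|.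
Proof. by rewrite /= subrr expr0n add0r sqrtr_sqr. Qed.

(* The real part of the integral of h along the boundary of [a, b] x [c, d],
   opposite sides being paired under one integral sign. *)
Definition rect_integral h a b c d : R :=
  \int[leb]_(x in `[a, b]) (complex.Re (h (x +i* c)) - complex.Re (h (x +i* d))) -
  \int[leb]_(y in `[c, d]) (complex.Im (h (b +i* y)) - complex.Im (h (a +i* y))).

Definition hseg_continuous h a b c :=
  forall x, a <= x <= b -> ccontinuous h (x +i* c).
Definition vseg_continuous h a c d :=
  forall y, c <= y <= d -> ccontinuous h (a +i* y).

Lemma hseg_continuous_Re h a b c : hseg_continuous h a b c ->
  seg_continuous a b (fun x => complex.Re (h (x +i* c))).
Proof.
move=> ch x /ch H.
by have [] := @ccontinuous_path h (fun s => s +i* c) x (horizontal_path c) H.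
Qed.

Lemma vseg_continuous_Im h a c d : vseg_continuous h a c d ->
  seg_continuous c d (fun y => complex.Im (h (a +i* y))).
Proof.
move=> ch y /ch H.
by have [] := @ccontinuous_path h (fun s => a +i* s) y (vertical_path a) H.
Qed.

Lemma rect_integral_splitx h a m b c d : a <= m -> m <= b ->
  hseg_continuous h a b c -> hseg_continuous h a b d ->
  vseg_continuous h a c d -> vseg_continuous h m c d -> vseg_continuous h b c d ->
  rect_integral h a b c d = rect_integral h a m c d + rect_integral h m b c d.
Proof.
move=> am mb /hseg_continuous_Re hc /hseg_continuous_Re hd.
move=> /vseg_continuous_Im va /vseg_continuous_Im vm /vseg_continuous_Im vb.
rewrite /rect_integral (seg_integral_split am mb); last exact: seg_continuousB.
rewrite !(RintegralB (mu := leb))//; try exact: seg_integrable.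
- by ring.
- exact/seg_integrable/(seg_continuousW am (lexx b)).
- exact/seg_integrable/(seg_continuousW am (lexx b)).
- exact/seg_integrable/(seg_continuousW (lexx a) mb).
- exact/seg_integrable/(seg_continuousW (lexx a) mb).
Qed.

Lemma rect_integral_splity h a b c m d : c <= m -> m <= d ->
  vseg_continuous h a c d -> vseg_continuous h b c d ->
  hseg_continuous h a b c -> hseg_continuous h a b m -> hseg_continuous h a b d ->
  rect_integral h a b c d = rect_integral h a b c m + rect_integral h a b m d.
Proof.
move=> cm md /vseg_continuous_Im va /vseg_continuous_Im vb.
move=> /hseg_continuous_Re hc /hseg_continuous_Re hm /hseg_continuous_Re hd.
rewrite /rect_integral (seg_integral_split cm md); last exact: seg_continuousB.
rewrite !(RintegralB (mu := leb))//; try exact: seg_integrable.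
- by ring.
- exact/seg_integrable/(seg_continuousW cm (lexx d)).
- exact/seg_integrable/(seg_continuousW cm (lexx d)).
- exact/seg_integrable/(seg_continuousW (lexx c) md).
- exact/seg_integrable/(seg_continuousW (lexx c) md).
Qed.

Definition rect_continuous h a b c d :=
  forall x y, a <= x <= b -> c <= y <= d -> ccontinuous h (x +i* y).

Lemma rect_continuous_sides h a b c d x y : rect_continuous h a b c d ->
  a <= x <= b -> c <= y <= d -> vseg_continuous h x c d /\ hseg_continuous h a b y.
Proof. by move=> H xab ycd; split => [t ?|t ?]; exact: H. Qed.

(** Bisecting both sides divides the squared half perimeter by 4. If all four quarters violated the
    bound, adding their integrals would violate it for the whole rectangle. *)
Lemma rect_integral_quarter h a b c d (K : R) : a < b -> c < d ->
  rect_continuous h a b c d -> K * ((b - a) + (d - c)) ^+ 2 <= `|rect_integral h a b c d| ->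
  exists r : (R * R) * (R * R), [/\ a <= r.1.1 /\ r.1.2 <= b, c <= r.2.1 /\ r.2.2 <= d,
    r.1.2 - r.1.1 = (b - a) / 2, r.2.2 - r.2.1 = (d - c) / 2 &
    K * ((r.1.2 - r.1.1) + (r.2.2 - r.2.1)) ^+ 2 <=
     `|rect_integral h r.1.1 r.1.2 r.2.1 r.2.2|].
Proof.
move=> ab cd ch HK.
pose m := (a + b) / 2; pose n := (c + d) / 2.
have am : a <= m by rewrite /m; lra.
have mb : m <= b by rewrite /m; lra.
have cn : c <= n by rewrite /n; lra.
have nd : n <= d by rewrite /n; lra.
have aab : a <= a <= b by rewrite lexx ltW.
have bab : a <= b <= b by rewrite lexx ltW.
have mab : a <= m <= b by rewrite am mb.
have ccd : c <= c <= d by rewrite lexx ltW.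
have dcd : c <= d <= d by rewrite lexx ltW.
have ncd : c <= n <= d by rewrite cn nd.
have [va hc] := rect_continuous_sides ch aab ccd.
have [vb hd] := rect_continuous_sides ch bab dcd.
have [vm hn] := rect_continuous_sides ch mab ncd.
have vW z c' d' : c <= c' -> d' <= d -> vseg_continuous h z c d -> vseg_continuous h z c' d'.
  move=> cc dd H y /andP[cy yd]; apply: H; by rewrite (le_trans cc cy) (le_trans yd dd).
have hW z a' b' : a <= a' -> b' <= b -> hseg_continuous h a b z -> hseg_continuous h a' b' z.
  move=> cc dd H y /andP[cy yd]; apply: H; by rewrite (le_trans cc cy) (le_trans yd dd).
have E : rect_integral h a b c d =
  (rect_integral h a m c n + rect_integral h a m n d) +
  (rect_integral h m b c n + rect_integral h m b n d).
  rewrite (rect_integral_splitx am mb)//.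
  by rewrite -!rect_integral_splity//; first [exact: hW hc|exact: hW hd|exact: hW hn].
pose L := (b - a) / 2 + (d - c) / 2.
have E1 : m - a = (b - a) / 2 by rewrite /m; field.
have E2 : b - m = (b - a) / 2 by rewrite /m; field.
have E3 : n - c = (d - c) / 2 by rewrite /n; field.
have E4 : d - n = (d - c) / 2 by rewrite /n; field.
have [H1|H1] := leP (K * L ^+ 2) `|rect_integral h a m c n|.
  by exists ((a, m), (c, n)); rewrite /= E1 E3; split.
have [H2|H2] := leP (K * L ^+ 2) `|rect_integral h a m n d|.
  by exists ((a, m), (n, d)); rewrite /= E1 E4; split.
have [H3|H3] := leP (K * L ^+ 2) `|rect_integral h m b c n|.
  by exists ((m, b), (c, n)); rewrite /= E2 E3; split.
have [H4|H4] := leP (K * L ^+ 2) `|rect_integral h m b n d|.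
  by exists ((m, b), (n, d)); rewrite /= E2 E4; split.
exfalso; move: HK; apply/negP; rewrite -ltNge E.
rewrite (le_lt_trans (ler_normD _ _))//.
apply: le_lt_trans (lerD (ler_normD _ _) (ler_normD _ _)) _.
have -> : K * (b - a + (d - c)) ^+ 2 = K * L ^+ 2 + K * L ^+ 2 + (K * L ^+ 2 + K * L ^+ 2).
  by rewrite /L; field.
by rewrite !ltrD.
Qed.

(** Across opposite sides the affine part changes by a constant. The horizontal pair contributes (d
    - c) Im D over length b - a, the vertical pair (b - a) Im D over length d - c, and these cancel.
    What remains is an error of at most [2 * e] per unit length. *)
Lemma rect_integral_dev h a b c d (P D : R[i]) (e : R) : a <= b -> c <= d ->
  rect_continuous h a b c d ->
  (forall x y, a <= x <= b -> c <= y <= d ->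
     normc (h (x +i* y) - h P - ((x +i* y) - P) * D) <= e) ->
  `|rect_integral h a b c d| <= 2 * e * ((b - a) + (d - c)).
Proof.
move=> ab cd ch He.
have aab : a <= a <= b by rewrite lexx ab.
have bab : a <= b <= b by rewrite lexx ab.
have ccd : c <= c <= d by rewrite lexx cd.
have dcd : c <= d <= d by rewrite lexx cd.
have [va hc] := rect_continuous_sides ch aab ccd.
have [vb hd] := rect_continuous_sides ch bab dcd.
rewrite /rect_integral.
have lip (z w : R[i]) : normc (h z - h P - (z - P) * D) <= e ->
    normc (h w - h P - (w - P) * D) <= e ->
  `|complex.Re (h z) - complex.Re (h w) - complex.Re ((z - w) * D)| <= 2 * e /\
  `|complex.Im (h z) - complex.Im (h w) - complex.Im ((z - w) * D)| <= 2 * e.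
  move=> Hz Hw.
  have : normc (h z - h w - (z - w) * D) <= 2 * e.
    have -> : h z - h w - (z - w) * D = (h z - h P - (z - P) * D) - (h w - h P - (w - P) * D) by ring.
    by rewrite (le_trans (ler_normcB _ _))// mulr_natl mulr2n lerD.
  move=> H; split.
    apply: le_trans H; apply: le_trans (normc_Re _).
    by case: (h z) (h w) ((z - w) * D) => [? ?] [? ?] [? ?].
  apply: le_trans H; apply: le_trans (normc_Im _).
  by case: (h z) (h w) ((z - w) * D) => [? ?] [? ?] [? ?].
have H1 : `|\int[leb]_(x in `[a, b]) (complex.Re (h (x +i* c)) - complex.Re (h (x +i* d)))
   - ((d - c) * complex.Im D) * (b - a)| <= 2 * e * (b - a).
  apply: seg_integral_dev => // [|x xab].
    exact: (seg_continuousB (hseg_continuous_Re hc) (hseg_continuous_Re hd)).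
  have [+ _] := lip _ _ (He x c xab ccd) (He x d xab dcd).
  suff -> : complex.Re ((x +i* c - x +i* d) * D) = (d - c) * complex.Im D by [].
  by case: D {lip He} => p q /=; ring.
have H2 : `|\int[leb]_(y in `[c, d]) (complex.Im (h (b +i* y)) - complex.Im (h (a +i* y)))
   - ((b - a) * complex.Im D) * (d - c)| <= 2 * e * (d - c).
  apply: seg_integral_dev => // [|y ycd].
    exact: (seg_continuousB (vseg_continuous_Im vb) (vseg_continuous_Im va)).
  have [_] := lip _ _ (He b y bab ycd) (He a y aab ycd).
  suff -> : complex.Im ((b +i* y - a +i* y) * D) = (b - a) * complex.Im D by [].
  by case: D {lip He H1} => p q /=; ring.
move: H1 H2.
move: (Rintegral _ _ _) (Rintegral _ _ _) => I J; rewrite !ler_norml.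
have -> : (d - c) * complex.Im D * (b - a) = (b - a) * complex.Im D * (d - c) by ring.
move: ((b - a) * _ * _) => k H1 H2.
rewrite mulrDr; apply/andP; lra.
Qed.

(* Goursat: a bad rectangle is bisected down to a point, near which h is affine
   up to o(size), and affine functions contribute nothing. *)
Theorem goursat h a b c d : a < b -> c < d ->
  (forall x y, a <= x <= b -> c <= y <= d -> exists D, cderiv h (x +i* y) D) ->
  rect_integral h a b c d = 0.
Proof.
move=> ab cd hD.
have ch a' b' c' d' : a <= a' -> b' <= b -> c <= c' -> d' <= d ->
    rect_continuous h a' b' c' d'.
  move=> aa bb cc dd x y /andP[x1 x2] /andP[y1 y2].
  have [|| D /cderiv_ccontinuous//] := hD x y.
    by rewrite (le_trans aa x1) (le_trans x2 bb).
  by rewrite (le_trans cc y1) (le_trans y2 dd).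
apply/eqP/negPn/negP => n0.
pose L := (b - a) + (d - c).
have L0 : 0 < L by rewrite /L; lra.
pose K := `|rect_integral h a b c d| / L ^+ 2.
have K0 : 0 < K by rewrite divr_gt0 ?exprn_gt0// normr_gt0.
(* The lower bound scales like the square of the size, so it survives bisection with the same [K],
   the ratio attained by the initial rectangle. *)
pose good (r : (R * R) * (R * R)) := [/\ r.1.1 < r.1.2, r.2.1 < r.2.2,
  a <= r.1.1 /\ r.1.2 <= b, c <= r.2.1 /\ r.2.2 <= d &
  K * ((r.1.2 - r.1.1) + (r.2.2 - r.2.1)) ^+ 2 <=
     `|rect_integral h r.1.1 r.1.2 r.2.1 r.2.2|].
have [g Hg] : {g & forall r, good r -> [/\ good (g r),
    r.1.1 <= (g r).1.1 /\ (g r).1.2 <= r.1.2,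
    r.2.1 <= (g r).2.1 /\ (g r).2.2 <= r.2.2,
    (g r).1.2 - (g r).1.1 = (r.1.2 - r.1.1) / 2 &
    (g r).2.2 - (g r).2.1 = (r.2.2 - r.2.1) / 2]}.
  apply: (@choice _ _ (fun r s => good r -> [/\ good s,
    r.1.1 <= s.1.1 /\ s.1.2 <= r.1.2, r.2.1 <= s.2.1 /\ s.2.2 <= r.2.2,
    s.1.2 - s.1.1 = (r.1.2 - r.1.1) / 2 & s.2.2 - s.2.1 = (r.2.2 - r.2.1) / 2])).
  (* The choice function must be total; outside the good rectangles its value is an arbitrary
     default. *)
  move=> [[a' b'] [c' d']]; have [|] := pselect (good ((a', b'), (c', d'))); last by exists ((a, b), (c, d)).
  move=> [/= ab' cd' [aa bb] [cc dd] HK].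
  have [s [[s1 s2] [s3 s4] s5 s6 s7]] := rect_integral_quarter ab' cd' (ch _ _ _ _ aa bb cc dd) HK.
  exists s => _; split => //; split => //; first last.
  - by rewrite (le_trans cc s3) (le_trans s4 dd).
  - by rewrite (le_trans aa s1) (le_trans s2 bb).
  - by rewrite -subr_gt0 s6 divr_gt0// subr_gt0.
  - by rewrite -subr_gt0 s5 divr_gt0// subr_gt0.
pose s n := iter n g ((a, b), (c, d)).
have gs n : good (s n).
  elim: n => [|n IH]; last by have [] := Hg _ IH.
  by split => //=; rewrite ?lexx//= /K divfK// gt_eqF// exprn_gt0.
have sz1 n : (s n).1.2 - (s n).1.1 = (b - a) / 2 ^+ n.
  elim: n => [|n IH]; first by rewrite expr0 divr1.
  have [_ _ _ /= -> _] := Hg _ (gs n).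
  by rewrite IH exprSr invfM mulrA.
have sz2 n : (s n).2.2 - (s n).2.1 = (d - c) / 2 ^+ n.
  elim: n => [|n IH]; first by rewrite expr0 divr1.
  have [_ _ _ _ /= ->] := Hg _ (gs n).
  by rewrite IH exprSr invfM mulrA.
have nested (u v : R^nat) : (forall n, u n <= u n.+1) -> (forall n, v n.+1 <= v n) ->
    (forall n, u n <= v n) -> exists p, forall n, u n <= p <= v n.
  move=> /nondecreasing_seqP nu /nonincreasing_seqP nv uv.
  have uv' n m : u n <= v m.
    have [nm|/ltnW mn] := leqP n m; first exact: le_trans (nu _ _ nm) (uv m).
    exact: le_trans (uv n) (nv _ _ mn).
  exists (sup (range u)) => n; apply/andP; split.
    apply: ub_le_sup; last by exists n.
    by exists (v 0%N) => _ [m _ <-].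
  apply: ge_sup; first by exists (u 0%N); exists 0%N.
  by move=> _ [m _ <-].
have [p Hp] : exists p, forall n, (s n).1.1 <= p <= (s n).1.2.
  apply: nested => n; try by have [_ [? ?] _ _ _] := Hg _ (gs n).
  by have [/ltW] := gs n.
have [q Hq] : exists q, forall n, (s n).2.1 <= q <= (s n).2.2.
  apply: nested => n; try by have [_ _ [? ?] _ _] := Hg _ (gs n).
  by have [_ /ltW] := gs n.
have [D hPD] := hD p q (Hp 0%N) (Hq 0%N).
(* With [K / 4], the deviation bound gives half of [K] times the squared half perimeter, which
   contradicts the lower bound. *)
have K40 : 0 < K / 4 by rewrite divr_gt0.
have [e e0 He] := hPD _ K40.
have [n Hn] : exists n, L / 2 ^+ n < e.
  have : (L / 2 ^+ k) @[k --> \oo] --> (0 : R).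
    rewrite -(mulr0 L); apply: cvgMr.
    under eq_fun do rewrite -exprVn.
    by apply: cvg_expr; rewrite ger0_norm ?invr_ge0// invf_lt1// ltr1n.
  move=> /cvgrPdist_lt /(_ _ e0)[N _ /(_ N (leqnn N))] /=.
  rewrite sub0r normrN ger0_norm; last by rewrite divr_ge0 ?exprn_ge0 ?ltW.
  by exists N.
have [] := gs n.
have := sz1 n; have := sz2 n; move: (Hp n) (Hq n).
case: (s n) => [[a' b'] [c' d']] /= Hp' Hq' E2 E1 ab' cd' [aa bb] [cc dd].
apply/negP; rewrite -ltNge.
have EL : b' - a' + (d' - c') = L / 2 ^+ n by rewrite E1 E2 -mulrDl.
have M0 : 0 < L / 2 ^+ n by rewrite divr_gt0 ?exprn_gt0.
rewrite EL; apply: (@le_lt_trans _ _ (2 * (K / 4 * (L / 2 ^+ n)) * (L / 2 ^+ n))); last first.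
  have -> : 2 * (K / 4 * (L / 2 ^+ n)) * (L / 2 ^+ n) = K * (L / 2 ^+ n) ^+ 2 / 2 by field; rewrite expf_neq0.
  by rewrite ltr_pdivrMr// ltr_pMr ?ltr1n// mulr_gt0 ?exprn_gt0.
rewrite -EL.
apply: (@rect_integral_dev h a' b' c' d' (p +i* q) D);
  [exact: ltW|exact: ltW|exact: ch|].
move=> x y xab ycd; rewrite EL.
have Hz : normc ((x +i* y) - (p +i* q)) <= L / 2 ^+ n.
  rewrite -EL (le_trans (normc_le_ReIm _))//= lerD// ler_norml; lra.
have := He _ (le_lt_trans Hz Hn).
rewrite [p +i* q + _]addrC subrK => /le_trans; apply.
by rewrite ler_pM2l.
Qed.

End rectangles.

(** * Cauchy estimates *)

Section cauchy_estimate.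
Context {R : realType}.
Local Notation leb := (@lebesgue_measure R).
Local Notation normc := (@Normc.normc R).
Implicit Types (f g h : R[i] -> R[i]) (s x y : R) (z D : R[i]).

Definition holomorphic f := forall z, exists D, cderiv f z D.

Lemma complex_neq0 x y : (x != 0) || (y != 0) -> x +i* y != 0.
Proof. by rewrite eq_complex/= negb_and. Qed.

(** The frame between the two squares is cut into a left, a right, a bottom and a top rectangle.
    None of them contains 0, so Goursat's theorem kills each. *)
Lemma punctured_rect_integral h s s' : 0 < s' -> s' < s ->
  (forall z, z != 0 -> exists D, cderiv h z D) ->
  rect_integral h (- s) s (- s) s = rect_integral h (- s') s' (- s') s'.
Proof.
move=> s'0 ss' hD.
have hc x y : (x != 0) || (y != 0) -> ccontinuous h (x +i* y).
  by move=> /complex_neq0 /hD[D /cderiv_ccontinuous].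
have hs a b y : y != 0 -> hseg_continuous h a b y.
  by move=> y0 x _; apply: hc; rewrite y0 orbT.
have vs a b x : x != 0 -> vseg_continuous h x a b.
  by move=> x0 y _; apply: hc; rewrite x0.
have s0 : s != 0 by apply/eqP; lra.
have ns0 : - s != 0 by apply/eqP; lra.
have s'00 : s' != 0 by apply/eqP; lra.
have ns'0 : - s' != 0 by apply/eqP; lra.
rewrite (@rect_integral_splitx _ h (- s) (- s') s); try (by [lra|apply: hs|apply: vs]).
rewrite (@goursat _ h (- s) (- s')) ?add0r; [|lra|lra|]; last first.
  move=> x y xs _; apply/hD/complex_neq0; apply/orP; left; apply/eqP; lra.
rewrite (@rect_integral_splitx _ h (- s') s' s); try (by [lra|apply: hs|apply: vs]).
rewrite (@goursat _ h s' s) ?addr0; [|lra|lra|]; last first.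
  move=> x y xs _; apply/hD/complex_neq0; apply/orP; left; apply/eqP; lra.
rewrite (@rect_integral_splity _ h (- s') s' (- s) (- s') s); try (by [lra|apply: hs|apply: vs]).
rewrite (@goursat _ h (- s') s' (- s)) ?add0r; [|lra|lra|]; last first.
  move=> x y _ xs; apply/hD/complex_neq0; apply/orP; right; apply/eqP; lra.
rewrite (@rect_integral_splity _ h (- s') s' (- s') s' s); try (by [lra|apply: hs|apply: vs]).
rewrite (@goursat _ h (- s') s' s') ?addr0; [|lra|lra|]; last first.
  move=> x y _ xs; apply/hD/complex_neq0; apply/orP; right; apply/eqP; lra.
by [].
Qed.

(** Removable singularity: the square may be shrunk to half side t, where [h] is o(1 / t) on a
    boundary of length 8 t. *)
Lemma punctured_rect_integral0 h s : 0 < s ->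
  (forall z, z != 0 -> exists D, cderiv h z D) ->
  (forall e : R, 0 < e -> exists2 d : R, 0 < d &
    forall z, z != 0 -> normc z < d -> normc z * normc (h z) <= e) ->
  rect_integral h (- s) s (- s) s = 0.
Proof.
move=> s0 hD hsmall; apply/eqP; rewrite -normr_le0; apply/ler_addgt0Pl => e e0.
rewrite addr0.
have [d d0 Hd] := hsmall (e / 8) ltac:(by rewrite divr_gt0).
(* Boundary points of the small square have modulus at most [2 * t], which must stay below [d]. *)
pose t := Num.min (s / 2) (d / 4).
have t0 : 0 < t by rewrite lt_min !divr_gt0.
have ts : t < s by rewrite gt_min ltr_pdivrMr// ltr_pMr// ltr1n.
have td : 2 * t < d.
  rewrite mulrC -ltr_pdivlMr// gt_min; apply/orP; right; lra.
rewrite (punctured_rect_integral t0 ts hD).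
have hc x y : (x != 0) || (y != 0) -> ccontinuous h (x +i* y).
  by move=> /complex_neq0 /hD[D /cderiv_ccontinuous].
have hs a b y : y != 0 -> hseg_continuous h a b y.
  by move=> y0 x _; apply: hc; rewrite y0 orbT.
have vs a b x : x != 0 -> vseg_continuous h x a b.
  by move=> x0 y _; apply: hc; rewrite x0.
have t00 : t != 0 by rewrite gt_eqF.
have nt0 : - t != 0 by rewrite oppr_eq0.
have B x y : `|x| <= t -> `|y| <= t -> t <= `|x| \/ t <= `|y| ->
    normc (h (x +i* y)) <= e / 8 / t.
  move=> xt yt xy.
  have tn : t <= normc (x +i* y).
    case: xy => H; first exact: le_trans H (normc_Re (x +i* y)).
    exact: le_trans H (normc_Im (x +i* y)).
  rewrite ler_pdivlMr// mulrC.
  have n0 : x +i* y != 0 by rewrite -normc_gt0 (lt_le_trans t0).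
  have nd : normc (x +i* y) < d.
    by rewrite (le_lt_trans (normc_le_ReIm _))//= (le_lt_trans _ td)// mulr_natl mulr2n lerD.
  apply: le_trans (Hd _ n0 nd).
  by rewrite ler_wpM2r// normc_ge0.
have tt : - t <= t by lra.
have nt : `|t| = t by rewrite gtr0_norm.
have xt x : - t <= x <= t -> `|x| <= t by rewrite ler_norml.
have H1 := @seg_integral_dev _ (- t) t
  (fun x => complex.Re (h (x +i* - t)) - complex.Re (h (x +i* t))) 0 (2 * (e / 8 / t)) tt
  (seg_continuousB (hseg_continuous_Re (hs _ _ _ nt0)) (hseg_continuous_Re (hs _ _ _ t00))).
have H2 := @seg_integral_dev _ (- t) t
  (fun y => complex.Im (h (t +i* y)) - complex.Im (h (- t +i* y))) 0 (2 * (e / 8 / t)) tt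
  (seg_continuousB (vseg_continuous_Im (vs _ _ _ t00)) (vseg_continuous_Im (vs _ _ _ nt0))).
rewrite /rect_integral (le_trans (ler_normB _ _))//.
have E : 2 * (e / 8 / t) * (t - - t) = e / 2 by field.
rewrite mul0r subr0 E in H1; rewrite mul0r subr0 E in H2.
rewrite (splitr e) lerD//.
  apply: H1 => x /xt xt'; rewrite subr0 (le_trans (ler_normB _ _))//.
  rewrite mulr_natl mulr2n lerD// (le_trans (normc_Re _))// B ?normrN ?nt//; by right.
apply: H2 => x /xt xt'; rewrite subr0 (le_trans (ler_normB _ _))//.
rewrite mulr_natl mulr2n lerD// (le_trans (normc_Im _))// B ?normrN ?nt//; by left.
Qed.

(** The arc length integral of |g| over the boundary of the square [[- s, s]] x [[- s, s]]. *)
Definition boundary_sum g s : R :=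
  \int[leb]_(x in `[- s, s]) (normc (g (x +i* - s)) + normc (g (x +i* s))) +
  \int[leb]_(y in `[- s, s]) (normc (g (s +i* y)) + normc (g (- s +i* y))).

Lemma ccontinuous_normc_path h (p : R -> R[i]) x :
  (forall s t, normc (p s - p t) <= `|s - t|) -> ccontinuous h (p x) ->
  {for x, continuous (fun s => normc (h (p s)))}.
Proof.
move=> lp ch; apply/cvgrPdist_lt => e /ch[d d0 H].
apply/nbhs_ballP; exists d => // y; rewrite /ball/= distrC => xy.
rewrite distrC (le_lt_trans (ler_dist_normc _ _))// H//.
exact: le_lt_trans (lp _ _) xy.
Qed.

(** The exact value is the real part of 2 pi i D. The integrals over the sides reduce to that of s /
    (x^2 + s^2), and the bound 1 / (2 s) from below for this integrand already gives the factor 4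
    without the arctangent. *)
Lemma rect_integral_residue D s : 0 < s ->
  4 * `|complex.Im D| <= `|rect_integral (fun z => D * z^-1) (- s) s (- s) s|.
Proof.
move=> s0; set q := complex.Im D.
have ds x : x ^+ 2 + s ^+ 2 != 0 by rewrite gt_eqF// ltr_wpDl ?sqr_ge0 ?exprn_gt0.
have -> : rect_integral (fun z => D * z^-1) (- s) s (- s) s =
    - (4 * q) * \int[leb]_(x in `[- s, s]) (s / (x ^+ 2 + s ^+ 2)).
  have cu : seg_continuous (- s) s (fun x => s / (x ^+ 2 + s ^+ 2)).
    move=> x _; apply: cvgM; first exact: cvg_cst.
    apply: cvgV => //; apply: cvgD; last exact: cvg_cst.
    exact: exprn_continuous.
  have iu := seg_integrable cu.
  have -> : - (4 * q) * \int[leb]_(x in `[- s, s]) (s / (x ^+ 2 + s ^+ 2)) =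
     - (2 * q) * \int[leb]_(x in `[- s, s]) (s / (x ^+ 2 + s ^+ 2)) -
     (2 * q) * \int[leb]_(x in `[- s, s]) (s / (x ^+ 2 + s ^+ 2)) by ring.
  rewrite /rect_integral -!RintegralZl//; congr (_ - _); apply: eq_Rintegral => x _.
    rewrite /q; case: (D) => a b /=; rewrite sqrrN.
    by field; rewrite ds.
  rewrite /q; case: (D) => a b /=; rewrite sqrrN [s ^+ 2 + _]addrC.
  by field; rewrite ds.
rewrite normrM normrN normrM ger0_norm// ler_peMr ?mulr_ge0//.
rewrite ger0_norm; last first.
  by apply: Rintegral_ge0 => x _; rewrite divr_ge0 ?addr_ge0 ?sqr_ge0// ltW.
have <- : \int[leb]_(x in `[- s, s]) (2 * s)^-1 = 1.
  by rewrite seg_integral_cst; [field; rewrite gt_eqF|lra].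
apply: seg_integral_le => [|x _|x /andP[xs sx]].
- exact: seg_continuous_cst.
- apply: cvgM; first exact: cvg_cst.
  apply: cvgV => //; apply: cvgD; last exact: cvg_cst.
  exact: exprn_continuous.
have x2 : x ^+ 2 <= s ^+ 2.
  rewrite -[leLHS]real_normK ?num_real// lerXn2r ?nnegrE ?normr_ge0 ?(ltW s0)//.
  by rewrite ler_norml xs.
rewrite ler_pdivlMr ?ltr_wpDl ?sqr_ge0 ?exprn_gt0// mulrC ler_pdivrMr ?mulr_gt0//.
have -> : s * (2 * s) = s ^+ 2 + s ^+ 2 by ring.
by rewrite lerD2r.
Qed.

Lemma holomorphic_divX2 g z : holomorphic g -> z != 0 ->
  exists D, cderiv (fun z => g z * z ^- 2) z D.
Proof.
move=> hg z0; have [D gD] := hg z; have zV := cderivV z0.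
eexists; apply: cderiv_eq (cderivM gD (cderivM zV zV)) => w.
by rewrite /= -exprVn expr2.
Qed.

Lemma rect_integral_boundary_sum g s : 0 < s -> holomorphic g ->
  `|rect_integral (fun z => g z * z ^- 2) (- s) s (- s) s| <= boundary_sum g s / s ^+ 2.
Proof.
move=> s0 hg; set h := fun z => _.
have B x y : s <= `|x| \/ s <= `|y| ->
    normc (h (x +i* y)) <= normc (g (x +i* y)) / s ^+ 2.
  move=> xy.
  have sn : s <= normc (x +i* y).
    case: xy => H; first exact: le_trans H (normc_Re (x +i* y)).
    exact: le_trans H (normc_Im (x +i* y)).
  rewrite Normc.normcM Normc.normcV normcX ler_wpM2l ?normc_ge0//.
  have n0 : 0 < normc (x +i* y) by exact: lt_le_trans sn.
  by rewrite lef_pV2 ?posrE ?exprn_gt0// lerXn2r ?nnegrE ?(ltW n0) ?(ltW s0).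
have hc x y : (x != 0) || (y != 0) -> ccontinuous h (x +i* y).
  by move=> /complex_neq0 z0; have [D /cderiv_ccontinuous] := holomorphic_divX2 hg z0.
have hs y : y != 0 -> hseg_continuous h (- s) s y.
  by move=> y0 x _; apply: hc; rewrite y0 orbT.
have vs x : x != 0 -> vseg_continuous h x (- s) s.
  by move=> x0 y _; apply: hc; rewrite x0.
have s00 : s != 0 by rewrite gt_eqF.
have ns0 : - s != 0 by rewrite oppr_eq0.
have ns : `|s| = s by rewrite gtr0_norm.
have cg z : ccontinuous g z by have [D /cderiv_ccontinuous] := hg z.
have ch y : seg_continuous (- s) s (fun x => normc (g (x +i* y))).
  move=> x _; exact: (@ccontinuous_normc_path g (fun s => s +i* y) x (horizontal_path y) (cg _)).
have cv x : seg_continuous (- s) s (fun y => normc (g (x +i* y))).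
  move=> y _; exact: (@ccontinuous_normc_path g (fun s => x +i* s) y (vertical_path x) (cg _)).
have side (u v : R -> R) : seg_continuous (- s) s u -> seg_continuous (- s) s v ->
    (forall x, `|u x| <= v x / s ^+ 2) ->
    `|\int[leb]_(x in `[- s, s]) u x| <= (\int[leb]_(x in `[- s, s]) v x) / s ^+ 2.
  move=> cu cv' uv; rewrite (le_trans (le_normr_Rintegral _ _))//; first exact: seg_integrable.
  rewrite mulrC -RintegralZl//; last exact: seg_integrable.
  apply: seg_integral_le => [x xs|x xs|x _].
  - by apply: cvg_norm; exact: cu.
  - by apply: cvgM; [exact: cvg_cst|exact: cv'].
  - by rewrite mulrC.
rewrite /rect_integral /boundary_sum mulrDl (le_trans (ler_normB _ _))// lerD//.
  apply: side => [||x].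
  - exact: seg_continuousB (hseg_continuous_Re (hs _ _)) (hseg_continuous_Re (hs _ _)).
  - by move=> x xs; apply: cvgD; exact: ch.
  rewrite mulrDl (le_trans (ler_normB _ _))// lerD//.
    by rewrite (le_trans (normc_Re _))// B//; right; rewrite normrN ns.
  by rewrite (le_trans (normc_Re _))// B//; right; rewrite ns.
apply: side => [||y].
- exact: seg_continuousB (vseg_continuous_Im (vs _ _)) (vseg_continuous_Im (vs _ _)).
- by move=> x xs; apply: cvgD; exact: cv.
rewrite mulrDl (le_trans (ler_normB _ _))// lerD//.
  by rewrite (le_trans (normc_Im _))// B//; left; rewrite ns.
by rewrite (le_trans (normc_Im _))// B//; left; rewrite normrN ns.
Qed.

Lemma rect_integralB h1 h2 a b c d :
  hseg_continuous h1 a b c -> hseg_continuous h1 a b d ->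
  vseg_continuous h1 a c d -> vseg_continuous h1 b c d ->
  hseg_continuous h2 a b c -> hseg_continuous h2 a b d ->
  vseg_continuous h2 a c d -> vseg_continuous h2 b c d ->
  rect_integral (fun z => h1 z - h2 z) a b c d =
  rect_integral h1 a b c d - rect_integral h2 a b c d.
Proof.
move=> /hseg_continuous_Re H1 /hseg_continuous_Re H2 /vseg_continuous_Im H3 /vseg_continuous_Im H4.
move=> /hseg_continuous_Re H5 /hseg_continuous_Re H6 /vseg_continuous_Im H7 /vseg_continuous_Im H8.
have aux (x1 y1 x2 y2 : R) : (x1 - y1) - (x2 - y2) = (x1 - x2) - (y1 - y2) by ring.
rewrite /rect_integral aux.
rewrite -!(RintegralB (mu := leb))//; try exact/seg_integrable/seg_continuousB.
congr (_ - _); apply: eq_Rintegral => x _.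
  move: (h1 _) (h2 _) (h1 (x +i* d)) (h2 _) => [? ?] [? ?] [? ?] [? ?] /=; ring.
move: (h1 _) (h2 _) (h1 (a +i* x)) (h2 _) => [? ?] [? ?] [? ?] [? ?] /=; ring.
Qed.

(** Since [g 0 = 0], the difference of g(z) / z^2 and D / z is o(1 / |z|) at 0, so both have the
    same integral along the square. For D / z it is bounded below by the residue computation, for
    g(z) / z^2 above by |z| >= s. *)
Lemma cauchy_estimate_Im g s D : 0 < s -> holomorphic g -> g 0 = 0 -> cderiv g 0 D ->
  4 * `|complex.Im D| <= boundary_sum g s / s ^+ 2.
Proof.
move=> s0 hg g0 gD.
apply: le_trans (rect_integral_residue D s0) _.
apply: le_trans (rect_integral_boundary_sum s0 hg).
have h1D z : z != 0 -> exists D, cderiv (fun z => g z * z ^- 2) z D.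
  exact: holomorphic_divX2.
have h2D z : z != 0 -> exists D', cderiv (fun z => D * z^-1) z D'.
  by move=> /cderivV zV; exists (D * - z ^- 2); exact: cderivZ.
have hs h y : (forall z, z != 0 -> exists D', cderiv h z D') -> y != 0 ->
    hseg_continuous h (- s) s y.
  move=> hD y0 x _.
  have [|E /cderiv_ccontinuous//] := hD (x +i* y).
  by apply: complex_neq0; rewrite y0 orbT.
have vs h x : (forall z, z != 0 -> exists D', cderiv h z D') -> x != 0 ->
    vseg_continuous h x (- s) s.
  move=> hD x0 y _.
  have [|E /cderiv_ccontinuous//] := hD (x +i* y).
  by apply: complex_neq0; rewrite x0.
have s00 : s != 0 by rewrite gt_eqF.
have ns0 : - s != 0 by rewrite oppr_eq0.
suff : rect_integral (fun z => g z * z ^- 2) (- s) s (- s) s -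
       rect_integral (fun z => D * z^-1) (- s) s (- s) s = 0.
  by move=> /eqP; rewrite subr_eq0 => /eqP ->.
rewrite -rect_integralB//; try (by [exact: hs|exact: vs]).
apply: punctured_rect_integral0 => // [z z0|e e0].
  have [D1 H1] := h1D _ z0; have [D2 H2] := h2D _ z0.
  by exists (D1 - D2); exact: cderivB.
have [d d0 H] := gD _ e0; exists d => // z z0 zd.
have := H _ zd; rewrite add0r g0 subr0 => {}H.
have n0 : 0 < normc z by rewrite normc_gt0.
have -> : g z * z ^- 2 - D * z^-1 = (g z - z * D) * z ^- 2 by field.
rewrite Normc.normcM Normc.normcV normcX mulrC -mulrA.
have -> : normc z ^- 2 * normc z = (normc z)^-1 by field; rewrite gt_eqF.
by rewrite ler_pdivrMr.
Qed.

(** [rect_integral] sees only the imaginary part of [D]; the real part is recovered from the same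
    estimate for i g, as Im (i D) = Re D and |i g| = |g|. *)
Theorem cauchy_estimate g s D : 0 < s -> holomorphic g -> g 0 = 0 -> cderiv g 0 D ->
  2 * normc D <= boundary_sum g s / s ^+ 2.
Proof.
move=> s0 hg g0 gD; have HI := cauchy_estimate_Im s0 hg g0 gD.
have HR : 4 * `|complex.Re D| <= boundary_sum g s / s ^+ 2.
  have hig : holomorphic (fun z => 'i * g z).
    by move=> z; have [E HE] := hg z; exists ('i * E); exact: cderivZ.
  have ig0 : 'i * g 0 = 0 :> R[i] by rewrite g0 mulr0.
  have := cauchy_estimate_Im s0 hig ig0 (cderivZ 'i gD).
  have -> : complex.Im ('i * D) = complex.Re D by case: (D) => a b /=; ring.
  suff -> : boundary_sum (fun z => 'i * g z) s = boundary_sum g s by [].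
  have ni (w : R[i]) : normc ('i * w) = normc w.
    by rewrite Normc.normcM /= expr0n add0r expr1n sqrtr1 mul1r.
  by rewrite /boundary_sum; congr (_ + _); apply: eq_Rintegral => x _; rewrite !ni.
have := normc_le_ReIm D; lra.
Qed.

End cauchy_estimate.

(** * Measurability and local boundedness of continuous functions on the plane *)

Section plane.
Context {R : realType}.
Local Notation normc := (@Normc.normc R).

(** The preimage of an open ray is the union of the open squares with rational centre and radius
    that it contains, a countable family. *)
Lemma continuous2_measurable (f : R * R -> R) :
  (forall p (e : R), 0 < e -> exists2 d : R, 0 < d &
    forall q, `|q.1 - p.1| < d -> `|q.2 - p.2| < d -> `|f q - f p| < e) ->
  measurable_fun [set: R * R] f.
Proof.
move=> cf mD; apply: (measurability _ (RGenOInfty.measurableE R)) => //.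
move=> /= _ [_ [a ->] <-]; rewrite setTI.
pose box (q1 q2 r : rat) : set (R * R) :=
  `]ratr q1 - ratr r, ratr q1 + ratr r[%classic `*` `]ratr q2 - ratr r, ratr q2 + ratr r[%classic.
rewrite [X in measurable X](_ : _ = \bigcup_(q1 : rat) \bigcup_(q2 : rat) \bigcup_(r : rat)
  (if pselect (box q1 q2 r `<=` f @^-1` `]a, +oo[) then box q1 q2 r else set0)).
  apply: bigcupT_measurable_rat => q1; apply: bigcupT_measurable_rat => q2.
  apply: bigcupT_measurable_rat => r.
  case: pselect => [?|?]; last exact: measurable0.
  by apply: measurableX; exact: measurable_itv.
apply/seteqP; split => [p /=|p [q1 _ [q2 _ [r _]]]]; last first.
  by case: pselect => //= H /H.
rewrite in_itv/= andbT -subr_gt0 => fpa; have [d d0 Hd] := cf p _ fpa.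
(* The square contains [p] but is not centred there: its points differ from [p] by less than 2 r in
   each coordinate, hence r < d / 2. *)
have [r] := @rat_in_itvoo R 0 (d / 2) ltac:(by rewrite divr_gt0).
rewrite in_itv/= => /andP[r0 rd].
have [q1] := @rat_in_itvoo R (p.1 - ratr r) (p.1 + ratr r) ltac:(lra).
rewrite in_itv/= => /andP[q1l q1r].
have [q2] := @rat_in_itvoo R (p.2 - ratr r) (p.2 + ratr r) ltac:(lra).
rewrite in_itv/= => /andP[q2l q2r].
exists q1 => //; exists q2 => //; exists r => //.
case: pselect => [?|[]].
  by split; rewrite /= in_itv/=; apply/andP; split; lra.
move=> q [/=]; rewrite !in_itv/= => /andP[? ?] /andP[? ?]; rewrite andbT.
have := Hd q; rewrite !ltr_norml => /(_ ltac:(apply/andP; lra) ltac:(apply/andP; lra)) /andP[]; lra.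
Qed.

Lemma ccontinuous_plane (f : R[i] -> R[i]) (p : R * R) (e : R) :
  ccontinuous f (p.1 +i* p.2) -> 0 < e -> exists2 d : R, 0 < d &
    forall q : R * R, `|q.1 - p.1| < d -> `|q.2 - p.2| < d ->
      `|normc (f (q.1 +i* q.2)) - normc (f (p.1 +i* p.2))| < e.
Proof.
move=> cf e0; have [d d0 H] := cf _ e0; exists (d / 2); first by rewrite divr_gt0.
move=> q q1 q2; rewrite (le_lt_trans (ler_dist_normc _ _))// H//.
by rewrite (le_lt_trans (normc_le_ReIm _))//= (splitr d) ltrD.
Qed.

Lemma ccontinuous_measurable (f : R[i] -> R[i]) : (forall z, ccontinuous f z) ->
  measurable_fun [set: R * R] (fun p => normc (f (p.1 +i* p.2))).
Proof. by move=> cf; apply: continuous2_measurable => p e; exact: ccontinuous_plane. Qed.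

Lemma ccontinuous_bounded (f : R[i] -> R[i]) (r : R) : (forall z, ccontinuous f z) ->
  exists2 M : R, 0 < M & forall z, normc z <= r -> normc (f z) <= M.
Proof.
move=> cf.
have cg : continuous (fun p : R * R => normc (f (p.1 +i* p.2)) : R^o).
  move=> p; apply/cvgrPdist_lt => e e0.
  have [d d0 H] := ccontinuous_plane (cf (p.1 +i* p.2)) e0.
  apply: filterS (nbhsx_ballx p d d0) => q [/= q1 q2]; rewrite distrC.
  have {}q1 : `|q.1 - p.1| < d by rewrite distrC; exact: q1.
  have {}q2 : `|q.2 - p.2| < d by rewrite distrC; exact: q2.
  exact: H q1 q2.
have cK : compact (`[- r, r]%classic `*` `[- r, r]%classic : set (R * R)).
  by apply: compact_setX; exact: segment_compact.
have [M [_ HM]] := compact_bounded (continuous_compact (continuous_subspaceT cg) cK).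
exists (Num.max M 0 + 1); first by rewrite ltr_pwDr// le_max lexx orbT.
move=> z zr.
have Mlt : M < Num.max M 0 + 1 by rewrite ltr_pwDr// le_max lexx.
suff H : `|normc (f z)| <= Num.max M 0 + 1 by rewrite -[leLHS]ger0_norm ?normc_ge0.
apply: (HM _ Mlt).
exists (complex.Re z, complex.Im z) => /=; last by case: (z).
split; rewrite /= in_itv/= -ler_norml (le_trans _ zr)//.
  exact: normc_Re.
exact: normc_Im.
Qed.

End plane.

(** * Mean value inequality and local bounds for holomorphic functions *)

Section mean_value.
Context {R : realType}.
Local Notation normc := (@Normc.normc R).
Implicit Types (f g h : R[i] -> R[i]) (z D : R[i]).

Lemma is_derive_line f (w k D : R[i]) (t : R) : cderiv f (w + t%:C * k) D ->
  is_derive t 1 (fun t : R => complex.Re (f (w + t%:C * k))) (complex.Re (k * D)).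
Proof.
move=> fD.
have H : h^-1 *: (complex.Re (f (w + (h + t)%:C * k)) - complex.Re (f (w + t%:C * k)))
    @[h --> (0:R)^'] --> complex.Re (k * D).
  apply/cvgrPdist_le => e e0.
  have k0 : 0 < normc k + 1 by rewrite ltr_wpDl ?normc_ge0.
  have [d d0 Hd] := fD _ (divr_gt0 e0 k0).
  apply/nbhs_ballP; exists (d / (normc k + 1)); first by rewrite /= divr_gt0.
  move=> h; rewrite /ball/= sub0r normrN => hd h0.
  have hk : normc (h%:C * k) <= `|h| * (normc k + 1).
    by rewrite Normc.normcM normc_real ler_wpM2l// lerDl.
  have hdk : normc (h%:C * k) < d by rewrite (le_lt_trans hk)// -ltr_pdivlMr.
  have {Hd} := Hd _ hdk.
  have -> : w + t%:C * k + h%:C * k = w + (h + t)%:C * k.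
    by rewrite rmorphD/=; ring.
  set u := f (w + (h + t)%:C * k); set v := f _ => Huv.
  have : `|complex.Re (u - v - h%:C * k * D)| <= e * `|h|.
    rewrite (le_trans (normc_Re _))// (le_trans Huv)//.
    have e1 : 0 <= e / (normc k + 1) by rewrite divr_ge0 ?ltW.
    by rewrite (le_trans (ler_wpM2l e1 hk))// mulrCA divfK ?gt_eqF// mulrC.
  have -> : complex.Re (u - v - h%:C * k * D) = complex.Re u - complex.Re v - h * complex.Re (k * D).
    by rewrite -mulrA; case: (u) (v) (k * D) => [? ?] [? ?] [? ?] /=; ring.
  move=> He; rewrite /GRing.scale/=.
  have aux (a b c x : R) : x != 0 -> a - x^-1 * (b - c) = - x^-1 * (b - c - x * a).
    by move=> x0; field.
  rewrite aux//.
  by rewrite normrM normrN normfV ler_pdivrMl ?normr_gt0// [`|h| * e]mulrC.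
apply: DeriveDef.
  apply/cvg_ex; exists (complex.Re (k * D)); apply: cvg_trans H; apply: near_eq_cvg.
  by apply: nearW => h /=; rewrite /GRing.scale/= mulr1.
apply/cvg_lim => //; apply: cvg_trans H; apply: near_eq_cvg.
by apply: nearW => h /=; rewrite /GRing.scale/= mulr1.
Qed.

Lemma mean_value_Re f (f' : R[i] -> R[i]) (w k : R[i]) (M : R) :
  (forall t : R, 0 <= t <= 1 -> cderiv f (w + t%:C * k) (f' (w + t%:C * k))) ->
  (forall t : R, 0 <= t <= 1 -> normc (f' (w + t%:C * k)) <= M) ->
  `|complex.Re (f (w + k) - f w)| <= M * normc k.
Proof.
move=> fD fM.
have [|||c] := @MVT_segment R (fun t : R => complex.Re (f (w + t%:C * k)))
  (fun t => complex.Re (k * f' (w + t%:C * k))) 0 1.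
- by [].
- move=> t; rewrite in_itv/= => /andP[t0 t1]; apply: is_derive_line.
  by apply: fD; rewrite !ltW.
- apply: continuous_in_subspaceT => t; rewrite inE/= in_itv/= => /fD.
  move=> /is_derive_line[+ _] => /derivable1_diffP /differentiable_continuous.
  exact.
rewrite in_itv/= => cI; rewrite subr0 mulr1 !rmorph1 rmorph0 mul1r mul0r addr0 => E.
have -> : complex.Re (f (w + k) - f w) = complex.Re (f (w + k)) - complex.Re (f w).
  by case: (f (w + k)) (f w) => [? ?] [? ?].
rewrite E (le_trans (normc_Re _))// Normc.normcM mulrC ler_wpM2r ?normc_ge0//.
exact: fM.
Qed.

(** The mean value theorem on a segment applies to real-valued functions only. Using it for the real
    parts of f and of i f bounds both components and costs the factor 2. *)
Lemma mean_value f (f' : R[i] -> R[i]) (w k : R[i]) (M : R) :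
  (forall t : R, 0 <= t <= 1 -> cderiv f (w + t%:C * k) (f' (w + t%:C * k))) ->
  (forall t : R, 0 <= t <= 1 -> normc (f' (w + t%:C * k)) <= M) ->
  normc (f (w + k) - f w) <= 2 * M * normc k.
Proof.
move=> fD fM.
have H1 := mean_value_Re fD fM.
have H2 : `|complex.Re ('i * f (w + k) - 'i * f w)| <= M * normc k.
  apply: (@mean_value_Re (fun z => 'i * f z) (fun z => 'i * f' z)) => t t01.
    by apply: cderivZ; exact: fD.
  by rewrite Normc.normcM /= expr0n add0r expr1n sqrtr1 mul1r fM.
apply: (le_trans (normc_le_ReIm _)).
have -> : `|complex.Im (f (w + k) - f w)| = `|complex.Re ('i * f (w + k) - 'i * f w)|.
  rewrite -normrN; congr (`|_|).
  by case: (f (w + k)) (f w) => [? ?] [? ?] /=; ring.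
rewrite -mulrA mulr_natl mulr2n; exact: lerD.
Qed.

Lemma boundary_sum_le g (s M : R) : 0 < s -> holomorphic g ->
  (forall z, normc z <= 2 * s -> normc (g z) <= M) ->
  boundary_sum g s <= 8 * M * s.
Proof.
move=> s0 hg gM.
have cg z : ccontinuous g z by have [D /cderiv_ccontinuous] := hg z.
have ch y : seg_continuous (- s) s (fun x => normc (g (x +i* y))).
  move=> x _; exact: (@ccontinuous_normc_path _ g (fun s => s +i* y) x (horizontal_path y) (cg _)).
have cv x : seg_continuous (- s) s (fun y => normc (g (x +i* y))).
  move=> y _; exact: (@ccontinuous_normc_path _ g (fun s => x +i* s) y (vertical_path x) (cg _)).
have B x y : `|x| <= s -> `|y| <= s -> normc (g (x +i* y)) <= M.
  by move=> xs ys; rewrite gM// (le_trans (normc_le_ReIm _))//= mulr_natl mulr2n lerD.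
have ss : - s <= s by lra.
have nt : `|s| <= s by rewrite gtr0_norm.
have side (u v : R -> R) : seg_continuous (- s) s u -> seg_continuous (- s) s v ->
    (forall x, `|x| <= s -> u x <= M) -> (forall x, `|x| <= s -> v x <= M) ->
    \int[@lebesgue_measure R]_(x in `[- s, s]) (u x + v x) <= 4 * M * s.
  move=> cu cv' uM vM.
  have -> : 4 * M * s = \int[@lebesgue_measure R]_(x in `[- s, s]) (2 * M).
    by rewrite seg_integral_cst//; ring.
  apply: seg_integral_le => [x xs|x xs|x xs].
  - by apply: cvgD; [exact: cu|exact: cv'].
  - exact: cvg_cst.
  by rewrite mulr_natl mulr2n lerD// ?uM ?vM// ler_norml.
have -> : 8 * M * s = 4 * M * s + 4 * M * s by ring.
by apply: lerD; apply: side => // x xs; apply: B; rewrite ?normrN.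
Qed.

Lemma holomorphic_shift f c : holomorphic f -> holomorphic (fun z => f (c + z)).
Proof.
move=> hf z; have [D HD] := hf (c + z); exists (1 * D).
rewrite addrC in HD; have := @cderiv_affine _ f z 1 c D.
rewrite mul1r => /(_ HD); apply: cderiv_eq => w.
by rewrite mul1r addrC.
Qed.

Lemma cderiv_shift f c z D : cderiv f (c + z) D -> cderiv (fun z => f (c + z)) z D.
Proof.
move=> HD; rewrite addrC in HD; have := @cderiv_affine _ f z 1 c D.
rewrite !mul1r => /(_ HD); apply: cderiv_eq => w.
by rewrite mul1r addrC.
Qed.

Lemma holomorphicB f g : holomorphic f -> holomorphic g -> holomorphic (fun z => f z - g z).
Proof.
move=> hf hg z; have [D HD] := hf z; have [E HE] := hg z.
by exists (D - E); exact: cderivB.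
Qed.

Lemma holomorphic_cst (c : R[i]) : holomorphic (fun=> c).
Proof. by move=> z; exists 0; exact: cderiv_cst. Qed.

(** Cauchy's estimate for f(c + z) - f(c), bounded by [2 * M], on the square of half side 1: its
    boundary has length 8 and lies in the disc of radius 2. *)
Lemma cderiv_le f c D (M : R) : holomorphic f -> cderiv f c D ->
  (forall z, normc (z - c) <= 2 -> normc (f z) <= M) -> normc D <= 8 * M.
Proof.
move=> hf fD fM.
pose g z := f (c + z) - f c.
have hg : holomorphic g.
  by apply: holomorphicB; [exact: holomorphic_shift|exact: holomorphic_cst].
have g0 : g 0 = 0 by rewrite /g addr0 subrr.
have gD : cderiv g 0 D.
  rewrite -[D]subr0; apply: cderivB; last exact: cderiv_cst.
  by apply: cderiv_shift; rewrite addr0.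
have := cauchy_estimate ltr01 hg g0 gD; rewrite expr1n divr1.
have gM z : normc z <= 2 * 1 -> normc (g z) <= 2 * M.
  rewrite mulr1 => z2; rewrite (le_trans (ler_normcB _ _))// mulr_natl mulr2n lerD// fM//.
    by rewrite addrAC subrr add0r.
  by rewrite subrr Normc.normc0.
have := boundary_sum_le ltr01 hg gM; lra.
Qed.

(* Both f' and the remainder f (w + k) - f w - k f' w are controlled by applying
   the Cauchy estimate to f and to the differences f (a + z) - f (b + z). *)
Lemma holomorphic_local_bounds f (f' : R[i] -> R[i]) (r : R) :
  (forall z, cderiv f z (f' z)) -> exists2 M : R, 0 < M &
  [/\ forall z, normc z <= r -> normc (f z) <= M,
      forall z, normc z <= r -> normc (f' z) <= M,
      forall w k, normc w <= r -> normc (w + k) <= r ->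
        normc (f' (w + k) - f' w) <= M * normc k &
      forall w k, normc w <= r -> normc (w + k) <= r ->
        normc (f (w + k) - f w - k * f' w) <= M * normc k ^+ 2].
Proof.
move=> fD; have hf : holomorphic f by move=> z; exists (f' z).
have cf z : ccontinuous f z by exact: cderiv_ccontinuous.
(* Each Cauchy estimate costs 2 in the radius: f is bounded up to [r + 4], f' and the increments of
   f up to [r + 2], the increments of f' up to [r]. *)
have [M M0 HM] := ccontinuous_bounded (r + 4) cf.
have B1 z : normc z <= r + 2 -> normc (f' z) <= 8 * M.
  move=> zr; apply: cderiv_le hf (fD z) _ => w wz.
  by rewrite HM// -(subrK z w) (le_trans (le_normcD _ _))//; lra.
have seg (s : R) (w k : R[i]) (t : R) : normc w <= s -> normc (w + k) <= s -> 0 <= t <= 1 ->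
    normc (w + t%:C * k) <= s.
  move=> ws wks /andP[t0 t1].
  have -> : w + t%:C * k = (1 - t)%:C * w + t%:C * (w + k).
    by rewrite rmorphB rmorph1/=; ring.
  rewrite (le_trans (le_normcD _ _))// !Normc.normcM !normc_real !ger0_norm ?subr_ge0//.
  have -> : s = (1 - t) * s + t * s by ring.
  by rewrite lerD// ler_wpM2l// subr_ge0.
have B2 w k : normc w <= r + 2 -> normc (w + k) <= r + 2 ->
    normc (f (w + k) - f w) <= 16 * M * normc k.
  move=> wr wkr; have -> : 16 * M = 2 * (8 * M) by ring.
  by apply: (@mean_value f f') => // t t01; apply: B1; exact: seg.
have B3 w k : normc w <= r -> normc (w + k) <= r ->
    normc (f' (w + k) - f' w) <= 128 * M * normc k.
  move=> wr wkr; pose g z := f (w + k + z) - f (w + z).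
  have hg : holomorphic g by apply: holomorphicB; exact: holomorphic_shift.
  have gD : cderiv g 0 (f' (w + k) - f' w).
    by apply: cderivB; apply: cderiv_shift; rewrite addr0.
  have -> : 128 * M * normc k = 8 * (16 * M * normc k) by ring.
  apply: cderiv_le hg gD _ => z; rewrite subr0 => z2.
  rewrite /g addrAC B2//; rewrite ?[w + z + k]addrAC (le_trans (le_normcD _ _))//; lra.
have B4 w k : normc w <= r -> normc (w + k) <= r ->
    normc (f (w + k) - f w - k * f' w) <= 256 * M * normc k ^+ 2.
  move=> wr wkr.
  (* The remainder is an increment of this [g], whose derivative f'(z) - f'(w) is O(|k|) on the
     segment. *)
  pose g z := f z - f' w * z.
  have := @mean_value g (fun z => f' z - f' w) w k (128 * M * normc k).
  have -> : g (w + k) - g w = f (w + k) - f w - k * f' w by rewrite /g; ring.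
  have -> : 2 * (128 * M * normc k) * normc k = 256 * M * normc k ^+ 2 by ring.
  apply => t t01.
    apply: cderivB => //; rewrite -[X in cderiv _ _ X]mulr1; apply: cderivZ; exact: cderiv_id.
  rewrite (le_trans (B3 _ _ wr (seg _ _ _ _ wr wkr t01)))//.
  rewrite ler_wpM2l ?mulr_ge0 ?(ltW M0)// Normc.normcM normc_real.
  by move/andP: t01 => [t0 t1]; rewrite ger0_norm// ler_piMl ?normc_ge0.
exists (256 * M); first by rewrite mulr_gt0.
split.
- by move=> z zr; rewrite (le_trans (HM _ _))//; lra.
- by move=> z zr; rewrite (le_trans (B1 _ _))//; lra.
- move=> w k wr wkr; rewrite (le_trans (B3 _ _ wr wkr))// ler_wpM2r ?normc_ge0//; lra.
- exact: B4.
Qed.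

End mean_value.

(** * Complex exponential and area means *)

Section complex_exponential.
Context {R : realType}.
Local Notation normc := (@Normc.normc R).

Definition cexp (z : R[i]) : R[i] :=
  (expR (complex.Re z) * cos (complex.Im z)) +i* (expR (complex.Re z) * sin (complex.Im z)).

Lemma normc_cexp z : normc (cexp z) = expR (complex.Re z).
Proof.
rewrite /cexp /= !exprMn -mulrDr cos2Dsin2 mulr1 sqrtr_sqr.
by rewrite ger0_norm// expR_ge0.
Qed.

Lemma cexpD z w : cexp (z + w) = cexp z * cexp w.
Proof.
case: z w => [a b] [c d]; rewrite /cexp /= expRD cosD sinD.
by apply/eqP; rewrite eq_complex /=; apply/andP; split; apply/eqP; ring.
Qed.

Lemma cexp_real (x : R) : cexp x%:C = (expR x)%:C.
Proof. by rewrite /cexp /= cos0 sin0 mulr1 mulr0. Qed.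

Lemma is_derive_expansion (f : R -> R) (x D e : R) : is_derive x 1 f D -> 0 < e ->
  exists2 d : R, 0 < d & forall h, `|h| < d -> `|f (x + h) - f x - h * D| <= e * `|h|.
Proof.
move=> [fx <-] e0.
have /cvgrPdist_le /(_ _ e0) := fx.
move=> /nbhs_ballP[d /= d0 H]; exists d => // h hd.
have [->|h0] := eqVneq h 0; first by rewrite addr0 subrr mul0r subr0 normr0 mulr0.
have := H h; rewrite /ball/= sub0r normrN => /(_ hd h0).
have aux (u v c y : R) : y != 0 -> c - y^-1 * (u - v) = - y^-1 * (u - v - y * c).
  by move=> y0; field.
rewrite /GRing.scale/= mulr1 aux// normrM normrN normfV ler_pdivrMl ?normr_gt0//.
by rewrite [h + x]addrC [`|h| * e]mulrC.
Qed.

Lemma cexp_expansion (e : R) : 0 < e -> exists2 d : R, 0 < d &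
  forall h, normc h < d -> normc (cexp h - 1 - h) <= e * normc h.
Proof.
(* With [e] generalized, it suffices to treat [e <= 1]: the expansion for 1 implies those for larger
   values. *)
wlog : e / e <= 1 => [wlg e0|e1 e0].
  have [/wlg/(_ e0)//|/ltW e1] := leP e 1.
  have [d d0 H] := wlg 1 (lexx 1) ltr01; exists d => // h /H /le_trans; apply.
  by rewrite ler_wpM2r// normc_ge0.
have e8 : 0 < e / 8 by rewrite divr_gt0.
have [d1 d10 H1] := is_derive_expansion (is_derive_expR (0 : R)) e8.
have [d2 d20 H2] := is_derive_expansion (is_derive_cos (0 : R)) e8.
have [d3 d30 H3] := is_derive_expansion (is_derive_sin (0 : R)) e8.
exists (Num.min (Num.min d1 d2) (Num.min d3 (Num.min 1 (e / 8)))).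
  by rewrite !lt_min d10 d20 d30 e8 ltr01.
move=> h; rewrite !lt_min => /andP[/andP[h1 h2] /andP[h3 /andP[h4 h5]]].
have ar := normc_Re h; have br := normc_Im h.
have -> : cexp h - 1 - h =
  (expR (complex.Re h) * cos (complex.Im h) - 1 - complex.Re h) +i*
  (expR (complex.Re h) * sin (complex.Im h) - complex.Im h).
  by case: h {h1 h2 h3 h4 h5 ar br} => a b; rewrite /cexp/=; congr Complex; ring.
rewrite (le_trans (normc_le_ReIm _))//=.
move: h1 h2 h3 h4 h5 ar br; set r := normc h.
move: (complex.Re h) (complex.Im h) => a b h1 h2 h3 h4 h5 ar br.
have {H1} := H1 a (le_lt_trans ar h1).
have {H2} := H2 b (le_lt_trans br h2).
have {H3} := H3 b (le_lt_trans br h3).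
rewrite !add0r expR0 cos0 sin0 oppr0 mulr0 !subr0 !mulr1 addr0 => H3 H2 H1.
set E := expR a in H1 *; set S := sin b in H3 *; set C := cos b in H2 *.
have r0 : 0 <= r by rewrite (le_trans _ ar).
have eb : e / 8 * `|b| <= e / 8 * r by rewrite ler_wpM2l// ltW.
have ea : e / 8 * `|a| <= e / 8 * r by rewrite ler_wpM2l// ltW.
have A1 : `|E * C - 1 - a| <= 3 * (e / 8) * r.
  have -> : E * C - 1 - a = (E - 1 - a) * C + (1 + a) * (C - 1) by ring.
  have -> : 3 * (e / 8) * r = e / 8 * r * 1 + 2 * (e / 8 * r) by ring.
  rewrite (le_trans (ler_normD _ _))// lerD// normrM ler_pM//.
  - exact: le_trans H1 ea.
  - by rewrite ler_norml cos_geN1 cos_le1.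
  - rewrite (le_trans (ler_normD _ _))// normr1; lra.
  - exact: le_trans H2 eb.
have E1 : `|E - 1| <= 2 * (e / 8).
  have -> : E - 1 = (E - 1 - a) + a by ring.
  rewrite (le_trans (ler_normD _ _))//.
  have : e / 8 * r <= e / 8 by rewrite ler_piMr// ltW.
  lra.
have A2 : `|E * S - b| <= 4 * (e / 8) * r.
  have -> : E * S - b = E * (S - b) + (E - 1) * b by ring.
  have -> : 4 * (e / 8) * r = 2 * (e / 8 * r) + 2 * (e / 8) * r by ring.
  rewrite (le_trans (ler_normD _ _))// lerD// normrM ler_pM//.
  - have -> : E = (E - 1) + 1 by ring.
    rewrite (le_trans (ler_normD _ _))// normr1; lra.
  - exact: le_trans H3 eb.
have -> : e * r = 3 * (e / 8) * r + 5 * (e / 8 * r) by field.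
rewrite lerD//; apply: le_trans A2 _.
have : 0 <= e / 8 * r by rewrite mulr_ge0// ltW.
rewrite -mulrA; lra.
Qed.

Lemma cderiv_cexp z : cderiv cexp z (cexp z).
Proof.
move=> e e0; have ez : 0 < e / (normc (cexp z) + 1).
  by rewrite divr_gt0// ltr_wpDl ?normc_ge0.
have [d d0 H] := cexp_expansion ez; exists d => // h /H {}H.
have -> : cexp (z + h) - cexp z - h * cexp z = cexp z * (cexp h - 1 - h).
  by rewrite cexpD; ring.
rewrite Normc.normcM (le_trans (ler_wpM2l (normc_ge0 _) H))//.
rewrite mulrA ler_wpM2r ?normc_ge0// mulrCA ler_piMr ?(ltW e0)//.
by rewrite ler_pdivrMr ?ltr_wpDl ?normc_ge0// mul1r lerDl.
Qed.

Lemma holomorphicM (f g : R[i] -> R[i]) : holomorphic f -> holomorphic g ->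
  holomorphic (fun z => f z * g z).
Proof.
move=> hf hg z; have [D HD] := hf z; have [E HE] := hg z.
by exists (D * g z + f z * E); exact: cderivM.
Qed.

Lemma holomorphic_cexp (c b : R[i]) : holomorphic (fun z => cexp (c * z + b)).
Proof. by move=> z; exists (c * cexp (c * z + b)); apply: cderiv_affine; exact: cderiv_cexp. Qed.

Lemma holomorphic_id : holomorphic (@id R[i]).
Proof. by move=> z; exists 1; exact: cderiv_id. Qed.

End complex_exponential.

(** * Invariance of Lebesgue integrals under translation and reflection *)

Section translation_invariance.
Context {R : realType}.
Local Notation leb := (@lebesgue_measure R).
Local Open Scope ereal_scope.

(** The pushforward gives every half-open interval its length, and this characterizes Lebesgue
    measure. *)
Lemma lebesgue_measure_shift (c : R) (A : set R) : measurable A ->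
  pushforward leb (fun x => (c + x)%R : measurableTypeR R) A = leb A.
Proof.
move=> mA; have mc : measurable_fun [set: measurableTypeR R]
    (fun x : measurableTypeR R => (c + x)%R : measurableTypeR R).
  exact: measurable_funD.
pose f : {mfun measurableTypeR R >-> measurableTypeR R} :=
  HB.pack (fun x : measurableTypeR R => (c + x)%R : measurableTypeR R) (isMeasurableFun.Build _ _ _ _ _ mc).
apply/esym/(@lebesgue_measure_unique R (pushforward leb f)) => //= _ [[a b]] _ <-.
rewrite /pushforward (_ : _ @^-1` _ = `](a - c)%R, (b - c)%R]%classic); last first.
  by apply/seteqP; split => x /=; rewrite !in_itv/= => /andP[? ?]; apply/andP; split; lra.
rewrite !lebesgue_measure_itv/= !lte_fin ltrD2r.
by case: ifPn => // _; rewrite -!EFinD; congr EFin; ring.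
Qed.

Lemma ge0_integral_shift (c : R) (f : R -> \bar R) :
  measurable_fun [set: R] f -> (forall x, 0 <= f x) ->
  \int[leb]_x f (c + x)%R = \int[leb]_x f x.
Proof.
move=> mf f0.
have mc : measurable_fun [set: measurableTypeR R]
    (fun x : measurableTypeR R => (c + x)%R : measurableTypeR R).
  exact: measurable_funD.
have := @ge0_integral_pushforward _ _ _ _ R _ mc leb setT f measurableT mf.
rewrite preimage_setT => <- //.
apply: eq_measure_integral => A mA _; exact: lebesgue_measure_shift.
Qed.

Lemma ge0_integral_opp (f : R -> \bar R) :
  measurable_fun [set: R] f -> (forall x, 0 <= f x) ->
  \int[leb]_x f (- x)%R = \int[leb]_x f x.
Proof.
move=> mf f0.
have mc : measurable_fun [set: measurableTypeR R]
    (fun x : measurableTypeR R => (- x)%R : measurableTypeR R).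
  exact: measurable_funN.
have := @ge0_integral_pushforward _ _ _ _ R _ mc leb setT f measurableT mf.
rewrite preimage_setT => <- //.
apply: eq_measure_integral => A mA _; exact: lebesgue_measureN.
Qed.

End translation_invariance.

(** * The area mean inequality over squares *)

Section area_mean.
Context {R : realType}.
Local Notation leb := (@lebesgue_measure R).
Local Notation normc := (@Normc.normc R).
Implicit Types (f g : R[i] -> R[i]) (z : R[i]).

Lemma holomorphic_ccontinuous f z : holomorphic f -> ccontinuous f z.
Proof. by move=> /(_ z)[D /cderiv_ccontinuous]. Qed.

Lemma holomorphic_hseg f y : holomorphic f -> forall x, {for x, continuous (fun x => normc (f (x +i* y)))}.
Proof.
move=> hf x.
exact: (@ccontinuous_normc_path _ f (fun s => s +i* y) x (horizontal_path y) (holomorphic_ccontinuous _ hf)).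
Qed.

Lemma holomorphic_vseg f x : holomorphic f -> forall y, {for y, continuous (fun y => normc (f (x +i* y)))}.
Proof.
move=> hf y.
exact: (@ccontinuous_normc_path _ f (fun s => x +i* s) y (vertical_path x) (holomorphic_ccontinuous _ hf)).
Qed.

(* The Cauchy estimate for the derivative of z * f z at 0. *)
Lemma le_boundary_sum f (s : R) : 0 < s -> holomorphic f ->
  s * normc (f 0) <= boundary_sum f s.
Proof.
move=> s0 hf; pose g z := z * f z.
have hg : holomorphic g by exact: holomorphicM (@holomorphic_id R) hf.
have [D fD] := hf 0.
have gD : cderiv g 0 (f 0).
  have := cderivM (cderiv_id 0) fD.
  by rewrite mul1r mul0r addr0.
have := cauchy_estimate s0 hg (mul0r _) gD.
rewrite ler_pdivlMr ?exprn_gt0// => H.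
suff : boundary_sum g s <= 2 * s * boundary_sum f s.
  move=> /(le_trans H); rewrite -[2 * s * _]mulrA.
  have -> : 2 * normc (f 0) * s ^+ 2 = 2 * (s * (s * normc (f 0))) by ring.
  by rewrite ler_pM2l// ler_pM2l.
have ss : `|s| = s by rewrite gtr0_norm.
have B x y : `|x| <= s -> `|y| <= s -> normc (g (x +i* y)) <= 2 * s * normc (f (x +i* y)).
  move=> xs ys; rewrite Normc.normcM ler_wpM2r ?normc_ge0//.
  by rewrite (le_trans (normc_le_ReIm _))//= mulr_natl mulr2n lerD.
have side (u v u' v' : R -> R) : (forall x, {for x, continuous u}) ->
    (forall x, {for x, continuous v}) -> (forall x, {for x, continuous u'}) ->
    (forall x, {for x, continuous v'}) ->
    (forall x, `|x| <= s -> u x <= 2 * s * u' x) -> (forall x, `|x| <= s -> v x <= 2 * s * v' x) ->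
    \int[leb]_(x in `[- s, s]) (u x + v x) <= 2 * s * \int[leb]_(x in `[- s, s]) (u' x + v' x).
  move=> cu cv cu' cv' uu vv.
  have c' : seg_continuous (- s) s (fun x => u' x + v' x).
    by move=> x _; apply: cvgD; [exact: cu'|exact: cv'].
  rewrite -RintegralZl//; last exact: seg_integrable.
  apply: seg_integral_le => [x xs|x xs|x xs].
  - by apply: cvgD; [exact: cu|exact: cv].
  - by apply: cvgM; [exact: cvg_cst|exact: c'].
  by rewrite mulrDr lerD// ?uu ?vv// ler_norml.
rewrite /boundary_sum mulrDr lerD//; apply: side;
  try (by [exact: holomorphic_hseg|exact: holomorphic_vseg]);
  by move=> x xs; apply: B; rewrite ?normrN ?ss.
Qed.

Definition usquare (x : R) : R := \1_`[(-1), 1] x.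

Lemma usquare_ge0 x : 0 <= usquare x.
Proof. by rewrite /usquare indicE. Qed.

Lemma measurable_usquare D : measurable_fun D usquare.
Proof. exact: measurable_indic. Qed.

Lemma usquareE x : `|x| <= 1 -> usquare x = 1.
Proof. by move=> x1; rewrite /usquare indicE mem_set//= in_itv/= -ler_norml. Qed.

Lemma usquare_out x : 1 < `|x| -> usquare x = 0.
Proof.
move=> x1; rewrite /usquare indicE memNset//= in_itv/= -ler_norml.
by apply/negP; rewrite -ltNge.
Qed.

Definition cut f (p : R * R) : R := normc (f (p.1 +i* p.2)) * (usquare p.1 * usquare p.2).

Lemma cut_ge0 f p : 0 <= cut f p.
Proof. by rewrite /cut !mulr_ge0 ?normc_ge0 ?usquare_ge0. Qed.

Lemma measurable_cut f : holomorphic f -> measurable_fun [set: R * R] (cut f).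
Proof.
move=> hf; apply: measurable_funM.
  by apply: ccontinuous_measurable => z; exact: holomorphic_ccontinuous.
by apply: measurable_funM; apply: measurableT_comp => //; exact: measurable_usquare.
Qed.

Lemma EFin_seg_integral (u : R -> R) a b : (forall x, {for x, continuous u}) ->
  (\int[leb]_(x in `[a, b]) u x)%:E = (\int[leb]_(x in `[a, b]) (u x)%:E)%E.
Proof.
move=> cu; rewrite /Rintegral fineK//; apply: integrable_fin_num => //.
by apply: seg_integrable => x _; exact: cu.
Qed.

Local Open Scope ereal_scope.

(** A side of a square of half side [s <= 1], at level t with |t| <= 1, lies in a slice of the
    square [-1, 1]^2. Boundary integrals are thus dominated by slice integrals, to which Tonelli's
    theorem applies. *)
Lemma seg_le_slice (u : R -> R) (s t : R) : (0 < s)%R -> (s <= 1)%R -> (`|t| <= 1)%R ->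
  (forall x, {for x, continuous u}) -> (forall x, 0 <= u x)%R ->
  (\int[leb]_(x in `[- s, s]) u x)%:E <=
  \int[leb]_x (u x * (usquare x * usquare t))%:E.
Proof.
move=> s0 s1 t1 cu u0; rewrite EFin_seg_integral// integral_mkcond.
have mu : measurable_fun [set: R] u by exact: continuous_measurable_fun.
apply: ge0_le_integral => //.
- by move=> x _; apply: erestrict_ge0 => y _; rewrite lee_fin.
- apply/(measurable_restrictT _ _).1 => //.
  exact/measurable_EFinP/measurable_funTS.
- apply/measurable_EFinP; apply: measurable_funM => //; apply: measurable_funM => //.
  exact: measurable_usquare.
move=> x _; rewrite patchE; case: ifPn => [|_]; last first.
  by rewrite lee_fin !mulr_ge0 ?usquare_ge0.
rewrite inE/= in_itv/= -ler_norml => xs.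
by rewrite !usquareE ?mulr1// (le_trans xs).
Qed.

(** The boundary estimate is integrated over the half side s in [1/2, 1]. Each of the four sides
    sweeps out at most the whole area integral, and s >= 1/2 costs a factor 2, so half of |f(0)| is
    at most 8 times that integral. *)
Lemma area_mean0 f : holomorphic f ->
  (normc (f 0))%:E <= 16%:E * \int[leb \x leb]_p (cut f p)%:E.
Proof.
move=> hf; set I := \int[_]_p _.
have mk : measurable_fun [set: R * R] (EFin \o cut f).
  by apply/measurable_EFinP; exact: measurable_cut.
have k0 p : 0 <= (EFin \o cut f) p by rewrite lee_fin cut_ge0.
pose H (y : R) := \int[leb]_x (cut f (x, y))%:E.
pose V (x : R) := \int[leb]_y (cut f (x, y))%:E.
have mH : measurable_fun [set: R] H by exact: (measurable_fun_fubini_tonelli_G (m1 := leb) (EFin \o cut f) mk k0).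
have mV : measurable_fun [set: R] V by exact: (measurable_fun_fubini_tonelli_F (m2 := leb) (EFin \o cut f) mk k0).
have IH : \int[leb]_y H y = I.
  exact/esym/(fubini_tonelli2 (m1 := leb) (m2 := leb) (EFin \o cut f) mk k0).
have IV : \int[leb]_y V y = I.
  exact/esym/(fubini_tonelli1 (m1 := leb) (m2 := leb) (EFin \o cut f) mk k0).
have H0 y : 0 <= H y by apply: integral_ge0 => x _; exact: k0.
have V0 y : 0 <= V y by apply: integral_ge0 => x _; exact: k0.
pose S s := (H (- s)%R + H s) + (V s + V (- s)%R).
have mHN : measurable_fun [set: R] (fun s => H (- s)%R) by exact: measurableT_comp.
have mVN : measurable_fun [set: R] (fun s => V (- s)%R) by exact: measurableT_comp.
have S0 s : 0 <= S s by apply: adde_ge0; apply: adde_ge0.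
have mS : measurable_fun [set: R] S.
  by rewrite /S; apply: emeasurable_funD => /=; apply: emeasurable_funD => /=; [exact: mHN|exact: mH|exact: mV|exact: mVN].
have IS : \int[leb]_s S s = 4%:E * I.
  rewrite /S ge0_integralD//; last 4 first.
  - by move=> s _; rewrite adde_ge0.
  - exact: emeasurable_funD.
  - by move=> s _; rewrite adde_ge0.
  - exact: emeasurable_funD.
  rewrite (ge0_integralD leb measurableT (fun s _ => H0 (- s)%R) mHN (fun s _ => H0 s) mH).
  rewrite (ge0_integralD leb measurableT (fun s _ => V0 s) mV (fun s _ => V0 (- s)%R) mVN).
  rewrite (ge0_integral_opp mH H0) (ge0_integral_opp mV V0) IH IV.
  by rewrite mule_natl -addeA.
have B s : s \in `[2^-1, 1]%R -> (normc (f 0))%:E <= 2%:E * S s.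
  rewrite in_itv/= => /andP[s2 s1].
  have s0 : (0 < s)%R by rewrite (lt_le_trans _ s2).
  have : (2^-1 * normc (f 0) <= boundary_sum f s)%R.
    by rewrite (le_trans _ (le_boundary_sum s0 hf))// ler_wpM2r ?normc_ge0.
  rewrite ler_pdivrMl// -lee_fin => /le_trans; apply.
  rewrite EFinM lee_pmul2l//.
  have ss : (`|s| <= 1)%R by rewrite gtr0_norm.
  have nss : (`|- s| <= 1)%R by rewrite normrN.
  have N (t : R) : (`|t| <= 1)%R -> (\int[leb]_(x in `[(- s)%R, s]) normc (f (x +i* t)))%:E <= H t.
    move=> t1; apply: le_trans (seg_le_slice s0 s1 t1 _ _) _ => //.
    - exact: holomorphic_hseg.
    - by move=> x; exact: normc_ge0.
  have W (t : R) : (`|t| <= 1)%R -> (\int[leb]_(y in `[(- s)%R, s]) normc (f (t +i* y)))%:E <= V t.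
    move=> t1; apply: le_trans (seg_le_slice s0 s1 t1 _ _) _ => //.
    - exact: holomorphic_vseg.
    - by move=> x; exact: normc_ge0.
    rewrite le_eqVlt; apply/orP; left; apply/eqP; by apply: eq_integral => y _; rewrite /cut/= [(usquare y * _)%R]mulrC.
  have sc (u : R -> R) : (forall x, {for x, continuous u}) ->
    leb.-integrable `[(- s)%R, s] (EFin \o u).
    by move=> cu; apply: seg_integrable => x _; exact: cu.
  rewrite /boundary_sum !(RintegralD (mu := leb))//; try (apply: sc; by [exact: holomorphic_hseg|exact: holomorphic_vseg]).
  by rewrite !EFinD; apply: leeD; apply: leeD; [apply: N|apply: N|apply: W|apply: W].
have E1 : \int[leb]_(s in `[2^-1%R, 1%R]) (normc (f 0))%:E = 2^-1%:E * (normc (f 0))%:E.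
  rewrite integral_cst//= lebesgue_measure_itv/= lte_fin invf_lt1// ltr1n.
  rewrite muleC -EFinB; congr (_%:E * _); by field.
have : 2^-1%:E * (normc (f 0))%:E <= 8%:E * I.
  have -> : 8%:E * I = \int[leb]_s (2%:E * S s).
    by rewrite ge0_integralZl// IS muleA -EFinM; congr (_%:E * _); ring.
  rewrite -E1; apply: (@le_trans _ _ (\int[leb]_(s in `[2^-1%R, 1%R]) (2%:E * S s))).
    apply: ge0_le_integral => //=.
    - by move=> s _; rewrite lee_fin normc_ge0.
    - by apply: measurable_funTS; exact: measurable_funeM.
  apply: ge0_subset_integral => //=.
  - exact: measurable_funeM.
  - by move=> s _; rewrite mule_ge0.
rewrite -(@lee_pmul2l _ 2%:E)// !muleA -(EFinM 2 2^-1) mulfV// mul1e -(EFinM 2 8).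
by have -> : (2 * 8 = 16 :> R)%R by ring.
Qed.

Lemma area_mean f (z : R[i]) : holomorphic f ->
  (normc (f z))%:E <= 16%:E * \int[leb \x leb]_p
    (normc (f (p.1 +i* p.2)) * (usquare (p.1 - complex.Re z) * usquare (p.2 - complex.Im z)))%:E.
Proof.
move=> hf; have := area_mean0 (holomorphic_shift z hf); rewrite addr0 => /le_trans; apply.
rewrite lee_pmul2l// le_eqVlt; apply/orP; left; apply/eqP.
pose K p := (normc (f (p.1 +i* p.2)) * (usquare (p.1 - complex.Re z) * usquare (p.2 - complex.Im z)))%:E.
have mK : measurable_fun [set: R * R] K.
  apply/measurable_EFinP; apply: measurable_funM.
    by apply: ccontinuous_measurable => w; exact: holomorphic_ccontinuous.
  apply: measurable_funM; (apply: measurableT_comp; first exact: measurable_usquare);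
    exact: measurable_funB.
have K0 p : 0 <= K p by rewrite lee_fin !mulr_ge0 ?normc_ge0 ?usquare_ge0.
have mc : measurable_fun [set: R * R] (EFin \o cut (fun w => f (z + w)%R)).
  by apply/measurable_EFinP; exact: measurable_cut (holomorphic_shift z hf).
have c0 p : 0 <= (EFin \o cut (fun w => f (z + w)%R)) p by rewrite lee_fin cut_ge0.
rewrite (fubini_tonelli1 (m1 := leb) (m2 := leb) _ mc c0).
rewrite (fubini_tonelli1 (m1 := leb) (m2 := leb) K mK K0).
rewrite -[RHS](ge0_integral_shift (complex.Re z)); last 2 first.
- exact: (measurable_fun_fubini_tonelli_F (m2 := leb) K mK K0).
- by move=> x; apply: integral_ge0 => y _; exact: K0.
apply: eq_integral => x _; rewrite /fubini_F.
rewrite -[RHS](ge0_integral_shift (complex.Im z)); last 2 first.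
- exact: (measurableT_comp mK (@pair1_measurable _ _ _ _ (complex.Re z + x)%R)).
- by move=> y; exact: K0.
apply: eq_integral => y _; rewrite /K /cut /=; congr (_%:E).
rewrite [(complex.Re z + x)%R]addrC addrK [(complex.Im z + y)%R]addrC addrK.
congr (normc (f _) * _)%R.
by case: (z) => a b /=; congr Complex; ring.
Qed.

End area_mean.

(** * The pointwise bound with Gaussian weight *)

Section weighted_mean.
Context {R : realType}.
Local Notation leb := (@lebesgue_measure R).
Local Notation normc := (@Normc.normc R).

(** Here [x] stands for |z|, the only way in which the evaluation point enters the bound. *)
Definition fock_kernel (f : R[i] -> R[i]) (alpha x : R) (p : R * R) : R :=
  normc (f (p.1 +i* p.2)) * expR (- alpha * normc (p.1 +i* p.2) ^+ 2) *
  expR (alpha * x * normc (p.1 +i* p.2)).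

Lemma measurable_normc_plane : measurable_fun [set: R * R] (fun p => normc (p.1 +i* p.2)).
Proof.
apply: (@ccontinuous_measurable _ id) => z.
exact: holomorphic_ccontinuous (@holomorphic_id R).
Qed.

Lemma measurable_weight (f : R[i] -> R[i]) (c : R) : holomorphic f ->
  measurable_fun [set: R * R]
    (fun p => normc (f (p.1 +i* p.2)) * expR (c * normc (p.1 +i* p.2) ^+ 2)).
Proof.
move=> hf; apply: measurable_funM.
  by apply: ccontinuous_measurable => w; exact: holomorphic_ccontinuous.
apply: measurableT_comp => //; apply: measurable_funM => //.
by apply: measurable_funX; exact: measurable_normc_plane.
Qed.

Lemma measurable_fock_kernel f alpha x : holomorphic f ->
  measurable_fun [set: R * R] (fock_kernel f alpha x).
Proof.
move=> hf; apply: measurable_funM; first exact: measurable_weight.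
apply: measurableT_comp => //; apply: measurable_funM => //.
exact: measurable_normc_plane.
Qed.

(* The area mean is applied to f (w) exp (alpha conj(z) (z - w)): the extra factor
   is 1 at w = z and turns Lebesgue measure near z into the Gaussian weight. *)
Lemma weighted_mean f (alpha : R) (z : R[i]) : 0 < alpha -> holomorphic f ->
  ((normc (f z))%:E <= (16 * expR (2 * alpha))%:E *
    \int[leb \x leb]_p (fock_kernel f alpha (normc z) p)%:E)%E.
Proof.
move=> a0 hf.
pose c := (- alpha)%:C * z^*; pose b := (alpha * normc z ^+ 2)%:C.
pose g w := f w * cexp (c * w + b).
have hg : holomorphic g by apply: holomorphicM => //; exact: holomorphic_cexp.
have gz : normc (g z) = normc (f z).
  rewrite Normc.normcM normc_cexp.
  suff -> : complex.Re (c * z + b) = 0 by rewrite expR0 mulr1.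
  by rewrite /c /b sqr_normcE; case: (z) => u v /=; ring.
rewrite -gz EFinM -muleA; apply: (le_trans (area_mean z hg)).
rewrite lee_pmul2l//.
have mk := measurable_fock_kernel alpha (normc z) hf.
have k0 p : 0 <= fock_kernel f alpha (normc z) p by rewrite /fock_kernel !mulr_ge0 ?normc_ge0 ?expR_ge0.
rewrite -ge0_integralZl_EFin ?expR_ge0//; last 2 first.
- by move=> p _; rewrite lee_fin.
- exact/measurable_EFinP.
apply: ge0_le_integral => //.
- by move=> p _; rewrite lee_fin !mulr_ge0 ?normc_ge0 ?usquare_ge0.
- apply/measurable_EFinP; apply: measurable_funM.
    by apply: ccontinuous_measurable => w; exact: holomorphic_ccontinuous.
  apply: measurable_funM; (apply: measurableT_comp; first exact: measurable_usquare);
    exact: measurable_funB.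
- exact/measurable_funeM/measurable_EFinP.
move=> [x y] _; rewrite -EFinM lee_fin /=.
have [x1|x1] := leP `|x - complex.Re z| 1; last first.
  by rewrite usquare_out// mul0r mulr0 mulr_ge0 ?expR_ge0.
have [y1|y1] := leP `|y - complex.Im z| 1; last first.
  by rewrite (usquare_out y1) mulr0 mulr0 mulr_ge0 ?expR_ge0.
rewrite !usquareE// !mulr1 Normc.normcM normc_cexp /fock_kernel.
pose n : R := normc (x +i* y); pose m : R := normc z.
have CS : x * complex.Re z + y * complex.Im z <= m * n.
  have -> : m = normc z^* by rewrite /m; case: (z) => u v; rewrite /= sqrrN.
  rewrite -Normc.normcM (le_trans _ (normc_Re _))// (le_trans _ (ler_norm _))//.
  by case: (z) => u v /=; rewrite le_eqVlt; apply/orP; left; apply/eqP; ring.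
have H (t : R) : `|t| <= 1 -> t ^+ 2 <= 1.
  by move=> t1; rewrite -[leLHS]real_normK ?num_real// expr_le1.
(* On the unit square around z one has |w - z|^2 <= 2. Expanding the square gives |z|^2 - Re
   (conj(z) w) <= 2 - |w|^2 + Re (conj(z) w); the 2 becomes the factor [expR (2 * alpha)]. *)
have aux (a u N : R) : a * complex.Re z + u * complex.Im z <= N ->
    (a - complex.Re z) ^+ 2 <= 1 -> (u - complex.Im z) ^+ 2 <= 1 ->
    m ^+ 2 - (a * complex.Re z + u * complex.Im z) <= 2 - (a ^+ 2 + u ^+ 2) + N.
  by rewrite /m sqr_normcE; lra.
have W : complex.Re (c * (x +i* y) + b) <= 2 * alpha + (- alpha * n ^+ 2 + alpha * m * n).
  have -> : complex.Re (c * (x +i* y) + b) =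
      alpha * (m ^+ 2 - (x * complex.Re z + y * complex.Im z)).
    by rewrite /c /b /m; case: (z) => u v /=; ring.
  have := ler_wpM2l (ltW a0) (aux _ _ _ CS (H _ x1) (H _ y1)).
  rewrite -(sqr_normcE (x +i* y)) -/n => /le_trans; apply.
  by rewrite le_eqVlt; apply/orP; left; apply/eqP; ring.
rewrite -/n -/m [leRHS]mulrCA -!mulrA ler_wpM2l ?normc_ge0//.
rewrite [leRHS]mulrCA mulrA -!expRD ler_expR.
by apply: (le_trans W); rewrite le_eqVlt; apply/orP; left; apply/eqP; ring.
Qed.
End weighted_mean.

(** * Series and Gaussian integrals *)

Section nonnegative_series.
Context {R : realType}.
Local Open Scope ereal_scope.

Lemma EFin_expR (x : R) : (0 <= x)%R ->
  (expR x)%:E = \sum_(n <oo) (x ^+ n / n`!%:R)%:E.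
Proof.
move=> x0; rewrite /expR -EFin_lim; last exact: is_cvg_series_exp_coeff.
by apply/congr_lim/funext => n /=; rewrite /series/= -sumEFin.
Qed.

Lemma EFin_expRM (x c : R) : (0 <= x)%R -> (0 <= c)%R ->
  (c * expR x)%:E = \sum_(n <oo) (c * (x ^+ n / n`!%:R))%:E.
Proof.
move=> x0 c0; under eq_eseriesr do rewrite EFinM.
rewrite nneseriesZl; first by rewrite -EFin_expR.
by move=> n _; rewrite lee_fin divr_ge0// exprn_ge0.
Qed.

(* This replaces Tonelli's theorem, which is not available because mu need not be
   sigma-finite. *)
Lemma series_kernel_swap d1 d2 (T1 : measurableType d1) (T2 : measurableType d2)
    (m1 : {measure set T1 -> \bar R}) (m2 : {measure set T2 -> \bar R})
    (D1 : set T1) (D2 : set T2) (u : nat -> T1 -> R) (v : nat -> T2 -> R) :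
  measurable D1 -> measurable D2 ->
  (forall n, measurable_fun D1 (u n)) -> (forall n, measurable_fun D2 (v n)) ->
  (forall n x, D1 x -> 0 <= u n x)%R -> (forall n y, D2 y -> 0 <= v n y)%R ->
  \int[m1]_(x in D1) \int[m2]_(y in D2) \sum_(n <oo) (u n x * v n y)%:E =
  \int[m2]_(y in D2) \int[m1]_(x in D1) \sum_(n <oo) (u n x * v n y)%:E.
Proof.
move=> mD1 mD2 mu mv u0 v0.
have Eu n : measurable_fun D1 (EFin \o u n) by exact/measurable_EFinP.
have Ev n : measurable_fun D2 (EFin \o v n) by exact/measurable_EFinP.
have V0 n : 0 <= \int[m2]_(y in D2) (v n y)%:E by apply: integral_ge0 => y; exact: v0.
have U0 n : 0 <= \int[m1]_(x in D1) (u n x)%:E by apply: integral_ge0 => x; exact: u0.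
transitivity (\sum_(n <oo) (\int[m1]_(x in D1) (u n x)%:E * \int[m2]_(y in D2) (v n y)%:E)).
  transitivity (\int[m1]_(x in D1) \sum_(n <oo) ((u n x)%:E * \int[m2]_(y in D2) (v n y)%:E)).
    apply: eq_integral => x; rewrite inE => D1x.
    rewrite integral_nneseries//; last 2 first.
    - by move=> n; apply/measurable_EFinP; apply: measurable_funM => //; exact: measurable_cst.
    - by move=> n y D2y; rewrite lee_fin mulr_ge0 ?u0 ?v0.
    apply: eq_eseriesr => n _; under eq_integral do rewrite EFinM.
    by apply: ge0_integralZl_EFin; [exact: mD2|exact: v0|exact: Ev|exact: u0].
  rewrite integral_nneseries//; last 2 first.
  - by move=> n; apply: emeasurable_funM; [exact: Eu|exact: measurable_cst].
  - by move=> n x D1x; rewrite mule_ge0// lee_fin u0.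
  apply: eq_eseriesr => n _.
  by apply: ge0_integralZr; [exact: mD1|exact: Eu|exact: u0|exact: V0].
transitivity (\int[m2]_(y in D2) \sum_(n <oo) ((v n y)%:E * \int[m1]_(x in D1) (u n x)%:E)).
  rewrite integral_nneseries//; last 2 first.
  - by move=> n; apply: emeasurable_funM; [exact: Ev|exact: measurable_cst].
  - by move=> n x D1x; rewrite mule_ge0// lee_fin v0.
  apply: eq_eseriesr => n _; rewrite muleC.
  by apply/esym/ge0_integralZr; [exact: mD2|exact: Ev|exact: v0|exact: U0].
apply: eq_integral => y; rewrite inE => D2y.
rewrite integral_nneseries//; last 2 first.
- by move=> n; apply/measurable_EFinP; apply: measurable_funM => //; exact: measurable_cst.
- by move=> n x D1x; rewrite lee_fin mulr_ge0 ?u0 ?v0.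
apply: eq_eseriesr => n _.
transitivity (\int[m1]_(x in D1) ((v n y)%:E * (u n x)%:E)).
  by apply/esym/ge0_integralZl_EFin; [exact: mD1|exact: u0|exact: Eu|exact: v0].
by apply: eq_integral => x _; rewrite -EFinM mulrC.
Qed.

End nonnegative_series.

(** * Gaussian integrals and the radial integral from both sides *)

Section gaussian.
Context {R : realType}.
Local Notation leb := (@lebesgue_measure R).

(** This is the total mass 1 of the normal law of variance 1 / (2 c). What matters is that [A] does
    not depend on the centre [m]. *)
Lemma gaussian_integral (c : R) : 0 < c -> exists2 A : R, 0 < A & forall m,
  (\int[leb]_x (expR (- c * (x - m) ^+ 2))%:E = A%:E)%E.
Proof.
move=> c0; pose s := Num.sqrt (2 * c)^-1.
have c20 : 0 < (2 * c)^-1 by rewrite invr_gt0 mulr_gt0.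
have s0 : s != 0 by rewrite gt_eqF// sqrtr_gt0.
have s2 : (s ^+ 2 *+ 2)^-1 = c.
  by rewrite sqr_sqrtr ?(ltW c20)// -mulr_natr invfM invrK; field.
have p0 := normal_peak_gt0 s0.
exists (normal_peak s)^-1; first by rewrite invr_gt0.
move=> m; have := integral_normal_pdf m s.
under eq_integral do rewrite normal_pdfE// /normal_fun -/(normal_fun m s _) EFinM.
rewrite ge0_integralZl_EFin ?ltW//; last 2 first.
- by move=> x _; rewrite lee_fin normal_fun_ge0.
- by apply/measurable_EFinP; exact: measurable_normal_fun.
have -> : (\int[leb]_x (normal_fun m s x)%:E =
    \int[leb]_x (expR (- c * (x - m) ^+ 2))%:E)%E.
  by apply: eq_integral => x _; rewrite /normal_fun s2 mulNr mulrC mulNr.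
move=> H; rewrite -[LHS]mul1e -[X in (X%:E * _)%E](@mulVf _ (normal_peak s)) ?gt_eqF//.
by rewrite EFinM -muleA H mule1.
Qed.

Lemma complete_square (alpha b r : R) : 0 < alpha ->
  b * r + - (alpha / 2) * r ^+ 2 = b ^+ 2 / (2 * alpha) + - (alpha / 2) * (r - b / alpha) ^+ 2.
Proof. by move=> a0; field; rewrite gt_eqF. Qed.

Definition radial_weight (alpha r : R) : R := expR (- (alpha / 2) * r ^+ 2) * r.

Lemma measurable_radial (alpha b : R) D :
  measurable_fun D (fun r => radial_weight alpha r * expR (b * r)).
Proof.
apply: measurable_funTS; apply: continuous_measurable_fun => r.
apply: cvgM.
  apply: cvgM; last exact: cvg_id.
  apply: (cvg_comp _ expR); last exact: continuous_expR.
  apply: cvgM; first exact: cvg_cst.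
  exact: exprn_continuous.
apply: (cvg_comp _ expR); last exact: continuous_expR.
by apply: cvgM; [exact: cvg_cst|exact: cvg_id].
Qed.

(** The square is completed around m = b / alpha and the Gaussian exponent is split into two halves
    q. One half absorbs the factor r, because r <= (m + K) (1 + q) <= (m + K) exp q; the other half
    is integrated. *)
Lemma radial_integral_le (alpha : R) : 0 < alpha -> exists2 C : R, 0 < C & forall b, 0 <= b ->
  (\int[leb]_(r in `]0%R, +oo[) (radial_weight alpha r * expR (b * r))%:E <=
   (C * (1 + b) * expR (b ^+ 2 / (2 * alpha)))%:E)%E.
Proof.
move=> a0; have a4 : 0 < alpha / 4 by rewrite divr_gt0.
have [A A0 HA] := gaussian_integral a4.
(* Chosen so that K (1 + q) >= 1 + (r - m)^2 >= r - m. *)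
pose K := 1 + 4 / alpha; have K0 : 0 < K by rewrite ltr_wpDr// divr_ge0// ltW.
exists (A * (alpha^-1 + K)); first by rewrite mulr_gt0// addr_gt0 ?invr_gt0.
move=> b b0; pose m := b / alpha; have m0 : 0 <= m by rewrite divr_ge0// ltW.
have pw r : 0 < r -> radial_weight alpha r * expR (b * r) <=
    expR (b ^+ 2 / (2 * alpha)) * (m + K) * expR (- (alpha / 4) * (r - m) ^+ 2).
  move=> r0; rewrite /radial_weight mulrAC -expRD [_ + b * r]addrC complete_square// -/m.
  rewrite expRD -!mulrA ler_wpM2l ?expR_ge0// mulrC.
  pose q := alpha / 4 * (r - m) ^+ 2.
  have q0 : 0 <= q by rewrite mulr_ge0 ?sqr_ge0// ltW.
  have -> : - (alpha / 2) * (r - m) ^+ 2 = - q + - q by rewrite /q; field.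
  have -> : - (alpha / 4) * (r - m) ^+ 2 = - q by rewrite /q; ring.
  rewrite expRD mulrA ler_wpM2r ?expR_ge0// expRN ler_pdivrMr ?expR_gt0//.
  have e1 : 1 + q <= expR q by exact: expR_ge1Dx.
  have rm : r - m <= K * (1 + q).
    have -> : K * (1 + q) = 1 + (r - m) ^+ 2 + 4 / alpha + q.
      by rewrite /K /q; field; rewrite gt_eqF.
    have : r - m <= 1 + (r - m) ^+ 2.
      have := sqr_ge0 (r - m - 1 / 2); lra.
    have : 0 <= 4 / alpha by rewrite divr_ge0// ltW.
    lra.
  apply: (@le_trans _ _ ((m + K) * (1 + q))); last by rewrite ler_wpM2l// addr_ge0// ltW.
  have : 0 <= m * q by rewrite mulr_ge0.
  lra.
have mg : measurable_fun [set: R] (fun r : R => expR (- (alpha / 4) * (r - m) ^+ 2)).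
  apply: measurableT_comp => //; apply: measurable_funM => //.
  by apply: measurable_funX; exact: measurable_funB.
apply: (@le_trans _ _ (\int[leb]_r
    (expR (b ^+ 2 / (2 * alpha)) * (m + K) * expR (- (alpha / 4) * (r - m) ^+ 2))%:E)%E).
  apply: (@le_trans _ _ (\int[leb]_(r in `]0%R, +oo[)
    (expR (b ^+ 2 / (2 * alpha)) * (m + K) * expR (- (alpha / 4) * (r - m) ^+ 2))%:E)%E).
    apply: ge0_le_integral => //.
    - move=> r /=; rewrite in_itv/= andbT => r0.
      by rewrite lee_fin mulr_ge0 ?expR_ge0// mulr_ge0 ?expR_ge0// ltW.
    - by apply/measurable_EFinP; apply: measurable_radial.
    - by apply/measurable_EFinP/measurable_funTS; exact: measurable_funM.
    - by move=> r /=; rewrite in_itv/= andbT => r0; rewrite lee_fin pw.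
  apply: ge0_subset_integral => //.
  - by apply/measurable_EFinP; exact: measurable_funM.
  - by move=> r _; rewrite lee_fin !mulr_ge0 ?expR_ge0// addr_ge0// ltW.
under eq_integral do rewrite EFinM.
rewrite ge0_integralZl_EFin; last 4 first.
- by [].
- by move=> r _; rewrite lee_fin expR_ge0.
- exact/measurable_EFinP.
- by rewrite mulr_ge0 ?expR_ge0// addr_ge0// ltW.
rewrite HA -EFinM lee_fin.
have -> : A * (alpha^-1 + K) * (1 + b) * expR (b ^+ 2 / (2 * alpha)) =
  expR (b ^+ 2 / (2 * alpha)) * ((alpha^-1 + K) * (1 + b)) * A by ring.
rewrite ler_pM2r// ler_pM2l ?expR_gt0//.
have : 0 <= alpha^-1 by rewrite invr_ge0 ltW.
have : 0 <= K * b by rewrite mulr_ge0// ltW.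
rewrite /m; lra.
Qed.

(** Only the unit interval to the right of the peak m = b / alpha is kept: there r >= m and (r -
    m)^2 <= 1. *)
Lemma radial_integral_ge (alpha b : R) : 0 < alpha -> 0 <= b ->
  ((b / alpha * expR (- (alpha / 2)) * expR (b ^+ 2 / (2 * alpha)))%:E <=
   \int[leb]_(r in `]0%R, +oo[) (radial_weight alpha r * expR (b * r))%:E)%E.
Proof.
move=> a0 b0; pose m := b / alpha; have m0 : 0 <= m by rewrite divr_ge0// ltW.
pose k := m * expR (- (alpha / 2)) * expR (b ^+ 2 / (2 * alpha)).
have k0 : 0 <= k.
  by apply: mulr_ge0; [apply: mulr_ge0 => //|]; exact: expR_ge0.
have -> : (k%:E = \int[leb]_(r in `]m, (m + 1)%R]) k%:E)%E.
  rewrite integral_cst//= lebesgue_measure_itv/= lte_fin ltrDl ltr01.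
  by rewrite -EFinB (_ : m + 1 - m = 1) ?mule1//; ring.
apply: (@le_trans _ _ (\int[leb]_(r in `]m, (m + 1)%R])
    (radial_weight alpha r * expR (b * r))%:E)%E).
  apply: ge0_le_integral => //; first by apply/measurable_EFinP; apply: measurable_radial.
  move=> r /=; rewrite in_itv/= => /andP[mr rm].
  have r0 : 0 < r by exact: le_lt_trans mr.
  rewrite lee_fin /radial_weight mulrAC -expRD [_ + b * r]addrC complete_square// -/m expRD.
  have -> : k = expR (b ^+ 2 / (2 * alpha)) * expR (- (alpha / 2)) * m by rewrite /k; ring.
  apply: ler_pM; [by rewrite mulr_ge0 ?expR_ge0|exact: m0| |exact: ltW].
  rewrite ler_wpM2l ?expR_ge0// ler_expR.
  have : (r - m) ^+ 2 <= 1 by rewrite expr_le1//; lra.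
  have : 0 <= alpha / 2 by rewrite divr_ge0// ltW.
  nra.
apply: ge0_subset_integral => //; first by apply/measurable_EFinP; apply: measurable_radial.
  move=> r /=; rewrite in_itv/= andbT => r0.
  by rewrite lee_fin mulr_ge0 ?expR_ge0// mulr_ge0 ?expR_ge0// ltW.
move=> r /=; rewrite !in_itv/= andbT => /andP[mr _]; exact: le_lt_trans mr.
Qed.

End gaussian.

(** * Moments and necessity *)

Section monotone.
Context d (T : measurableType d) (R : realType).
Variable m : {measure set T -> \bar R}.
Local Open Scope ereal_scope.

(* Stated without measurability because Minfty is not known to be measurable. *)
Lemma ge0_le_integral_nonmeas (D : set T) (f g : T -> \bar R) :
  (forall x, D x -> 0 <= f x) -> (forall x, D x -> f x <= g x) ->
  \int[m]_(x in D) f x <= \int[m]_(x in D) g x.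
Proof.
move=> f0 fg; rewrite integral_mkcond [leRHS]integral_mkcond.
have g0 x : D x -> 0 <= g x by move=> Dx; rewrite (le_trans (f0 _ Dx)) ?fg.
rewrite !ge0_integralTE; [|exact: erestrict_ge0|exact: erestrict_ge0].
apply: ge_ereal_sup => _ [h hf <-]; apply: ereal_sup_ubound; exists h => // x.
by apply: (le_trans (hf x)); exact: lee_restrict.
Qed.

End monotone.

Section moments.
Context {R : realType}.
Variable mu : {measure set (measurableTypeR R) -> \bar R}.
Local Notation leb := (@lebesgue_measure R).
Local Notation normc := (@Normc.normc R).
Local Notation halfline := (`]0%R, +oo[%classic : set R).

Lemma measurable_inv_halfline : measurable_fun halfline (fun t : R => t^-1).
Proof.
apply: open_continuous_measurable_fun; first exact: interval_open.
move=> t; rewrite inE/= in_itv/= andbT => t0.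
by apply: cvgV; [rewrite gt_eqF|exact: cvg_id].
Qed.

Lemma measurable_invX n : measurable_fun halfline (fun t : R => (t ^+ n)^-1).
Proof.
rewrite (_ : (fun t : R => _) = (fun t : R => t^-1 ^+ n)); last first.
  by apply/funext => t; rewrite exprVn.
by apply: measurable_funX; exact: measurable_inv_halfline.
Qed.

Lemma measurable_exp_kernel (x : R) : measurable_fun halfline (fun t : R => expR (x / t) / t).
Proof.
apply: measurable_funM; last exact: measurable_inv_halfline.
apply: measurableT_comp => //; apply: measurable_funM => //.
exact: measurable_inv_halfline.
Qed.

(** The Hausdorff operator applied to the exponential function, at the real point [x]. Both
    implications are reduced to this function. *)
Definition exp_transform (x : R) : \bar R :=
  (\int[mu]_(t in halfline) (expR (x / t) / t)%:E)%E.

Lemma halflineP t : halfline t -> 0 < t.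
Proof. by rewrite /= in_itv/= andbT. Qed.

Lemma exp_kernel_series (c x t : R) : 0 <= c -> 0 <= x -> 0 < t ->
  ((c * (expR (x / t) / t))%:E = \sum_(n <oo) (c * (x ^+ n / n`!%:R) * (t ^+ n.+1)^-1)%:E)%E.
Proof.
move=> c0 x0 t0.
have -> : c * (expR (x / t) / t) = c / t * expR (x / t) by ring.
rewrite EFin_expRM ?divr_ge0 ?(ltW t0)//; apply: eq_eseriesr => n _; congr EFin.
have : n`!%:R != 0 :> R by rewrite pnatr_eq0 -lt0n fact_gt0.
move=> nf; rewrite expr_div_n exprS; field.
by rewrite nf expf_neq0 gt_eqF.
Qed.

(** The power series of exp (phi x / t) / t has terms of the form u_n(x) v_n(t), so the interchange
    holds for arbitrary [m] and [mu]. *)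
Lemma exp_transform_swap d (T : measurableType d) (m : {measure set T -> \bar R})
    (D : set T) (h phi : T -> R) : measurable D ->
  measurable_fun D h -> measurable_fun D phi ->
  (forall x, D x -> 0 <= h x) -> (forall x, D x -> 0 <= phi x) ->
  (\int[m]_(x in D) ((h x)%:E * exp_transform (phi x)) =
   \int[mu]_(t in halfline) \int[m]_(x in D) (h x * (expR (phi x / t) / t))%:E)%E.
Proof.
move=> mD mh mphi h0 phi0.
pose u n x := h x * (phi x ^+ n / n`!%:R); pose v n (t : R) := (t ^+ n.+1)^-1.
transitivity (\int[m]_(x in D) \int[mu]_(t in halfline) \sum_(n <oo) (u n x * v n t)%:E)%E.
  apply: eq_integral => x; rewrite inE => Dx.
  rewrite -ge0_integralZl_EFin//; last 3 first.
  - by move=> t /halflineP t0; rewrite lee_fin divr_ge0 ?expR_ge0 ?ltW.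
  - by apply/measurable_EFinP; exact: measurable_exp_kernel.
  - exact: h0.
  apply: eq_integral => t; rewrite inE => /halflineP t0.
  by rewrite -EFinM exp_kernel_series// ?h0 ?phi0.
rewrite series_kernel_swap//.
- apply: eq_integral => t; rewrite inE => /halflineP t0.
  apply: eq_integral => x; rewrite inE => Dx.
  by rewrite exp_kernel_series// ?h0 ?phi0.
- move=> n; apply: measurable_funM => //; apply: measurable_funM => //.
  exact: measurable_funX.
- by move=> n; exact: measurable_invX.
- move=> n x Dx; rewrite mulr_ge0 ?h0// divr_ge0// exprn_ge0// phi0//.
- by move=> n t /halflineP t0; rewrite invr_ge0 exprn_ge0// ltW.
Qed.

Lemma exp_transform_ge0 x : (0 <= exp_transform x)%E.
Proof.
apply: integral_ge0 => t /halflineP t0.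
by rewrite lee_fin divr_ge0 ?expR_ge0 ?ltW.
Qed.

Lemma moment_ge0 n : (0 <= moment mu n)%E.
Proof.
apply: integral_ge0 => t /halflineP t0.
by rewrite lee_fin invr_ge0 exprn_ge0// ltW.
Qed.

Lemma radial_weight_ge0 (alpha r : R) : 0 < r -> 0 <= radial_weight alpha r.
Proof. by move=> r0; rewrite mulr_ge0 ?expR_ge0// ltW. Qed.

(* t^-(n+2) = t^-2 t^-n, and 1/t <= exp ((t^-2 - 1) / 2) since
   2/t <= 1 + t^-2. *)
Lemma moment_le_exp (rho C : R) n :
  (\int[mu]_(t in halfline) (rho * (expR (n%:R / 2 / t ^+ 2) / t ^+ 2))%:E <= (C * expR (n%:R / 2))%:E)%E ->
  0 < rho -> (moment mu n.+1 <= (C / rho)%:E)%E.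
Proof.
move=> H rho0.
have mk (c : R) : measurable_fun halfline (fun t : R => c * (expR (n%:R / 2 / t ^+ 2) / t ^+ 2)).
  apply: measurable_funM => //; apply: measurable_funM; last exact: measurable_invX.
  apply: measurableT_comp => //; apply: measurable_funM => //; exact: measurable_invX.
have k0 (c : R) t : 0 <= c -> halfline t -> (0 <= (c * (expR (n%:R / 2 / t ^+ 2) / t ^+ 2))%:E)%E.
  by move=> c0 /halflineP t0; rewrite lee_fin mulr_ge0// divr_ge0 ?expR_ge0// exprn_ge0// ltW.
pose c := expR (- (n%:R / 2)) / rho.
have c0 : 0 <= c by rewrite divr_ge0 ?expR_ge0 ?ltW.
have -> : C / rho = c * (C * expR (n%:R / 2)).
  rewrite /c expRN; field; by rewrite gt_eqF// gt_eqF// expR_gt0.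
rewrite EFinM; apply: le_trans (lee_wpmul2l _ H); last by rewrite lee_fin.
rewrite -ge0_integralZl_EFin//; last 2 first.
- by move=> t; apply: k0; exact: ltW.
- by apply/measurable_EFinP; exact: mk.
apply: ge0_le_integral => //.
- by move=> t /halflineP t0; rewrite lee_fin invr_ge0 exprn_ge0// ltW.
- by apply/measurable_EFinP; exact: measurable_invX.
- by apply/measurable_funeM/measurable_EFinP; exact: mk.
move=> t /halflineP t0; rewrite -EFinM lee_fin.
have -> : c * (rho * (expR (n%:R / 2 / t ^+ 2) / t ^+ 2)) =
    expR (n%:R / 2 / t ^+ 2 - n%:R / 2) / t ^+ 2.
  by rewrite /c expRD; field; rewrite !gt_eqF.
have -> : t ^+ n.+2 = t ^+ n * t ^+ 2 by rewrite -exprD addn2.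
rewrite invfM ler_wpM2r ?invr_ge0 ?exprn_ge0 ?(ltW t0)// -exprVn.
have -> : n%:R / 2 / t ^+ 2 - n%:R / 2 = (t^-1 ^+ 2 - 1) / 2 * n%:R.
  by rewrite exprVn; field; rewrite gt_eqF.
rewrite expRM_natr lerXn2r ?nnegrE ?invr_ge0 ?(ltW t0) ?expR_ge0//.
apply: le_trans (expR_ge1Dx _).
have := sqr_ge0 (t^-1 - 1); lra.
Qed.

End moments.

(** * Exponential test functions and necessity *)

Section necessity.
Context {R : realType}.
Variable mu : {measure set (measurableTypeR R) -> \bar R}.
Local Notation leb := (@lebesgue_measure R).
Local Notation normc := (@Normc.normc R).
Local Notation halfline := (`]0%R, +oo[%classic : set R).

Lemma entireP (f : R[i] -> R[i]) : entire f <-> holomorphic f.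
Proof. by split=> hf z; apply/derivable_cderiv; exact: hf. Qed.

(** Completing the square in x turns the weighted modulus into exp (alpha rho^2 / 2) times a product
    of two Gaussians centred at rho and 0, so the area integral factors. *)
Lemma fock1_norm_cexp (alpha : R) : 0 < alpha -> exists2 B : R, 0 < B & forall rho,
  fock1_norm alpha (fun w => cexp ((alpha * rho)%:C * w + 0)) =
  (B * expR (alpha * rho ^+ 2 / 2))%:E.
Proof.
move=> a0; have a2 : 0 < alpha / 2 by rewrite divr_gt0.
have [A A0 HA] := gaussian_integral a2.
exists (alpha / (2 * pi) * (A * A)).
  by apply: mulr_gt0; [rewrite divr_gt0// mulr_gt0// pi_gt0|exact: mulr_gt0].
move=> rho; set f := fun w => _.
have hf : holomorphic f by exact: holomorphic_cexp.
rewrite /fock1_norm -[in RHS]mulrA [RHS]EFinM; congr (_ * _)%E.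
pose E := expR (alpha * rho ^+ 2 / 2).
have pw (x y : R) : normc (f (x +i* y)) * expR (- (alpha / 2) * normc (x +i* y) ^+ 2) =
    E * expR (- (alpha / 2) * (x - rho) ^+ 2) * expR (- (alpha / 2) * (y - 0) ^+ 2).
  rewrite normc_cexp -!expRD; congr expR; by rewrite sqr_normcE /=; field.
have mf := measurable_weight (- (alpha / 2)) hf.
have mF := mf; move/measurable_EFinP in mF.
have F0 p : (0 <= (EFin \o (fun p : R * R => normc (f (p.1 +i* p.2)) *
    expR (- (alpha / 2) * normc (p.1 +i* p.2) ^+ 2))%R) p)%E.
  by rewrite lee_fin mulr_ge0 ?normc_ge0 ?expR_ge0.
apply: (etrans (fubini_tonelli1 (m1 := leb) (m2 := leb) _ mF F0)).
have mg (m c : R) : measurable_fun [set: R] (fun x : R => c * expR (- (alpha / 2) * (x - m) ^+ 2)).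
  apply: measurable_funM => //; apply: measurableT_comp => //; apply: measurable_funM => //.
  by apply: measurable_funX; exact: measurable_funB.
have Ig (m c : R) : 0 <= c ->
    (\int[leb]_x (c * expR (- (alpha / 2) * (x - m) ^+ 2))%:E = (c * A)%:E)%E.
  move=> c0; under eq_integral do rewrite EFinM.
  rewrite ge0_integralZl_EFin//; first by rewrite HA EFinM.
  apply/measurable_EFinP; have := mg m 1; congr measurable_fun.
  by apply/funext => x; rewrite mul1r.
rewrite /fubini_F.
transitivity (\int[leb]_x (E * A * expR (- (alpha / 2) * (x - rho) ^+ 2))%:E)%E; last first.
  by rewrite Ig ?mulr_ge0 ?expR_ge0// 1?ltW// -mulrA mulrC.
apply: eq_integral => x _.
transitivity (\int[leb]_y (E * expR (- (alpha / 2) * (x - rho) ^+ 2) *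
    expR (- (alpha / 2) * (y - 0) ^+ 2))%:E)%E.
  by apply: eq_integral => y _; exact: (congr1 EFin (pw x y)).
by rewrite Ig ?mulr_ge0 ?expR_ge0// mulrAC.
Qed.

Lemma hausdorff_integrand_cexp (k r t : R) :
  hausdorff_integrand (fun w => cexp (k%:C * w + 0)) r%:C t = (expR (k * r / t) / t)%:C.
Proof.
by rewrite /hausdorff_integrand -!fmorph_div addr0 -rmorphM cexp_real -fmorph_div mulrA.
Qed.

(** The identity feeds the lower bound of the mixed norm; finiteness is used at [r = 0]. *)
Lemma Re_hausdorff_cexp (k r : R) :
  hausdorff_defined mu (fun w => cexp (k%:C * w + 0)) ->
  ((complex.Re (hausdorff mu (fun w => cexp (k%:C * w + 0)%R) r%:C))%:E =
   exp_transform mu (k * r))%E /\ (exp_transform mu (k * r) < +oo)%E.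
Proof.
pose f w : R[i] := cexp (k%:C * w + 0).
rewrite -/f => /(_ r%:C)[iH _].
have fi : (\int[mu]_(t in halfline) (complex.Re (hausdorff_integrand f r%:C t))%:E)%E \is a fin_num.
  exact: integrable_fin_num.
have E : (\int[mu]_(t in halfline) (complex.Re (hausdorff_integrand f r%:C t))%:E)%E =
   exp_transform mu (k * r).
  by apply: eq_integral => t _; rewrite hausdorff_integrand_cexp.
split; last by rewrite -E ltey_eq fi.
by rewrite /hausdorff /cintegral /= /Rintegral fineK.
Qed.

Lemma Minfty_ge (f : R[i] -> R[i]) (r : R) : 0 <= r -> ((complex.Re (f r%:C))%:E <= Minfty f r)%E.
Proof.
move=> r0; apply: (@le_trans _ _ (normc (f r%:C))%:E).
  by rewrite lee_fin (le_trans (ler_norm _))// normc_Re.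
by apply: ereal_sup_ubound; exists r%:C => //=; rewrite expr0n addr0 sqrtr_sqr ger0_norm.
Qed.

(** On each circle the maximum modulus is at least the value at the positive point r. After the
    interchange the lower radial bound with b = alpha rho / t yields rho / t, and the kernel
    contributes another 1 / t, whence t^-2. *)
Lemma mixed_norm_cexp_ge (alpha rho : R) : 0 < alpha -> 0 <= rho ->
  hausdorff_defined mu (fun w => cexp ((alpha * rho)%:C * w + 0)) ->
  ((alpha * expR (- (alpha / 2)))%:E *
   \int[mu]_(t in halfline) (rho * (expR (alpha * rho ^+ 2 / 2 / t ^+ 2) / t ^+ 2))%:E <=
   mixed_fock_norm alpha (hausdorff mu (fun w => cexp ((alpha * rho)%:C * w + 0)%R)))%E.
Proof.
move=> a0 rho0 hdef; set k := alpha * rho.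
have k0 : 0 <= k by rewrite mulr_ge0// ltW.
have mrad : measurable_fun halfline (radial_weight alpha).
  have := @measurable_radial R alpha 0 halfline; congr measurable_fun.
  by apply/funext => r; rewrite mul0r expR0 mulr1.
rewrite /mixed_fock_norm EFinM -muleA lee_pmul2l//.
apply: (@le_trans _ _ (\int[leb]_(r in halfline) ((radial_weight alpha r)%:E * exp_transform mu (k * r)))%E);
  last first.
  apply: ge0_le_integral_nonmeas => r /halflineP r0.
    by rewrite mule_ge0 ?exp_transform_ge0// lee_fin radial_weight_ge0.
  rewrite muleC lee_wpmul2r ?lee_fin ?radial_weight_ge0//.
  have [<- _] := Re_hausdorff_cexp r hdef.
  by apply: Minfty_ge; exact: ltW.
rewrite exp_transform_swap//; last 2 first.
- by move=> r /halflineP; exact: radial_weight_ge0.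
- by move=> r /halflineP r0; rewrite mulr_ge0// ltW.
rewrite -ge0_integralZl_EFin ?expR_ge0//; last 2 first.
- by move=> t /halflineP t0; rewrite lee_fin mulr_ge0// divr_ge0 ?expR_ge0// exprn_ge0// ltW.
- apply/measurable_EFinP; apply: measurable_funM => //; apply: measurable_funM; last exact: measurable_invX.
  apply: measurableT_comp => //; apply: measurable_funM => //; exact: measurable_invX.
apply: ge0_le_integral_nonmeas => t /halflineP t0.
  by rewrite -EFinM lee_fin !mulr_ge0 ?invr_ge0 ?expR_ge0// exprn_ge0// ltW.
have -> : (\int[leb]_(r in halfline) (radial_weight alpha r * (expR (k * r / t) / t))%:E =
    t^-1%:E * \int[leb]_(r in halfline) (radial_weight alpha r * expR (k / t * r))%:E)%E.
  rewrite -ge0_integralZl_EFin ?invr_ge0 ?(ltW t0)//; last 2 first.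
  - by move=> r /halflineP r0; rewrite lee_fin mulr_ge0 ?expR_ge0 ?radial_weight_ge0.
  - by apply/measurable_EFinP; exact: measurable_radial.
  by apply: eq_integral => r _; rewrite -EFinM; congr EFin; rewrite [k * r / t]mulrAC; ring.
have kt0 : 0 <= k / t by rewrite divr_ge0// ltW.
apply: le_trans (lee_wpmul2l _ (radial_integral_ge a0 kt0)); last by rewrite lee_fin invr_ge0 ltW.
rewrite -!EFinM lee_fin le_eqVlt; apply/orP; left; apply/eqP.
have -> : (k / t) ^+ 2 / (2 * alpha) = alpha * rho ^+ 2 / 2 / t ^+ 2.
  by rewrite /k; field; rewrite !gt_eqF.
by rewrite /k; field; rewrite !gt_eqF.
Qed.

Lemma bounded_moments (alpha : R) : 0 < alpha ->
  hausdorff_bounded mu (fock1 alpha) (fock1_norm alpha)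
    (mixed_fock alpha) (mixed_fock_norm alpha) ->
  (ereal_sup (range (fun n : nat => moment mu n * (Num.sqrt (n.+1%:R : R))%:E)) < +oo)%E.
Proof.
move=> a0 [hX [C [C0 hC]]].
have [B B0 HB] := fock1_norm_cexp a0.
pose f rho := fun w => cexp ((alpha * rho)%:C * w + 0).
have fX rho : fock1 alpha (f rho).
  split; first by apply/entireP; exact: holomorphic_cexp.
  by rewrite HB ltry.
pose C1 := C * B / (alpha * expR (- (alpha / 2))).
have C10 : 0 < C1 by rewrite divr_gt0 ?mulr_gt0 ?expR_gt0.
have key rho : 0 <= rho ->
    (\int[mu]_(t in halfline) (rho * (expR (alpha * rho ^+ 2 / 2 / t ^+ 2) / t ^+ 2))%:E
     <= (C1 * expR (alpha * rho ^+ 2 / 2))%:E)%E.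
  move=> rho0; have c0 : 0 < alpha * expR (- (alpha / 2)) by rewrite mulr_gt0 ?expR_gt0.
  rewrite -(@lee_pmul2l _ (alpha * expR (- (alpha / 2)))%:E)//.
  apply: le_trans (mixed_norm_cexp_ge a0 rho0 (hX _ (fX rho)).1) _.
  apply: le_trans (hC _ (fX rho)) _.
  rewrite HB -!EFinM lee_fin le_eqVlt; apply/orP; left; apply/eqP.
  by rewrite /C1; field; rewrite !gt_eqF// expR_gt0.
(* This makes s = (n + 1) / 2. The shift by 1 keeps [rho n] positive, so the test covers the moments
   of index at least 2; the indices 0 and 1 are treated apart. *)
pose rho n : R := Num.sqrt (n.+1%:R / alpha).
have rho0 n : 0 < rho n by rewrite sqrtr_gt0 divr_gt0.
have rho2 n : alpha * rho n ^+ 2 / 2 = n.+1%:R / 2.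
  by rewrite sqr_sqrtr ?divr_ge0 ?ltW//; field; rewrite gt_eqF.
have M2 n : (moment mu n.+2 <= (C1 / rho n)%:E)%E.
  apply: moment_le_exp => //.
  by have := key _ (ltW (rho0 n)); rewrite rho2.
(* At z = 0 the Hausdorff integrand of an exponential is 1 / t, so well-definedness alone makes mu_0
   finite. *)
have M0 : (moment mu 0 < +oo)%E.
  have [_] := Re_hausdorff_cexp 0 (hX _ (fX 1)).1.
  rewrite mulr0 /exp_transform; congr (_ < _)%E; apply: eq_integral => t _.
  by rewrite mul0r expR0 mul1r expr1.
(* The test with rho = 1, after dropping the exponential factor, which is at least 1. *)
have M1 : (moment mu 1 < +oo)%E.
  apply: le_lt_trans (ltry (C1 * expR (alpha * 1 ^+ 2 / 2))).
  apply: le_trans (key 1 ler01).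
  apply: ge0_le_integral_nonmeas => t /halflineP t0.
    by rewrite lee_fin invr_ge0 exprn_ge0// ltW.
  rewrite lee_fin mul1r ler_peMl ?invr_ge0 ?exprn_ge0 ?(ltW t0)//.
  rewrite -[leLHS]expR0 ler_expR expr1n mulr1.
  by rewrite !divr_ge0 ?exprn_ge0 ?ltW.
pose m n : R := fine (moment mu n).
have mE n : (moment mu n < +oo)%E -> moment mu n = (m n)%:E.
  by move=> H; rewrite /m fineK// ge0_fin_numE// moment_ge0.
have m0 n : 0 <= m n by rewrite fine_ge0// moment_ge0.
(* One summand for each of the cases 0, 1 and n + 2; in the last one, n + 3 <= 3 (n + 1) explains
   [3 * alpha]. *)
pose M := m 0%N + m 1%N * Num.sqrt 2 + C1 * Num.sqrt (3 * alpha).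
have [t1 t2 t3] : [/\ 0 <= m 0%N, 0 <= m 1%N * Num.sqrt 2 & 0 <= C1 * Num.sqrt (3 * alpha)].
  by split; [exact: m0|rewrite mulr_ge0 ?m0 ?sqrtr_ge0|rewrite mulr_ge0 ?sqrtr_ge0// ltW].
apply: (@le_lt_trans _ _ M%:E); last exact: ltry.
apply: ge_ereal_sup => _ [[|[|n]] _ <-].
- by rewrite (mE _ M0) -EFinM lee_fin sqrtr1 mulr1 /M; lra.
- by rewrite (mE _ M1) -EFinM lee_fin /M; lra.
apply: (@le_trans _ _ ((C1 / rho n) * Num.sqrt n.+3%:R)%:E).
  by rewrite EFinM lee_wpmul2r// lee_fin sqrtr_ge0.
rewrite lee_fin; suff : C1 / rho n * Num.sqrt n.+3%:R <= C1 * Num.sqrt (3 * alpha) by rewrite /M; lra.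
rewrite -mulrA ler_pM2l// ler_pdivrMl// /rho -sqrtrM; last by rewrite divr_ge0// ltW.
have -> : n.+1%:R / alpha * (3 * alpha) = 3 * n.+1%:R by field; rewrite gt_eqF.
by rewrite ler_sqrt ?mulr_ge0// -natrM ler_nat; lia.
Qed.

End necessity.

(** * Sufficiency *)

Section moment_bounds.
Context {R : realType}.
Variable mu : {measure set (measurableTypeR R) -> \bar R}.
Local Notation leb := (@lebesgue_measure R).
Local Notation halfline := (`]0%R, +oo[%classic : set R).

Lemma moments_le :
  (ereal_sup (range (fun n : nat => moment mu n * (Num.sqrt (n.+1%:R : R))%:E)) < +oo)%E ->
  exists2 B : R, 0 < B & forall n, (moment mu n <= (B / Num.sqrt n.+1%:R)%:E)%E.
Proof.
set S := ereal_sup _ => Soo.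
have ub n : (moment mu n * (Num.sqrt (n.+1%:R : R))%:E <= S)%E.
  by apply: ereal_sup_ubound; exists n.
have S0 : (0 <= S)%E.
  by apply: le_trans (ub 0%N); rewrite mule_ge0 ?moment_ge0// lee_fin sqrtr_ge0.
have SE : S = (fine S)%:E by rewrite fineK// ge0_fin_numE.
have f0 : 0 <= fine S by rewrite fine_ge0.
exists (fine S + 1); first by rewrite ltr_wpDl.
move=> n; have n0 : 0 < Num.sqrt n.+1%:R :> R by rewrite sqrtr_gt0.
rewrite EFinM lee_pdivlMr//; apply: (le_trans (ub n)).
by rewrite SE lee_fin lerDl.
Qed.

Variables (B : R) (B0 : 0 < B).
Hypothesis HB : forall n, (moment mu n <= (B / Num.sqrt n.+1%:R)%:E)%E.

Lemma sqrtS_ge1 n : 1 <= Num.sqrt n.+1%:R :> R.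
Proof. by rewrite -[leLHS]sqrtr1 ler_sqrt// ler1n. Qed.

Lemma moment_leB n : (moment mu n <= B%:E)%E.
Proof.
apply: le_trans (HB n) _; rewrite lee_fin ler_pdivrMr ?(lt_le_trans _ (sqrtS_ge1 n))//.
by rewrite ler_peMr ?sqrtS_ge1// ltW.
Qed.

Lemma moment_fin n : moment mu n \is a fin_num.
Proof. by rewrite ge0_fin_numE ?moment_ge0// (le_lt_trans (moment_leB n))// ltry. Qed.

(** Chebyshev's inequality: t^-(n+1) >= q^-(n+1) on ]0, q], so the mass there is at most B q^(n+1)
    for every n. *)
Lemma null_initial (q : R) : 0 < q -> q < 1 -> mu `]0%R, q]%classic = 0%E.
Proof.
move=> q0 q1; apply/eqP; rewrite eq_le measure_ge0 andbT; apply/lee_addgt0Pr => e e0.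
rewrite add0e.
have [n Hn] : exists n, B * q ^+ n.+1 <= e.
  have : (B * q ^+ k) @[k --> \oo] --> (0 : R).
    rewrite -(mulr0 B); apply: cvgMr; apply: cvg_expr.
    by rewrite ger0_norm ?ltW.
  move=> /cvgrPdist_le /(_ _ e0)[N _ /(_ N.+1 (leqnSn N))] /=.
  rewrite sub0r normrN ger0_norm; last by rewrite mulr_ge0 ?exprn_ge0 ?ltW.
  by exists N.
apply: (@le_trans _ _ (B * q ^+ n.+1)%:E); last by rewrite lee_fin.
rewrite mulrC EFinM -(@lee_pdivrMl _ (q ^+ n.+1)) ?exprn_gt0//.
apply: le_trans (moment_leB n).
have sub : `]0%R, q]%classic `<=` halfline.
  by move=> t /=; rewrite !in_itv/= andbT => /andP[].
apply: (@le_trans _ _ (\int[mu]_(t in `]0%R, q]) ((t ^+ n.+1)^-1)%:E)%E); last first.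
  apply: ge0_subset_integral => //.
  - by apply/measurable_EFinP; exact: measurable_invX.
  - by move=> t /halflineP t0; rewrite lee_fin invr_ge0 exprn_ge0// ltW.
rewrite -integral_cst//; apply: ge0_le_integral => //.
- by move=> t _; rewrite lee_fin invr_ge0 exprn_ge0// ltW.
- apply: measurable_funS sub _ => //.
  by apply/measurable_EFinP; exact: measurable_invX.
move=> t /=; rewrite in_itv/= => /andP[t0 tq].
by rewrite lee_fin lef_pV2 ?posrE ?exprn_gt0// lerXn2r ?nnegrE ?(ltW t0) ?(ltW q0).
Qed.

Lemma null_unit : mu `]0%R, 1%R[%classic = 0%E.
Proof.
apply/negligibleP; first exact: measurable_itv.
(* The index [k.+2] keeps the right endpoints strictly between 0 and 1. *)
have E : `]0%R, 1%R[%classic `<=` \bigcup_k `]0%R, (1 - k.+2%:R^-1 : R)]%classic.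
  move=> t /=; rewrite in_itv/= => /andP[t0 t1].
  have [k Hk] : exists k : nat, (1 - t)^-1 <= k.+2%:R.
    by exists (Num.truncn (1 - t)^-1); rewrite ltW// (lt_le_trans (truncnS_gt _))// ler_nat.
  exists k => //=; rewrite in_itv/= t0/=.
  by rewrite lerBrDr addrC -lerBrDr -[leRHS]invrK lef_pV2 ?posrE// invr_gt0 subr_gt0.
apply: (@negligibleS _ (measurableTypeR R) R mu _ _ E); apply: negligible_bigcup => k.
apply/negligibleP; first exact: measurable_itv.
apply: null_initial; first by rewrite subr_gt0 invf_lt1// ltr1n.
by rewrite gtrBl invr_gt0.
Qed.

Lemma ae_ge1 (P : R -> Prop) : (forall t, 1 <= t -> P t) ->
  {ae mu, forall t, halfline t -> P t}.
Proof.
move=> HP; exists `]0%R, 1%R[%classic; split; [exact: measurable_itv|exact: null_unit|].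
move=> t /=; rewrite in_itv/= => H; apply/negPn/negP => Ht; apply: H => /halflineP t0.
by apply: HP; rewrite leNgt; apply/negP => t1; case/negP: Ht; apply/andP; split.
Qed.

(** Since mu_0 is finite, M / t is an integrable majorant; domination on t >= 1 is enough because
    ]0, 1[ is null. *)
Lemma integrable_of_le (phi : R -> R) (M : R) : 0 <= M -> measurable_fun halfline phi ->
  (forall t, 1 <= t -> `|phi t| <= M / t) ->
  mu.-integrable halfline (EFin \o phi) /\
  `|\int[mu]_(t in halfline) phi t| <= M * fine (moment mu 0).
Proof.
move=> M0 mphi HM.
have mE : measurable_fun halfline (EFin \o phi) by exact/measurable_EFinP.
have le : (\int[mu]_(t in halfline) `|(phi t)%:E| <= (M * fine (moment mu 0))%:E)%E.
  apply: (@le_trans _ _ (\int[mu]_(t in halfline) (M / t)%:E)%E).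
    apply: ae_ge0_le_integral => //.
    - exact: measurableT_comp.
    - by move=> t /halflineP t0; rewrite lee_fin divr_ge0// ltW.
    - by apply/measurable_EFinP; apply: measurable_funM => //; exact: measurable_inv_halfline.
    - by apply: ae_ge1 => t t1; rewrite lee_fin HM.
  under eq_integral do rewrite EFinM.
  rewrite ge0_integralZl_EFin//; last 2 first.
  - by move=> t /halflineP t0; rewrite lee_fin invr_ge0 ltW.
  - by apply/measurable_EFinP; exact: measurable_inv_halfline.
  rewrite EFinM lee_wpmul2l// fineK ?moment_fin//.
have iphi : mu.-integrable halfline (EFin \o phi).
  by apply/integrableP; split => //; apply: le_lt_trans le _; exact: ltry.
split => //; rewrite -lee_fin EFin_normr_Rintegral//.
by apply: le_trans le; exact: le_abse_integral.
Qed.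

(** With j = 0 and j = 1 this separates the even from the odd moments. *)
Lemma integral_exp_moments (s : R) j : 0 <= s ->
  (\int[mu]_(t in halfline) (expR (s / t ^+ 2) / t ^+ j.+1)%:E =
   \sum_(k <oo) (s ^+ k / k`!%:R)%:E * moment mu (k.*2 + j))%E.
Proof.
move=> s0.
have H t : 0 < t -> ((expR (s / t ^+ 2) / t ^+ j.+1)%:E =
    \sum_(k <oo) (s ^+ k / k`!%:R * (t ^+ (k.*2 + j).+1)^-1)%:E)%E.
  move=> t0; rewrite mulrC EFin_expRM; last 2 first.
  - by rewrite divr_ge0// exprn_ge0// ltW.
  - by rewrite invr_ge0 exprn_ge0// ltW.
  apply: eq_eseriesr => k _; congr EFin.
  rewrite -addnS exprD -muln2 mulnC exprM expr_div_n.
  have kf : k`!%:R != 0 :> R by rewrite pnatr_eq0 -lt0n fact_gt0.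
  by field; rewrite kf !expf_neq0// gt_eqF.
transitivity (\int[mu]_(t in halfline)
    \sum_(k <oo) (s ^+ k / k`!%:R * (t ^+ (k.*2 + j).+1)^-1)%:E)%E.
  by apply: eq_integral => t; rewrite inE => /halflineP; exact: H.
have c0 k : 0 <= s ^+ k / k`!%:R by rewrite divr_ge0// exprn_ge0.
rewrite integral_nneseries//; last 2 first.
- by move=> k; apply/measurable_EFinP; apply: measurable_funM => //; exact: measurable_invX.
- by move=> k t /halflineP t0; rewrite lee_fin mulr_ge0// invr_ge0 exprn_ge0// ltW.
apply: eq_eseriesr => k _; under eq_integral do rewrite EFinM.
rewrite ge0_integralZl_EFin//.
- by move=> t /halflineP t0; rewrite lee_fin invr_ge0 exprn_ge0// ltW.
- by apply/measurable_EFinP; exact: measurable_invX.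
Qed.

Lemma exp_series_shift_le (s : R) : 0 <= s ->
  (\sum_(k <oo) (s ^+ k.+1 / k.+1`!%:R)%:E <= (expR s)%:E)%E.
Proof.
move=> s0; pose f k : \bar R := (s ^+ k / k`!%:R)%:E.
have f0 k : (0 <= f k)%E by rewrite lee_fin divr_ge0// exprn_ge0.
rewrite EFin_expR// [leRHS](@nneseries_split _ _ 0 1)//=; last by move=> k _; exact: f0.
rewrite -(nneseries_addn 1) => [|k]; last exact: f0.
have -> : (\sum_(k <oo) (s ^+ k.+1 / k.+1`!%:R)%:E = \sum_(k <oo) f (k + 1)%N)%E.
  by apply: eq_eseriesr => k _; rewrite addn1.
rewrite leeDr//; apply: sume_ge0 => k _; exact: f0.
Qed.

(* AM-GM with the weight 1 / sqrt (2 k + 2) of the odd moments keeps the linear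
   factor alpha rho under control. *)
Lemma exp_moments_le (alpha rho : R) : 0 < alpha -> 0 <= rho ->
  (\int[mu]_(t in halfline) ((1 + alpha * rho / t) * (expR (alpha * rho ^+ 2 / 2 / t ^+ 2) / t))%:E <=
   (B * (2 + alpha) * expR (alpha * rho ^+ 2 / 2))%:E)%E.
Proof.
move=> a0 rho0; pose s := alpha * rho ^+ 2 / 2.
have s0 : 0 <= s by rewrite divr_ge0// mulr_ge0 ?sqr_ge0// ltW.
have ar0 : 0 <= alpha * rho by rewrite mulr_ge0// ltW.
have mk j : measurable_fun halfline (fun t : R => expR (s / t ^+ 2) / t ^+ j).
  apply: measurable_funM; last exact: measurable_invX.
  apply: measurableT_comp => //; apply: measurable_funM => //; exact: measurable_invX.
have k0 j t : halfline t -> 0 <= expR (s / t ^+ 2) / t ^+ j.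
  by move=> /halflineP t0; rewrite divr_ge0 ?expR_ge0// exprn_ge0// ltW.
have c0 k : 0 <= s ^+ k / k`!%:R by rewrite divr_ge0// exprn_ge0.
have E : (\int[mu]_(t in halfline) ((1 + alpha * rho / t) * (expR (s / t ^+ 2) / t))%:E =
  \sum_(k <oo) (s ^+ k / k`!%:R)%:E * moment mu (k.*2 + 0) +
  (alpha * rho)%:E * \sum_(k <oo) (s ^+ k / k`!%:R)%:E * moment mu (k.*2 + 1))%E.
  rewrite -!integral_exp_moments// -ge0_integralZl_EFin//; last 2 first.
  - by move=> t Dt; rewrite lee_fin k0.
  - by apply/measurable_EFinP; exact: mk.
  rewrite -ge0_integralD//; last 4 first.
  - by move=> t Dt; rewrite lee_fin k0.
  - by apply/measurable_EFinP; exact: mk.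
  - by move=> t Dt; rewrite -EFinM lee_fin mulr_ge0// k0.
  - by apply/measurable_funeM/measurable_EFinP; exact: mk.
  apply: eq_integral => t; rewrite inE => /halflineP t0.
  rewrite -EFinM -EFinD; congr EFin; rewrite expr1 [t ^+ 2 in X in _ = _ + X]expr2 invfM.
  by ring.
rewrite -/s E -nneseriesZl; last first.
  by move=> k _; rewrite mule_ge0// ?moment_ge0// lee_fin.
(* The even moments use [B], the odd ones [B * alpha / 2] and [B / 2]; the last summand is slack
   that rounds the constant. *)
have -> : (B * (2 + alpha) * expR s)%:E = (B%:E * (expR s)%:E +
   ((B * alpha / 2)%:E * (expR s)%:E + (B / 2)%:E * (expR s)%:E) + (B / 2 * (1 + alpha) * expR s)%:E)%E.
  by rewrite -!EFinM -!EFinD; congr EFin; field.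
apply: (@le_trans _ _ (B%:E * (expR s)%:E +
   ((B * alpha / 2)%:E * (expR s)%:E + (B / 2)%:E * (expR s)%:E))%E); last first.
  by rewrite leeDl// lee_fin !mulr_ge0 ?expR_ge0// ?addr_ge0// ltW// divr_gt0.
apply: leeD.
  rewrite EFin_expR// -nneseriesZl; last by move=> k _; rewrite lee_fin.
  apply: lee_nneseries => k _; first by rewrite mule_ge0// ?moment_ge0// lee_fin.
  by rewrite muleC lee_wpmul2r ?lee_fin// moment_leB.
apply: (@le_trans _ _ (\sum_(k <oo) ((B * alpha / 2)%:E * (s ^+ k.+1 / k.+1`!%:R)%:E +
    (B / 2)%:E * (s ^+ k / k`!%:R)%:E))%E).
  apply: lee_nneseries => k _.
    by rewrite !mule_ge0// ?moment_ge0// lee_fin.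
  apply: (@le_trans _ _ ((alpha * rho)%:E * ((s ^+ k / k`!%:R)%:E * (B / Num.sqrt (k.*2 + 1).+1%:R)%:E))%E).
    by rewrite lee_wpmul2l ?lee_fin// lee_wpmul2l ?lee_fin.
  rewrite -!EFinM -EFinD lee_fin.
  set w := Num.sqrt _.
  have w2 : w ^+ 2 = 2 * k.+1%:R.
    by rewrite sqr_sqrtr// -natrM; congr (_%:R); rewrite -muln2; lia.
  have w0 : 0 < w by rewrite sqrtr_gt0.
  have k1 : 0 < k.+1%:R :> R by [].
  (* This is x <= (x^2 + 1) / 2 with x = alpha rho / w and x^2 = alpha s / (k + 1). The factor s /
     (k + 1) turns s^k / k! into the next term of the exponential series. *)
  have amgm : alpha * rho / w <= (alpha * s / k.+1%:R + 1) / 2.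
    have -> : alpha * s / k.+1%:R = (alpha * rho / w) ^+ 2.
      by rewrite expr_div_n w2 /s; field; rewrite gt_eqF.
    have := sqr_ge0 (alpha * rho / w - 1); lra.
  have -> : B * alpha / 2 * (s ^+ k.+1 / k.+1`!%:R) + B / 2 * (s ^+ k / k`!%:R) =
      B * (s ^+ k / k`!%:R) * ((alpha * s / k.+1%:R + 1) / 2).
    have kf : k`!%:R != 0 :> R by rewrite pnatr_eq0 -lt0n fact_gt0.
    by rewrite factS natrM exprS; field; rewrite kf gt_eqF.
  have -> : alpha * rho * (s ^+ k / k`!%:R * (B / w)) = B * (s ^+ k / k`!%:R) * (alpha * rho / w) by ring.
  by rewrite ler_wpM2l// mulr_ge0// ltW.
rewrite nneseriesD; last 2 first.
- by move=> k _ _; rewrite -EFinM lee_fin mulr_ge0 ?divr_ge0 ?exprn_ge0 ?mulr_ge0// ltW.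
- by move=> k _ _; rewrite -EFinM lee_fin mulr_ge0// divr_ge0// ltW.
rewrite nneseriesZl; last by move=> k _; rewrite lee_fin divr_ge0 ?exprn_ge0.
rewrite nneseriesZl; last by move=> k _; rewrite lee_fin.
rewrite -EFin_expR// leeD2r//.
by rewrite lee_wpmul2l ?exp_series_shift_le// lee_fin !mulr_ge0 ?invr_ge0// ltW.
Qed.

End moment_bounds.

(** * Absolute convergence and holomorphy of the Hausdorff transform *)

Section sufficiency.
Context {R : realType}.
Variable mu : {measure set (measurableTypeR R) -> \bar R}.
Local Notation leb := (@lebesgue_measure R).
Local Notation normc := (@Normc.normc R).
Local Notation halfline := (`]0%R, +oo[%classic : set R).

Lemma cintegralB (psi phi : R -> R[i]) : cintegrable mu halfline psi ->
  cintegrable mu halfline phi ->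
  cintegrable mu halfline (fun t => psi t - phi t) /\
  cintegral mu halfline (fun t => psi t - phi t) =
  cintegral mu halfline psi - cintegral mu halfline phi.
Proof.
move=> [p1 p2] [q1 q2].
have rE t : complex.Re (psi t - phi t) = complex.Re (psi t) - complex.Re (phi t).
  by case: (psi t) (phi t) => [? ?] [? ?].
have iE t : complex.Im (psi t - phi t) = complex.Im (psi t) - complex.Im (phi t).
  by case: (psi t) (phi t) => [? ?] [? ?].
have mD : measurable (halfline : set (measurableTypeR R)) by exact: measurable_itv.
split.
  split.
    by apply: eq_integrable (integrableB mD p1 q1) => // t _; rewrite rE.
  by apply: eq_integrable (integrableB mD p2 q2) => // t _; rewrite iE.
rewrite /cintegral (eq_Rintegral mu (fun t _ => rE t)) (eq_Rintegral mu (fun t _ => iE t)).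
by rewrite !RintegralB.
Qed.

Lemma cintegralZ (c : R[i]) (psi : R -> R[i]) : cintegrable mu halfline psi ->
  cintegrable mu halfline (fun t => c * psi t) /\
  cintegral mu halfline (fun t => c * psi t) = c * cintegral mu halfline psi.
Proof.
move=> [p1 p2]; case: c => a b.
have rE t : complex.Re ((a +i* b) * psi t) = a * complex.Re (psi t) - b * complex.Im (psi t).
  by case: (psi t) => [? ?].
have iE t : complex.Im ((a +i* b) * psi t) = a * complex.Im (psi t) + b * complex.Re (psi t).
  by case: (psi t) => [? ?].
have mD : measurable (halfline : set (measurableTypeR R)) by exact: measurable_itv.
have Z (k : R) (u : R -> R) : mu.-integrable halfline (EFin \o u) ->
    mu.-integrable halfline (EFin \o (fun t => k * u t)).
  by move=> iu; have := integrableZl mD k iu; apply: eq_integrable.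
split.
  split.
    by apply: eq_integrable (integrableB mD (Z a _ p1) (Z b _ p2)) => // t _; rewrite rE.
  by apply: eq_integrable (integrableD mD (Z a _ p2) (Z b _ p1)) => // t _; rewrite iE.
rewrite /cintegral (eq_Rintegral mu (fun t _ => rE t)) (eq_Rintegral mu (fun t _ => iE t)).
rewrite RintegralB//; [|exact: Z|exact: Z].
rewrite RintegralD//; [|exact: Z|exact: Z].
by rewrite !RintegralZl.
Qed.

Variables (B : R) (B0 : 0 < B).
Hypothesis HB : forall n, (moment mu n <= (B / Num.sqrt n.+1%:R)%:E)%E.

Let mu0 := fine (moment mu 0).

Lemma mu0_ge0 : 0 <= mu0.
Proof. by rewrite fine_ge0// moment_ge0. Qed.

Lemma cintegrable_of_le (psi : R -> R[i]) (M : R) : 0 <= M ->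
  measurable_fun halfline (fun t => complex.Re (psi t)) ->
  measurable_fun halfline (fun t => complex.Im (psi t)) ->
  (forall t, 1 <= t -> normc (psi t) <= M / t) ->
  cintegrable mu halfline psi /\ normc (cintegral mu halfline psi) <= 2 * (M * mu0).
Proof.
move=> M0 mr mi HM.
have [|r1 r2] := integrable_of_le B0 HB M0 mr.
  by move=> t /HM; apply: le_trans; exact: normc_Re.
have [|i1 i2] := integrable_of_le B0 HB M0 mi.
  by move=> t /HM; apply: le_trans; exact: normc_Im.
split => //; rewrite (le_trans (normc_le_ReIm _))//.
by rewrite mulr_natl mulr2n lerD.
Qed.

(** As a function of y = 1 / t, g(z y) is continuous on the whole line; only inversion has to be
    handled on the half line. *)
Lemma measurable_dilation (g : R[i] -> R[i]) (z : R[i]) : (forall w, ccontinuous g w) ->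
  measurable_fun halfline (fun t : R => complex.Re (g (z / t%:C))) /\
  measurable_fun halfline (fun t : R => complex.Im (g (z / t%:C))).
Proof.
move=> cg; pose h w := g (z * w).
have ch w : ccontinuous h w.
  move=> e e0; have [d d0 H] := cg (z * w) _ e0.
  have z1 : 0 < normc z + 1 by rewrite ltr_wpDl ?normc_ge0.
  exists (d / (normc z + 1)); first by rewrite divr_gt0.
  move=> w' hw; apply: H; rewrite -mulrBr Normc.normcM.
  apply: le_lt_trans (_ : (normc z + 1) * normc (w' - w) < d).
    by rewrite ler_wpM2r ?normc_ge0// lerDl.
  by rewrite mulrC -ltr_pdivlMr.
have lp (s t : R) : normc (s%:C - t%:C) <= `|s - t| by exact: horizontal_path.
have E (t : R) : z / t%:C = z * (t^-1)%:C by rewrite fmorphV.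
split.
  have mh : measurable_fun [set: R] (fun y : R => complex.Re (h y%:C)).
    by apply: continuous_measurable_fun => y; have [] := ccontinuous_path lp (ch y%:C).
  rewrite (_ : (fun t : R => complex.Re _) = (fun t : R => complex.Re (h (t^-1)%:C))).
    exact: (measurableT_comp mh measurable_inv_halfline).
  by apply/funext => t; rewrite E.
have mh : measurable_fun [set: R] (fun y : R => complex.Im (h y%:C)).
  by apply: continuous_measurable_fun => y; have [] := ccontinuous_path lp (ch y%:C).
rewrite (_ : (fun t : R => complex.Im _) = (fun t : R => complex.Im (h (t^-1)%:C))).
  exact: (measurableT_comp mh measurable_inv_halfline).
by apply/funext => t; rewrite E.
Qed.

(** For t >= 1 the point z / t stays in the disc of radius |z| and t^-(j+1) <= 1 / t. The case j = 0
    is the Hausdorff integrand, j = 1 its derivative in z. *)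
Lemma dilation_cintegrable (g : R[i] -> R[i]) (z : R[i]) (M : R) j : 0 <= M ->
  (forall w, ccontinuous g w) -> (forall w, normc w <= normc z -> normc (g w) <= M) ->
  cintegrable mu halfline (fun t : R => g (z / t%:C) / (t ^+ j.+1)%:C).
Proof.
move=> M0 cg gM; have [mr mi] := measurable_dilation z cg.
have E t : g (z / t%:C) / (t ^+ j.+1)%:C = ((t ^+ j.+1)^-1)%:C * g (z / t%:C).
  by rewrite fmorphV mulrC.
have rE t : complex.Re (g (z / t%:C) / (t ^+ j.+1)%:C) =
    (t ^+ j.+1)^-1 * complex.Re (g (z / t%:C)).
  by rewrite E; case: (g _) => ? ? /=; rewrite mul0r subr0.
have iE t : complex.Im (g (z / t%:C) / (t ^+ j.+1)%:C) =
    (t ^+ j.+1)^-1 * complex.Im (g (z / t%:C)).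
  by rewrite E; case: (g _) => ? ? /=; rewrite mul0r addr0.
apply: (cintegrable_of_le M0 _ _ _).1.
- by rewrite (funext rE); apply: measurable_funM => //; exact: measurable_invX.
- by rewrite (funext iE); apply: measurable_funM => //; exact: measurable_invX.
move=> t t1; have t0 : 0 < t by rewrite (lt_le_trans _ t1).
rewrite E Normc.normcM normc_real ger0_norm ?invr_ge0 ?exprn_ge0 ?(ltW t0)// mulrC.
apply: ler_pM; rewrite ?normc_ge0 ?invr_ge0 ?exprn_ge0 ?(ltW t0)//.
  rewrite gM// Normc.normcM Normc.normcV normc_real gtr0_norm//.
  by rewrite ler_pdivrMr// ler_peMr ?normc_ge0.
by rewrite lef_pV2 ?posrE ?exprn_gt0// exprS ler_peMr ?(ltW t0)// exprn_ege1.
Qed.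

Lemma hausdorff_cintegrable (f : R[i] -> R[i]) : holomorphic f -> hausdorff_defined mu f.
Proof.
move=> hf z; have cf w : ccontinuous f w by exact: holomorphic_ccontinuous.
have [M M0 fM] := ccontinuous_bounded (normc z) cf.
have := dilation_cintegrable 0 (ltW M0) cf fM.
by congr cintegrable; apply/funext => t; rewrite expr1.
Qed.

(** Differentiation under the integral sign. For t >= 1 and |h| < 1 both z / t and (z + h) / t lie
    in the disc of radius |z| + 1, so the second-order remainder of f is at most M |h|^2 uniformly
    in t, and M |h|^2 / t is integrable. *)
Lemma hausdorff_entire (f : R[i] -> R[i]) : holomorphic f -> holomorphic (hausdorff mu f).
Proof.
move=> hf z; have [f' f'D] := choice hf.
have [M M0 [fM f'M f'L fT]] := holomorphic_local_bounds (normc z + 1) f'D.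
have cf w : ccontinuous f w by exact: holomorphic_ccontinuous.
(* Here [f'] comes from a choice of derivatives; its continuity, needed for measurability in t,
   follows from the local Lipschitz bound. *)
have cf' w : ccontinuous f' w.
  have [N N0 [_ _ H _]] := holomorphic_local_bounds (normc w + 1) f'D.
  move=> e e0; exists (Num.min 1 (e / N)); first by rewrite lt_min ltr01 divr_gt0.
  move=> v; rewrite lt_min => /andP[v1 ve].
  have := H w (v - w); rewrite [w + _]addrC subrK => /(_ _ _)/le_lt_trans; apply.
  - by rewrite lerDl.
  - by rewrite -(subrK w v) (le_trans (le_normcD _ _))// addrC lerD2l ltW.
  - by rewrite mulrC -ltr_pdivlMr.
have z1 : normc z <= normc z + 1 by rewrite lerDl.
have I' : cintegrable mu halfline (fun t : R => f' (z / t%:C) / (t ^+ 2)%:C).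
  apply: (dilation_cintegrable 1 (ltW M0) cf') => w wz; apply: f'M; exact: le_trans z1.
exists (cintegral mu halfline (fun t : R => f' (z / t%:C) / (t ^+ 2)%:C)) => e e0.
pose K := 2 * (M * mu0) + 1.
have K0 : 0 < K by rewrite ltr_wpDl// !mulr_ge0 ?mu0_ge0// ltW.
exists (Num.min 1 (e / K)); first by rewrite lt_min ltr01 divr_gt0.
move=> h; rewrite lt_min => /andP[h1 he].
have Iz := hausdorff_cintegrable hf z.
have Ih := hausdorff_cintegrable hf (z + h).
have [J1 E1] := cintegralB Ih Iz.
have [J2 E2] := cintegralZ h I'.
have [J3 E3] := cintegralB J1 J2.
rewrite /hausdorff -E1 -E2 -E3.
have [mr mi] : measurable_fun halfline (fun t => complex.Re (hausdorff_integrand f (z + h) t -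
    hausdorff_integrand f z t - h * (f' (z / t%:C) / (t ^+ 2)%:C))) /\
    measurable_fun halfline (fun t => complex.Im (hausdorff_integrand f (z + h) t -
    hausdorff_integrand f z t - h * (f' (z / t%:C) / (t ^+ 2)%:C))).
  by case: J3 => /measurable_int/measurable_EFinP j1 /measurable_int/measurable_EFinP j2.
have Mh0 : 0 <= M * normc h ^+ 2 by rewrite mulr_ge0 ?exprn_ge0 ?normc_ge0// ltW.
have [|_] := cintegrable_of_le Mh0 mr mi; last first.
  move=> /le_trans; apply.
  have -> : 2 * (M * normc h ^+ 2 * mu0) = 2 * (M * mu0) * normc h * normc h by ring.
  rewrite ler_wpM2r ?normc_ge0//.
  apply: (@le_trans _ _ (K * normc h)).
    by rewrite ler_wpM2r ?normc_ge0// /K lerDl.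
  by rewrite mulrC -ler_pdivlMr// ltW.
move=> t t1; have t0 : 0 < t by rewrite (lt_le_trans _ t1).
have tC : t%:C != 0 :> R[i] by rewrite eq_complex/= gt_eqF.
have -> : hausdorff_integrand f (z + h) t - hausdorff_integrand f z t -
    h * (f' (z / t%:C) / (t ^+ 2)%:C) =
    (f (z / t%:C + h / t%:C) - f (z / t%:C) - h / t%:C * f' (z / t%:C)) * (t^-1)%:C.
  rewrite /hausdorff_integrand -mulrDl rmorphXn fmorphV /=; field.
  exact: tC.
rewrite Normc.normcM normc_real ger0_norm ?invr_ge0 ?(ltW t0)//.
rewrite ler_wpM2r ?invr_ge0 ?(ltW t0)//.
have dil (w : R[i]) : normc (w / t%:C) <= normc w.
  rewrite Normc.normcM Normc.normcV normc_real gtr0_norm//.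
  by rewrite ler_pdivrMr// ler_peMr ?normc_ge0.
apply: le_trans (fT _ _ _ _) _.
- exact: le_trans (dil _) z1.
- rewrite -mulrDl (le_trans (dil _))// (le_trans (le_normcD _ _))//.
  by rewrite lerD2l ltW.
by rewrite ler_wpM2l ?(ltW M0)// lerXn2r ?nnegrE ?normc_ge0.
Qed.

End sufficiency.

(** * The norm inequality *)

Section norm_inequality.
Context {R : realType}.
Variable mu : {measure set (measurableTypeR R) -> \bar R}.
Local Notation leb := (@lebesgue_measure R).
Local Notation normc := (@Normc.normc R).
Local Notation halfline := (`]0%R, +oo[%classic : set R).
Variables (B : R) (B0 : 0 < B).
Hypothesis HB : forall n, (moment mu n <= (B / Num.sqrt n.+1%:R)%:E)%E.

Lemma normc_cintegral_le (psi : R -> R[i]) : cintegrable mu halfline psi ->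
  ((normc (cintegral mu halfline psi))%:E <= 2%:E * \int[mu]_(t in halfline) (normc (psi t))%:E)%E.
Proof.
move=> [ir ii].
have side (u : R -> R) : mu.-integrable halfline (EFin \o u) -> (forall t, `|u t| <= normc (psi t)) ->
    ((`|\int[mu]_(t in halfline) u t|)%:E <= \int[mu]_(t in halfline) (normc (psi t))%:E)%E.
  move=> iu un; have mu' := measurable_int _ iu.
  rewrite EFin_normr_Rintegral//; apply: le_trans (le_abse_integral mu _ mu') _ => //.
  apply: ge0_le_integral_nonmeas => t _ //; by rewrite lee_fin.
apply: le_trans (_ : (`|complex.Re (cintegral mu halfline psi)| +
    `|complex.Im (cintegral mu halfline psi)|)%:E <= _)%E.
  by rewrite lee_fin normc_le_ReIm.
rewrite EFinD mule_natl mule2n; apply: leeD.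
  by apply: side => // t; exact: normc_Re.
by apply: side => // t; exact: normc_Im.
Qed.

Lemma exp_transform_series (x : R) : 0 <= x ->
  (exp_transform mu x = \sum_(n <oo) (x ^+ n / n`!%:R)%:E * moment mu n)%E.
Proof.
move=> x0; have c0 n : 0 <= x ^+ n / n`!%:R by rewrite divr_ge0// exprn_ge0.
transitivity (\int[mu]_(t in halfline)
    \sum_(n <oo) (x ^+ n / n`!%:R * (t ^+ n.+1)^-1)%:E)%E.
  apply: eq_integral => t; rewrite inE => /halflineP t0.
  rewrite -[expR _ / t]mul1r exp_kernel_series//.
  by apply: eq_eseriesr => n _; rewrite mul1r.
rewrite integral_nneseries//; last 2 first.
- by move=> k; apply/measurable_EFinP; apply: measurable_funM => //; exact: measurable_invX.
- by move=> k t /halflineP t0; rewrite lee_fin mulr_ge0// invr_ge0 exprn_ge0// ltW.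
apply: eq_eseriesr => k _; under eq_integral do rewrite EFinM.
rewrite ge0_integralZl_EFin//.
- by move=> t /halflineP t0; rewrite lee_fin invr_ge0 exprn_ge0// ltW.
- by apply/measurable_EFinP; exact: measurable_invX.
Qed.

(** Measurability in the parameter is read off the moment series, as Tonelli's theorem is not at
    hand for [mu]. *)
Lemma measurable_exp_transform d (T : measurableType d) (D : set T) (phi : T -> R) :
  measurable_fun D phi -> (forall x, D x -> 0 <= phi x) ->
  measurable_fun D (fun x => exp_transform mu (phi x)).
Proof.
move=> mphi phi0.
apply: (eq_measurable_fun (fun x => \sum_(n <oo) (phi x ^+ n / n`!%:R)%:E * moment mu n)%E).
  by move=> x; rewrite inE => Dx; rewrite exp_transform_series// phi0.
apply: ge0_emeasurable_sum => n.
  by move=> x Dx _; rewrite mule_ge0 ?moment_ge0// lee_fin divr_ge0// exprn_ge0// phi0.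
move=> _; apply: emeasurable_funM; last exact: measurable_cst.
by apply/measurable_EFinP; apply: measurable_funM => //; exact: measurable_funX.
Qed.

(** The exponent is [alpha], not [alpha / 2] as in the norm, because the pointwise bound produces
    this weight. *)
Definition fock_weight (f : R[i] -> R[i]) (alpha : R) (p : R * R) : R :=
  normc (f (p.1 +i* p.2)) * expR (- alpha * normc (p.1 +i* p.2) ^+ 2).

Lemma fock_weight_ge0 f alpha p : 0 <= fock_weight f alpha p.
Proof. by rewrite mulr_ge0 ?normc_ge0 ?expR_ge0. Qed.

Lemma measurable_fock_weight f alpha : holomorphic f ->
  measurable_fun [set: R * R] (fock_weight f alpha).
Proof. exact: measurable_weight. Qed.

Lemma measurable_scaled_modulus (c : R) :
  measurable_fun [set: R * R] (fun p => c * normc (p.1 +i* p.2)).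
Proof. by apply: measurable_funM => //; exact: measurable_normc_plane. Qed.

(** The pointwise bound is applied at z / t. There t enters only through exp (alpha |z| |w| / t),
    whose integral against dmu(t) / t is the exponential transform. The additional factor 2 comes
    from bounding real and imaginary parts separately. *)
Lemma normc_hausdorff_le (f : R[i] -> R[i]) (alpha : R) (z : R[i]) : 0 < alpha ->
  holomorphic f ->
  ((normc (hausdorff mu f z))%:E <= (2 * (16 * expR (2 * alpha)))%:E *
    \int[leb \x leb]_p ((fock_weight f alpha p)%:E *
      exp_transform mu (alpha * normc z * normc (p.1 +i* p.2))))%E.
Proof.
move=> a0 hf; set c := 16 * _.
have c0 : 0 <= c by rewrite mulr_ge0 ?expR_ge0.
have Iz := hausdorff_cintegrable B0 HB hf z.
have E (t : R) : 0 < t -> normc (hausdorff_integrand f z t) = t^-1 * normc (f (z / t%:C)).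
  by move=> t0; rewrite Normc.normcM Normc.normcV normc_real gtr0_norm// mulrC.
have [mr mi] := measurable_dilation z (fun w => holomorphic_ccontinuous w hf).
rewrite EFinM -muleA; apply: le_trans (normc_cintegral_le Iz) _.
rewrite lee_pmul2l//.
have mF := measurable_fock_weight alpha hf.
have mphi := measurable_scaled_modulus (alpha * normc z).
have phi0 p : 0 <= alpha * normc z * normc (p.1 +i* p.2) by rewrite !mulr_ge0 ?normc_ge0// ltW.
have -> : (c%:E * \int[leb \x leb]_p ((fock_weight f alpha p)%:E *
      exp_transform mu (alpha * normc z * normc (p.1 +i* p.2))) =
   \int[leb \x leb]_p ((c * fock_weight f alpha p)%:E *
      exp_transform mu (alpha * normc z * normc (p.1 +i* p.2))))%E.
  rewrite -ge0_integralZl_EFin//; last 2 first.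
  - by move=> p _; rewrite mule_ge0 ?exp_transform_ge0// lee_fin fock_weight_ge0.
  - apply: emeasurable_funM; first exact/measurable_EFinP.
    exact: measurable_exp_transform.
  by apply: eq_integral => p _; rewrite muleA -EFinM.
have mcF : measurable_fun [set: R * R] (fun p => c * fock_weight f alpha p) by exact: measurable_funM.
have cF0 p : [set: R * R] p -> 0 <= c * fock_weight f alpha p by rewrite mulr_ge0 ?fock_weight_ge0.
have S := exp_transform_swap mu (leb \x leb)%E measurableT mcF mphi cF0 (fun p _ => phi0 p).
cbv beta in S; rewrite S {S}.
apply: ge0_le_integral_nonmeas => t /halflineP t0; first by rewrite lee_fin normc_ge0.
rewrite E// EFinM.
have zt : normc (z / t%:C) = normc z / t.
  by rewrite Normc.normcM Normc.normcV normc_real gtr0_norm.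
have mk := measurable_fock_kernel alpha (normc z / t) hf.
have k0 p : 0 <= fock_kernel f alpha (normc z / t) p by rewrite !mulr_ge0 ?normc_ge0 ?expR_ge0.
have -> : (\int[leb \x leb]_x (c * fock_weight f alpha x *
     (expR (alpha * normc z * normc (x.1 +i* x.2) / t) / t))%:E =
   t^-1%:E * (c%:E * \int[leb \x leb]_p (fock_kernel f alpha (normc z / t) p)%:E))%E.
  rewrite muleA -EFinM -ge0_integralZl_EFin//; last 3 first.
  - by move=> p _; rewrite lee_fin.
  - exact/measurable_EFinP.
  - by rewrite mulr_ge0// invr_ge0 ltW.
  apply: eq_integral => p _; rewrite -EFinM; congr EFin; rewrite /fock_kernel /fock_weight.
  have -> : alpha * (normc z / t) * normc (p.1 +i* p.2) = alpha * normc z * normc (p.1 +i* p.2) / t.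
    by ring.
  by ring.
rewrite lee_wpmul2l ?lee_fin ?invr_ge0 ?(ltW t0)//.
by rewrite -zt; exact: weighted_mean.
Qed.

(** The upper radial bound with b = alpha rho / t produces precisely the integrand of
    [exp_moments_le]. *)
Lemma radial_exp_transform_le (alpha : R) : 0 < alpha -> exists2 C : R, 0 < C & forall rho, 0 <= rho ->
  (\int[leb]_(r in halfline) ((radial_weight alpha r)%:E * exp_transform mu (alpha * rho * r)) <=
   (C * expR (alpha * rho ^+ 2 / 2))%:E)%E.
Proof.
move=> a0; have [C C0 HC] := radial_integral_le a0.
exists (C * (B * (2 + alpha))); first by rewrite !mulr_gt0// addr_gt0.
move=> rho rho0; have ar0 : 0 <= alpha * rho by rewrite mulr_ge0// ltW.
have mrad : measurable_fun halfline (radial_weight alpha).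
  have := @measurable_radial R alpha 0 halfline; congr measurable_fun.
  by apply/funext => r; rewrite mul0r expR0 mulr1.
rewrite exp_transform_swap//; last 2 first.
- by move=> r /halflineP; exact: radial_weight_ge0.
- by move=> r /halflineP r0; rewrite mulr_ge0// ltW.
rewrite -mulrA EFinM; apply: le_trans (lee_wpmul2l _ (exp_moments_le B0 HB a0 rho0)); last first.
  by rewrite lee_fin ltW.
rewrite -ge0_integralZl_EFin ?(ltW C0)//; last 2 first.
- move=> t /halflineP t0; rewrite lee_fin mulr_ge0 ?divr_ge0 ?expR_ge0 ?(ltW t0)//.
  by rewrite addr_ge0// divr_ge0// ltW.
- apply/measurable_EFinP; apply: measurable_funM.
    apply: measurable_funD => //; apply: measurable_funM => //; exact: measurable_inv_halfline.
  apply: measurable_funM; last exact: measurable_inv_halfline.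
  apply: measurableT_comp => //; apply: measurable_funM => //; exact: measurable_invX.
apply: ge0_le_integral_nonmeas => t /halflineP t0.
  apply: integral_ge0 => r /halflineP r0.
  rewrite lee_fin; apply: mulr_ge0; first exact: radial_weight_ge0.
  by rewrite divr_ge0 ?expR_ge0// ltW.
have -> : (\int[leb]_(r in halfline) (radial_weight alpha r * (expR (alpha * rho * r / t) / t))%:E =
    t^-1%:E * \int[leb]_(r in halfline) (radial_weight alpha r * expR (alpha * rho / t * r))%:E)%E.
  rewrite -ge0_integralZl_EFin ?invr_ge0 ?(ltW t0)//; last 2 first.
  - by move=> r /halflineP r0; rewrite lee_fin mulr_ge0 ?expR_ge0 ?radial_weight_ge0.
  - by apply/measurable_EFinP; exact: measurable_radial.
  by apply: eq_integral => r _; rewrite -EFinM; congr EFin; rewrite [alpha * rho * r / t]mulrAC; ring.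
have kt0 : 0 <= alpha * rho / t by rewrite divr_ge0// ltW.
apply: le_trans (lee_wpmul2l _ (HC _ kt0)) _; first by rewrite lee_fin invr_ge0 ltW.
rewrite -!EFinM lee_fin le_eqVlt; apply/orP; left; apply/eqP.
have -> : (alpha * rho / t) ^+ 2 / (2 * alpha) = alpha * rho ^+ 2 / 2 / t ^+ 2.
  by field; rewrite !gt_eqF.
by field; rewrite !gt_eqF.
Qed.

Lemma radial_plane_swap (h : R -> R) (F : R * R -> R) (alpha : R) : 0 < alpha ->
  measurable_fun halfline h -> measurable_fun [set: R * R] F ->
  (forall r, halfline r -> 0 <= h r) -> (forall p, 0 <= F p) ->
  (\int[leb]_(r in halfline) ((h r)%:E * \int[leb \x leb]_p
     ((F p)%:E * exp_transform mu (alpha * r * normc (p.1 +i* p.2)))) =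
   \int[leb \x leb]_p ((F p)%:E * \int[leb]_(r in halfline)
     ((h r)%:E * exp_transform mu (alpha * normc (p.1 +i* p.2) * r))))%E.
Proof.
move=> a0 mh mF h0 F0.
pose m n := fine (moment mu n).
(* Finite moments can serve as real coefficients of a series whose terms are products of a function
   of r and a function of p. *)
have mE n : moment mu n = (m n)%:E by rewrite /m fineK// (moment_fin B0 HB).
have m0 n : 0 <= m n by rewrite fine_ge0// moment_ge0.
pose u n (r : R) := h r * r ^+ n.
pose v n (p : R * R) := F p * ((alpha * normc (p.1 +i* p.2)) ^+ n / n`!%:R * m n).
have an0 p : 0 <= alpha * normc (p.1 +i* p.2) by rewrite mulr_ge0 ?normc_ge0// ltW.
have ker r p : halfline r -> ((h r)%:E * ((F p)%:E * exp_transform mu (alpha * normc (p.1 +i* p.2) * r)) =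
    \sum_(n <oo) (u n r * v n p)%:E)%E.
  move=> r0; rewrite exp_transform_series; last by rewrite mulr_ge0// ltW// halflineP.
  rewrite muleA -EFinM -nneseriesZl; last first.
    move=> n _; rewrite mE -EFinM lee_fin mulr_ge0// divr_ge0// exprn_ge0// mulr_ge0//.
    exact/ltW/halflineP.
  apply: eq_eseriesr => n _; rewrite mE -!EFinM; congr EFin; rewrite /u /v exprMn; ring.
have mn := measurable_scaled_modulus.
transitivity (\int[leb]_(r in halfline) \int[leb \x leb]_p \sum_(n <oo) (u n r * v n p)%:E)%E.
  apply: eq_integral => r; rewrite inE => r0.
  rewrite -ge0_integralZl_EFin ?h0//; last 2 first.
  - by move=> p _; rewrite mule_ge0 ?exp_transform_ge0// lee_fin.
  - apply: emeasurable_funM; first exact/measurable_EFinP.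
    apply: measurable_exp_transform => [|p _]; first exact: mn.
    by rewrite mulr_ge0 ?normc_ge0// mulr_ge0// ltW// halflineP.
  by apply: eq_integral => p _; rewrite -(ker r p r0) [alpha * r * _]mulrAC.
rewrite series_kernel_swap//.
- apply: eq_integral => p _.
  rewrite -ge0_integralZl_EFin//; last 2 first.
  - by move=> r r0; rewrite mule_ge0 ?exp_transform_ge0// lee_fin h0.
  - apply: emeasurable_funM; first exact/measurable_EFinP.
    apply: measurable_exp_transform => [|r /halflineP r0]; first exact: measurable_funM.
    by rewrite mulr_ge0// ltW.
  by apply: eq_integral => r; rewrite inE => r0; rewrite -(ker r p r0) muleCA.
- by move=> n; apply: measurable_funM => //; exact: measurable_funX.
- move=> n; apply: measurable_funM => //; apply: measurable_funM => //.
  apply: measurable_funM => //; apply: measurable_funX; exact: mn.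
- by move=> n r r0; rewrite mulr_ge0 ?h0// exprn_ge0// ltW// halflineP.
- by move=> n p _; rewrite mulr_ge0// mulr_ge0// divr_ge0// exprn_ge0.
Qed.

Lemma mixed_norm_hausdorff_le (alpha : R) : 0 < alpha -> exists2 C : R, 0 < C &
  forall f, holomorphic f ->
  (mixed_fock_norm alpha (hausdorff mu f) <= C%:E * fock1_norm alpha f)%E.
Proof.
move=> a0; have [K K0 HK] := radial_exp_transform_le a0.
pose c := 2 * (16 * expR (2 * alpha)).
have c0 : 0 < c by rewrite !mulr_gt0 ?expR_gt0.
have pi2 : 0 < 2 * pi :> R by rewrite mulr_gt0// pi_gt0.
(* The factor [2 * pi] cancels the normalization of the norm of F^1. *)
exists (2 * pi * (c * K)); first by rewrite mulr_gt0// mulr_gt0.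
move=> f hf.
have mF := measurable_fock_weight alpha hf.
have mrad : measurable_fun halfline (radial_weight alpha).
  have := @measurable_radial R alpha 0 halfline; congr measurable_fun.
  by apply/funext => r; rewrite mul0r expR0 mulr1.
have mcrad : measurable_fun halfline (fun r => c * radial_weight alpha r) by exact: measurable_funM.
have crad0 r : halfline r -> 0 <= c * radial_weight alpha r.
  by move=> /halflineP r0; rewrite mulr_ge0 ?radial_weight_ge0// ltW.
apply: (@le_trans _ _ (alpha%:E * \int[leb]_(r in halfline) ((c * radial_weight alpha r)%:E *
    \int[leb \x leb]_p ((fock_weight f alpha p)%:E *
     exp_transform mu (alpha * r * normc (p.1 +i* p.2)))))%E).
  rewrite /mixed_fock_norm lee_pmul2l//.
  have M0 r : 0 < r -> (0 <= Minfty (hausdorff mu f) r)%E.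
    move=> r0; apply: (@le_trans _ _ (normc (hausdorff mu f r%:C))%:E).
      by rewrite lee_fin normc_ge0.
    by apply: ereal_sup_ubound; exists r%:C => //=; rewrite expr0n addr0 sqrtr_sqr gtr0_norm.
  apply: ge0_le_integral_nonmeas => r /halflineP r0.
    by rewrite mule_ge0 ?M0// lee_fin radial_weight_ge0.
  have -> : (c * radial_weight alpha r)%:E = ((radial_weight alpha r)%:E * c%:E)%E.
    by rewrite -EFinM mulrC.
  rewrite -/(radial_weight alpha r) [leLHS]muleC -muleA.
  apply: lee_wpmul2l; first by rewrite lee_fin radial_weight_ge0.
  (* The bound depends on z only through |z|, so it passes to the supremum over the circle. *)
  apply: ge_ereal_sup => _ [z zr <-]; rewrite -zr.
  exact: normc_hausdorff_le.
rewrite (radial_plane_swap a0 mcrad mF crad0 (fock_weight_ge0 f alpha)).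
have mw := measurable_weight (- (alpha / 2)) hf.
rewrite /fock1_norm muleA -EFinM.
have -> : 2 * pi * (c * K) * (alpha / (2 * pi)) = alpha * (c * K).
  by rewrite mulrAC [2 * pi * (alpha / _)]mulrC divfK ?gt_eqF.
rewrite EFinM -muleA lee_pmul2l//.
rewrite -ge0_integralZl_EFin ?mulr_ge0 ?(ltW c0) ?(ltW K0)//; last 2 first.
- by move=> p _; rewrite lee_fin mulr_ge0 ?normc_ge0 ?expR_ge0.
- exact/measurable_EFinP.
apply: ge0_le_integral_nonmeas => p _.
  rewrite mule_ge0 ?lee_fin ?fock_weight_ge0//; apply: integral_ge0 => r r0.
  by rewrite mule_ge0 ?exp_transform_ge0// lee_fin crad0.
set q := normc (p.1 +i* p.2).
have q0 : 0 <= q by exact: normc_ge0.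
have -> : (\int[leb]_(r in halfline) ((c * radial_weight alpha r)%:E * exp_transform mu (alpha * q * r)) =
    c%:E * \int[leb]_(r in halfline) ((radial_weight alpha r)%:E * exp_transform mu (alpha * q * r)))%E.
  rewrite -ge0_integralZl_EFin ?(ltW c0)//; last 2 first.
  - by move=> r /halflineP r0; rewrite mule_ge0 ?exp_transform_ge0// lee_fin radial_weight_ge0.
  - apply: emeasurable_funM; first exact/measurable_EFinP.
    apply: measurable_exp_transform => [|r /halflineP r0]; first exact: measurable_funM.
    by rewrite !mulr_ge0// ltW.
  by apply: eq_integral => r _; rewrite muleA -EFinM.
apply: le_trans (lee_wpmul2l _ (lee_wpmul2l _ (HK q q0))) _.
- by rewrite lee_fin fock_weight_ge0.
- by rewrite lee_fin ltW.
rewrite -!EFinM lee_fin /fock_weight -/q.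
(* One half of the exponent is the weight of F^1, the other cancels the growth of the radial
   integral. *)
have -> : - alpha * q ^+ 2 = - (alpha / 2) * q ^+ 2 - alpha * q ^+ 2 / 2 by field.
rewrite expRD expRN le_eqVlt; apply/orP; left; apply/eqP.
by field; rewrite gt_eqF// expR_gt0.
Qed.

End norm_inequality.

Theorem theorem5p5 (R : realType) (alpha : R)
    (mu : {measure set (measurableTypeR R) -> \bar R}) (alpha_gt0 : 0 < alpha) :
  hausdorff_bounded mu (fock1 alpha) (fock1_norm alpha)
                       (mixed_fock alpha) (mixed_fock_norm alpha) <->
  (ereal_sup (range (fun n : nat => moment mu n * (Num.sqrt (n.+1%:R : R))%:E))
     < +oo)%E.
Proof.
split; first exact: bounded_moments.
move=> /moments_le[B B0 HB].
have [C C0 HC] := mixed_norm_hausdorff_le B0 HB alpha_gt0.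
split; last by exists C; split => // f [/entireP hf _]; exact: HC.
move=> f [/entireP hf fn]; split; first exact: hausdorff_cintegrable B0 HB _ hf.
split; first by apply/entireP; exact: hausdorff_entire B0 HB _ hf.
apply: le_lt_trans (HC _ hf) _.
have f0 : (0 <= fock1_norm alpha f)%E.
  rewrite mule_ge0//; first by rewrite lee_fin divr_ge0 ?mulr_ge0 ?pi_ge0// ltW.
  by apply: integral_ge0 => p _; rewrite lee_fin mulr_ge0 ?normc_ge0 ?expR_ge0.
by rewrite -(@fineK _ (fock1_norm alpha f)) ?ge0_fin_numE// -EFinM ltry.
Qed.
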